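(* Let $m=(m_1,m_2,m_3)\in(\mathbb{R}^+)^3$ with $m_1+m_2+m_3=1$, let $e_1,e_2,e_3\in\mathbb{R}$, and let $\delta_{ij}=1-\frac{e_ie_j}{m_im_j}$. Suppose $\delta_{12},\delta_{23},\delta_{31}>0$ and $\delta_{ij}^{1/3}+\delta_{jk}^{1/3}>\delta_{ki}^{1/3}$ for every cyclic permutation $(i,j,k)$ of $(1,2,3)$. Let $\tau>0$ and $k=(1,1,1)$ or $k=(-1,-1,-1)$. Then: (i) $\displaystyle\inf_{q\in X_{\tau,k}}f(q)=\Big(\sum_{(i,j)\in P}m_im_j\delta_{ij}^{2/3}\Big)\,3\cdot 2^{-1/3}\pi^{2/3}\tau^{1/3}$; (ii) the elliptic triangle solutions of the charged three-body problem (lying in $X_{\tau,k}$) attain the minimum of $f$ on $X_{\tau,k}$; (iii) every regular (i.e. $C^2$) minimizer of $f$ on $X_{\tau,k}$ is an elliptic triangle solution.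
   Context: $P=\{(1,2),(2,3),(3,1)\}$. The configuration space is $\hat{\mathcal X}=\{q=(q_1,q_2,q_3)\in(\mathbb{R}^2)^3:\sum_i m_iq_i=0,\ q_i\ne q_j\ \forall i\ne j\}$. For a closed curve $u:S^1\to\mathbb{R}^2\setminus\{0\}$, ${\rm ind}(u,0)$ is its winding number (degree) around the origin. For $k=(k_{12},k_{23},k_{31})\in\mathbb{Z}^3$, $\Omega_{\tau,k}=\{q\in C^\infty(\mathbb{R}/\tau\mathbb{Z},\hat{\mathcal X}):{\rm ind}(q_i-q_j,0)=k_{ij}\ \forall (i,j)\in P\}$, and $X_{\tau,k}$ is the $W^{1,2}$-completion of $\Omega_{\tau,k}$. The functional is $f(q)=\int_0^\tau\big(\tfrac12\sum_{i=1}^3m_i|\dot q_i(t)|^2+U(q(t))\big)dt$ with $U(q)=\sum_{i<j}m_im_j\delta_{ij}/|q_i-q_j|$. The charged three-body problem is $m_i\ddot q_i=\sum_{j\ne i}\frac{m_im_j\delta_{ij}}{|q_i-q_j|^3}(q_j-q_i)$. An elliptic triangle solution is a solution of the form $q_i(t)=r(t)R(\theta(t))a_i$, $i=1,2,3$, where $R(\varphi)$ is rotation by $\varphi$, $(a_1,a_2,a_3)$ is a non-collinear central configuration of the charged problem (distinct $a_i$ with $\lambda m_ia_i+\partial U/\partial q_i(a)=0$ for some $\lambda$), and $r(t)(\cos\theta(t),\sin\theta(t))$ is a (collision-free) elliptic Kepler orbit, here $\tau$-periodic. *)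

(* Defs.v *)
From HB Require Import structures.
From mathcomp Require Import all_boot all_order all_algebra.
From mathcomp Require Import all_classical all_reals all_analysis.
Set Implicit Arguments. Unset Strict Implicit. Unset Printing Implicit Defensive.
Import Order.TTheory GRing.Theory Num.Theory numFieldNormedType.Exports.
Local Open Scope classical_set_scope.
Local Open Scope ring_scope.

Definition b1 : 'I_3 := @Ordinal 3 0 isT.
Definition b2 : 'I_3 := @Ordinal 3 1 isT.
Definition b3 : 'I_3 := @Ordinal 3 2 isT.
Definition x0 : 'I_2 := @Ordinal 2 0 isT.
Definition x1 : 'I_2 := @Ordinal 2 1 isT.

Section Defs.
Variable R : realType.

(* A path in (R^2)^3: q i c t = c-th coordinate of body i at time t. *)
Definition loop := 'I_3 -> 'I_2 -> R -> R.
Definition config := 'I_3 -> 'I_2 -> R.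

Definition periodic (tau : R) (g : R -> R) := forall t, g (t + tau) = g t.

Definition smooth (g : R -> R) := forall (n : nat) (t : R), derivable (derive1n n g) t 1.

Definition C2 (g : R -> R) :=
  (forall t, derivable g t 1) /\ (forall t, derivable (derive1 g) t 1) /\
  continuous (derive1n 2 g).

Definition winding (tau : R) (u1 u2 : R -> R) (k : int) :=
  exists th : R -> R, {within `[0, tau], continuous th} /\
    (forall t, 0 <= t <= tau ->
       u1 t = Num.sqrt (u1 t ^+ 2 + u2 t ^+ 2) * cos (th t) /\
       u2 t = Num.sqrt (u1 t ^+ 2 + u2 t ^+ 2) * sin (th t)) /\
    th tau - th 0 = 2 * pi * k%:~R.

Definition dist (x : config) (i j : 'I_3) : R :=
  Num.sqrt ((x i x0 - x j x0) ^+ 2 + (x i x1 - x j x1) ^+ 2).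

Definition at_time (q : loop) (t : R) : config := fun i c => q i c t.

Definition Omega (m : 'I_3 -> R) (tau : R) (k12 k23 k31 : int) (q : loop) :=
  (forall i c, smooth (q i c) /\ periodic tau (q i c)) /\
  (forall c t, \sum_(i < 3) m i * q i c t = 0) /\
  (forall i j t, i != j -> exists c, q i c t != q j c t) /\
  winding tau (fun t => q b1 x0 t - q b2 x0 t) (fun t => q b1 x1 t - q b2 x1 t) k12 /\
  winding tau (fun t => q b2 x0 t - q b3 x0 t) (fun t => q b2 x1 t - q b3 x1 t) k23 /\
  winding tau (fun t => q b3 x0 t - q b1 x0 t) (fun t => q b3 x1 t - q b1 x1 t) k31.

Definition sqint (tau : R) (g : R -> R) : \bar R :=
  (\int[lebesgue_measure]_(t in `[0%R, tau]%classic) ((g t) ^+ 2)%:E)%E.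

(* q is a tau-periodic W^{1,2} path with weak derivative v
   (absolutely continuous with L^2 derivative v). *)
Definition weak_deriv (tau : R) (q v : loop) :=
  forall i c, periodic tau (q i c) /\ measurable_fun `[0, tau] (v i c) /\
    (sqint tau (v i c) < +oo)%E /\
    forall t, 0 <= t <= tau ->
      ((q i c t)%:E = (q i c 0)%:E + \int[lebesgue_measure]_(s in `[0%R, t]%classic) (v i c s)%:E)%E.

Definition dist2 (tau : R) (q v p w : loop) : \bar R :=
  (\sum_(i < 3) \sum_(c < 2)
     (sqint tau (fun t => q i c t - p i c t)%R + sqint tau (fun t => v i c t - w i c t)%R))%E.

(* (q, v) with q in X_{tau,k} (the W^{1,2}-closure of Omega_{tau,k}; W^{1,2} of
   the circle being complete, this is its completion) and v its weak derivative. *)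
Definition Xset (m : 'I_3 -> R) (tau : R) (k12 k23 k31 : int) (q v : loop) :=
  weak_deriv tau q v /\
  forall eps : R, 0 < eps -> exists p : loop, Omega m tau k12 k23 k31 p /\
    (dist2 tau q v p (fun i c => derive1 (p i c)) < eps%:E)%E.

Definition delta (m e : 'I_3 -> R) (i j : 'I_3) : R := 1 - e i * e j / (m i * m j).

Definition Uterm (m e : 'I_3 -> R) (x : config) (i j : 'I_3) : R :=
  m i * m j * delta m e i j / dist x i j.

Definition U (m e : 'I_3 -> R) (x : config) : \bar R :=
  if [exists i, exists j, (i != j) && [forall c, x i c == x j c]] then +oo%E
  else (Uterm m e x b1 b2 + Uterm m e x b2 b3 + Uterm m e x b3 b1)%:E.

Definition action (m e : 'I_3 -> R) (tau : R) (q v : loop) : \bar R :=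
  (\int[lebesgue_measure]_(t in `[0%R, tau]%classic)
     ((2^-1 * \sum_(i < 3) m i * \sum_(c < 2) (v i c t) ^+ 2)%:E + U m e (at_time q t)))%E.

Definition fvals (m e : 'I_3 -> R) (tau : R) (k12 k23 k31 : int) : set (\bar R) :=
  [set a | exists q v, Xset m tau k12 k23 k31 q v /\ a = action m e tau q v].

Definition solves (m e : 'I_3 -> R) (q : loop) :=
  (forall i c t, derivable (q i c) t 1 /\ derivable (derive1 (q i c)) t 1) /\
  (forall i j t, i != j -> exists c, q i c t != q j c t) /\
  forall i c t, m i * derive1n 2 (q i c) t =
    \sum_(j < 3 | j != i) m i * m j * delta m e i j * (q j c t - q i c t)
                          / dist (at_time q t) i j ^+ 3.

Definition dU (m e : 'I_3 -> R) (x : config) (i : 'I_3) (c : 'I_2) : R :=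
  \sum_(j < 3 | j != i) - (m i * m j * delta m e i j * (x i c - x j c) / dist x i j ^+ 3).

Definition noncollinear (a : config) :=
  (a b2 x0 - a b1 x0) * (a b3 x1 - a b1 x1) - (a b2 x1 - a b1 x1) * (a b3 x0 - a b1 x0) != 0.

Definition central_config (m e : 'I_3 -> R) (a : config) :=
  (forall i j, i != j -> exists c, a i c != a j c) /\ noncollinear a /\
  exists lam : R, forall i c, lam * m i * a i c + dU m e a i c = 0.

Definition kepler_elliptic (tau : R) (y : 'I_2 -> R -> R) :=
  exists mu : R, 0 < mu /\
   (forall c, periodic tau (y c) /\
      forall t, derivable (y c) t 1 /\ derivable (derive1 (y c)) t 1) /\
   forall t, 0 < Num.sqrt (y x0 t ^+ 2 + y x1 t ^+ 2) /\
     (forall c, derive1n 2 (y c) t =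
        - mu * y c t / Num.sqrt (y x0 t ^+ 2 + y x1 t ^+ 2) ^+ 3) /\
     2^-1 * (derive1 (y x0) t ^+ 2 + derive1 (y x1) t ^+ 2)
       - mu / Num.sqrt (y x0 t ^+ 2 + y x1 t ^+ 2) < 0.

Definition rot (phi : R) (p : 'I_2 -> R) (c : 'I_2) : R :=
  if c == x0 then cos phi * p x0 - sin phi * p x1 else sin phi * p x0 + cos phi * p x1.

Definition elliptic_triangle (m e : 'I_3 -> R) (tau : R) (q : loop) :=
  solves m e q /\
  exists (r th : R -> R) (a : config),
    central_config m e a /\
    kepler_elliptic tau (fun c t => r t * (if c == x0 then cos (th t) else sin (th t))) /\
    forall i c t, q i c t = r t * rot (th t) (a i) c.

End Defs.

(* Main.v *)
(* The kinetic energy splits over the pairs: since the masses sum to 1 and the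
   centre of mass is fixed, the action is the sum of m_i m_j J_ij(q_i - q_j) with
   J(u) = \int 1/2 |u'|^2 + delta/|u|, so everything reduces to Gordon's theorem
   for one Kepler problem.  That theorem is proved by calibration.  A loop of
   winding number +-1 meets two opposite rays: u(0) = |u(0)| e, u(t2) = -|u(t2)| e.
   With sigma' = 1/|u|, S = sigma(tau), w = pi/S, c_k = cot(w sigma + alpha_k)
   singular at 0 resp. t2, and G = |u| -+ u.e,
     1/2 |u'|^2 = 1/2 |u' - w p|^2 + (w (c1 G1 + c2 G2))' + 2 w^2,
     p = (c1 + c2) u/|u| + (c2 - c1) e
   (Levi-Civita regularization followed by Wirtinger's inequality, without the
   square root).  Hence J(u) >= 2 pi^2 tau/S^2 + delta S, which is minimal at
   delta S^3 = 4 pi^2 tau.  Replacing |u| by sqrt(|u|^2 + eps^2) and pi by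
   pi - 2 eta keeps all terms smooth, and gives the bound on the whole
   W^{1,2}-closure, collisions included.  Equality forces u' = w p, which is a
   Kepler orbit; conversely a Kepler orbit winding once satisfies w S = pi.
   For a C^2 minimizer the three Kepler equations add up to
   sum delta_ij u_ij/|u_ij|^3 = 0; the triangle inequality for delta^(1/3)
   excludes collinear positions, so |u_ij|^3 is proportional to delta_ij at all
   times and the triangle keeps its shape. *)
Require Import Defs.
From HB Require Import structures.
From mathcomp Require Import all_boot all_order all_algebra.
From mathcomp Require Import all_classical all_reals all_analysis.
From mathcomp Require Import measurable_realfun.
From mathcomp Require Import ring lra.
Import Order.TTheory GRing.Theory Num.Theory numFieldNormedType.Exports.
Local Open Scope classical_set_scope.
Local Open Scope ring_scope.
Set Implicit Arguments.
Unset Strict Implicit.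
Unset Printing Implicit Defensive.

(** Along loops that approach a collision the action need not converge to the action of the limit,
    so a bound for smooth loops does not by itself pass to the W^{1,2}-closure. The potential
    1/sqrt(|u|^2 + eps^2) is smaller than 1/|u| and, for fixed eps, W^{1,2}-continuous. It can
    replace 1/|u| because the loss in the Kepler bound is made small by an eps that depends on the
    tolerance but not on the loop. In the calibration, eps acts as a constant third coordinate of u,
    orthogonal to e, so that the identity survives with one more square. The poles of cot sit at the
    times where u is on a ray and the factor G vanishes. Moving them off by eta leaves boundary
    terms of size cot(eta) eps, whence eta is fixed before eps. The winding number enters the lower
    bound only through the two opposite rays. The three Kepler bounds are proved separately; they
    are attained together because a triangle with sides proportional to delta^(1/3) exists, and
    rotating it uniformly solves all three Kepler problems with the same period. *)

Section Calculus.
Variable R : realType.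
Implicit Types (f g h : R -> R) (a b t : R).

Lemma is_derive_continuous f t (d : R) : is_derive t 1 f d -> {for t, continuous f}.
Proof. by move=> H; exact/differentiable_continuous/derivable1_diffP. Qed.

Lemma is_derive_continuous_within f f' a b :
  (forall t, a <= t <= b -> is_derive t 1 f (f' t)) -> {within `[a, b], continuous f}.
Proof.
move=> H; apply: continuous_in_subspaceT => t /set_mem /=; rewrite in_itv/= => tab.
exact: is_derive_continuous (H t tab).
Qed.

Lemma is_derive_ge0_le f f' a b : a <= b ->
  (forall t, a <= t <= b -> is_derive t 1 f (f' t)) ->
  (forall t, a < t < b -> 0 <= f' t) -> f a <= f b.
Proof.
rewrite le_eqVlt => /predU1P[->//|ab] df f'0.
have [|c] := @MVT R f f' a b ab _ (is_derive_continuous_within df).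
  move=> t; rewrite in_itv/= => /andP[at_ tb]; apply: df; by rewrite !ltW.
rewrite in_itv/= => /f'0 c0 E; rewrite -subr_ge0 E mulr_ge0// subr_ge0; exact: ltW.
Qed.

Lemma is_derive_eq0_const f f' a b : a <= b ->
  (forall t, a <= t <= b -> is_derive t 1 f (f' t)) ->
  (forall t, a < t < b -> f' t = 0) -> f a = f b.
Proof.
move=> ab df f'0; apply/eqP; rewrite eq_le (is_derive_ge0_le ab df)/=; last first.
  by move=> t /f'0 ->.
rewrite -lerN2; apply: (@is_derive_ge0_le (fun x => - f x) (fun x => - f' x)) => //.
  move=> t /df ?; exact: is_deriveN.
by move=> t /f'0 ->; rewrite oppr0.
Qed.

(** Serves to differentiate identities that are known only on an open interval. *)
Lemma is_derive_oo_eq0 f a b t (d : R) : a < t < b ->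
  (forall s, a < s < b -> f s = 0) -> is_derive t 1 f d -> d = 0.
Proof.
move=> /andP[at_ tb] f0 df.
have [_ <-] := df.
have [_ <-] : is_derive t 1 f 0; last by [].
apply: (@near_eq_is_derive _ _ _ (cst 0)); rewrite ?oner_eq0//.
have : \forall s \near t, s \in `]a, b[%R by apply: near_in_itvoo; rewrite in_itv/= at_.
by apply: filterS => s; rewrite in_itv/= => /f0 ->.
Qed.

(** The integral starts at -1 rather than 0, so that 0 is an interior point and the derivative there
    is two-sided. *)
Lemma antiderivative h : continuous h ->
  exists2 H : R -> R, H 0 = 0 & forall t, -1 < t -> is_derive t 1 H (h t).
Proof.
move=> ch.
suff [F dF] : exists F : R -> R, forall t, -1 < t -> derivable F t 1 /\ derive1 F t = h t.
  exists (fun x => F x - F 0) => [|t /dF[dFt F'E]]; first by rewrite subrr.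
  have dF' : is_derive t 1 F (h t) by split => //; rewrite -derive1E.
  by apply: is_derive_eq; rewrite subr0.
exists (fun x => (\int[lebesgue_measure]_(t in [set` `[-1, x]]) h t)%R) => t t1.
apply: (@continuous_FTC1_closed R h (-1) t (t + 1)) => //; first by rewrite ltrDl.
apply: continuous_compact_integrable; first exact: segment_compact.
exact: continuous_subspaceT.
exact: ch.
Qed.

Lemma integral_antiderivative h H a b : a < b -> continuous h ->
  (forall t, a <= t <= b -> is_derive t 1 H (h t)) ->
  (\int[lebesgue_measure]_(t in `[a, b]) (h t)%:E = (H b - H a)%:E)%E.
Proof.
move=> ab ch dH.
rewrite (@continuous_FTC2 R h H a b ab).
- by rewrite EFinB.
- exact: continuous_subspaceT.
- split.
  + move=> x; rewrite in_itv/= => /andP[ax xb].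
    by have [] := dH x; rewrite ?ltW.
  + apply: cvg_at_right_filter; apply: is_derive_continuous (dH a _).
    by rewrite lexx ltW.
  + apply: cvg_at_left_filter; apply: is_derive_continuous (dH b _).
    by rewrite lexx ltW.
- move=> x; rewrite in_itv/= => /andP[ax xb].
  by rewrite derive1E; have [|_ ->] := dH x; rewrite ?ltW.
Qed.

End Calculus.

(** * Calibration *)

Section Calibration.
Variable R : realType.
Implicit Types (x y K sig f g : R -> R) (t eps w : R).

Definition cot (z : R) : R := cos z / sin z.

Definition rho eps x y t : R := Num.sqrt (x t ^+ 2 + y t ^+ 2 + eps ^+ 2).

Lemma is_derive_comp f g t (a b : R) :
  is_derive t 1 g b -> is_derive (g t) 1 f a -> is_derive t 1 (fun s => f (g s)) (a * b).
Proof. by move=> dg df; exact: is_derive1_comp. Qed.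

Lemma is_derive_cot (z : R) : sin z != 0 -> is_derive z 1 cot (- (1 + cot z ^+ 2)).
Proof.
move=> s0; have dV := is_deriveV s0 (is_derive_sin z).
have := is_deriveM (is_derive_cos z) dV.
move/is_derive_eq; apply; rewrite /cot /GRing.scale /=.
by field.
Qed.

Lemma is_derive_sqrt f t (a : R) : 0 < f t -> is_derive t 1 f a ->
  is_derive t 1 (fun s => Num.sqrt (f s)) (a / (2 * Num.sqrt (f t))).
Proof.
move=> f0 df; have := is_derive_comp df (is_derive1_sqrt f0).
by rewrite mulrC.
Qed.

Lemma rho_ge0 eps x y t : 0 <= rho eps x y t. Proof. exact: sqrtr_ge0. Qed.

Lemma sqr_rho eps x y t : rho eps x y t ^+ 2 = x t ^+ 2 + y t ^+ 2 + eps ^+ 2.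
Proof. by rewrite sqr_sqrtr// !addr_ge0// sqr_ge0. Qed.

Lemma is_derive_rho eps x y t (dx dy : R) : 0 < rho eps x y t ->
  is_derive t 1 x dx -> is_derive t 1 y dy ->
  is_derive t 1 (rho eps x y) ((x t * dx + y t * dy) / rho eps x y t).
Proof.
move=> r0 Dx Dy; have r0' := r0; rewrite sqrtr_gt0 in r0.
pose n s := x s ^+ 2 + y s ^+ 2 + eps ^+ 2.
have D : is_derive t 1 n (2 * (x t * dx + y t * dy)).
  by apply: is_derive_eq; rewrite /GRing.scale /=; ring.
have := @is_derive_sqrt n _ _ r0 D; rewrite /n -/(rho eps x y t) => /is_derive_eq; apply.
by field; rewrite gt_eqF.
Qed.

(** Primitive form of the calibration: [K] stands for a primitive of the kinetic energy and [sig]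
    for one of [1/rho]. Once the exact terms are subtracted, only a sum of squares is left in the
    derivative. *)
Definition calib K sig x y eps (e1 e2 w a1 a2 : R) t : R :=
  K t - w * (cot (w * sig t + a1) * (rho eps x y t - (x t * e1 + y t * e2))
           + cot (w * sig t + a2) * (rho eps x y t + (x t * e1 + y t * e2)))
  - 2 * w ^+ 2 * t.

(** Read u = (x, y, eps), of norm [rho], with u' = (dx, dy, 0) and e = (e1, e2, 0): the three
    squares are the coordinates of u' - w p. The identity uses only |u / rho| = 1 and |e| = 1. *)
Lemma is_derive_calib K sig x y eps (e1 e2 w a1 a2 dx dy : R) t :
  e1 ^+ 2 + e2 ^+ 2 = 1 -> 0 < rho eps x y t ->
  is_derive t 1 x dx -> is_derive t 1 y dy ->
  is_derive t 1 K (2^-1 * (dx ^+ 2 + dy ^+ 2)) ->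
  is_derive t 1 sig (rho eps x y t)^-1 ->
  sin (w * sig t + a1) != 0 -> sin (w * sig t + a2) != 0 ->
  let c1 := cot (w * sig t + a1) in let c2 := cot (w * sig t + a2) in
  let r := rho eps x y t in
  is_derive t 1 (calib K sig x y eps e1 e2 w a1 a2)
    (2^-1 * ((dx - w * ((c1 + c2) * (x t / r) + (c2 - c1) * e1)) ^+ 2
           + (dy - w * ((c1 + c2) * (y t / r) + (c2 - c1) * e2)) ^+ 2
           + (w * ((c1 + c2) * (eps / r))) ^+ 2)).
Proof.
move=> e12 r0 Dx Dy DK Ds s1 s2 /=.
have Dr := is_derive_rho r0 Dx Dy.
have Dc (a : R) : sin (w * sig t + a) != 0 ->
    is_derive t 1 (fun s => cot (w * sig s + a))
      (- (1 + cot (w * sig t + a) ^+ 2) * (w / rho eps x y t)).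
  move=> sa; have Da : is_derive t 1 (fun s => w * sig s + a) (w / rho eps x y t).
    by apply: is_derive_eq; rewrite /GRing.scale /=; ring.
  exact: is_derive_comp Da (is_derive_cot sa).
have Dc1 := Dc a1 s1; have Dc2 := Dc a2 s2.
rewrite /calib.
apply: is_derive_eq.
rewrite /GRing.scale /=.
set r := rho eps x y t in r0 Dc1 Dc2 *.
have nr : r != 0 by rewrite gt_eqF.
have Hr : (x t / r) ^+ 2 + (y t / r) ^+ 2 + (eps / r) ^+ 2 = 1.
  by rewrite !expr_div_n -!mulrDl -(sqr_rho eps x y t) divff// expf_neq0.
move: (cot (_ + a2)) (cot (_ + a1)) => c2 c1.
have Ex : x t = r * (x t / r) by field.
have Ey : y t = r * (y t / r) by field.
move: Hr Ex Ey.
set a := x t / r; set b := y t / r; set c := eps / r => Hr -> ->.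
clearbody a b c.
apply: subr0_eq.
transitivity (- (2^-1 * w ^+ 2 * (c1 + c2) ^+ 2) * (a ^+ 2 + b ^+ 2 + c ^+ 2 - 1)
  - 2^-1 * w ^+ 2 * (c2 - c1) ^+ 2 * (e1 ^+ 2 + e2 ^+ 2 - 1)).
  by field.
by rewrite Hr e12 subrr !mulr0 subrr.
Qed.

End Calibration.

(** * Kinetic energy of a closed curve that meets two opposite rays *)

Section Gordon.
Variable R : realType.
Implicit Types (eta t : R).

(** The data on which the calibration runs. Of the winding number only this is kept: u is on the ray
    of e at time 0 and on the opposite ray at time [t2]. For [eps] = 0 the field [gl_rho] says that
    u never vanishes on the period. *)
Record gordon_loop (x y dx dy K sig : R -> R) (tau eps e1 e2 t2 a b : R) : Prop := {
  gl_tau : 0 < tau;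
  gl_unit : e1 ^+ 2 + e2 ^+ 2 = 1;
  gl_x : forall t, 0 <= t <= tau -> is_derive t 1 x (dx t);
  gl_y : forall t, 0 <= t <= tau -> is_derive t 1 y (dy t);
  gl_K : forall t, 0 <= t <= tau ->
    is_derive t 1 K (2^-1 * (dx t ^+ 2 + dy t ^+ 2));
  gl_sig : forall t, 0 <= t <= tau -> is_derive t 1 sig (rho eps x y t)^-1;
  gl_sig0 : sig 0 = 0;
  gl_rho : forall t, 0 <= t <= tau -> 0 < rho eps x y t;
  gl_xper : x tau = x 0;
  gl_yper : y tau = y 0;
  gl_a : 0 <= a;
  gl_b : 0 <= b;
  gl_t2 : 0 <= t2 <= tau;
  gl_ray0 : x 0 = a * e1 /\ y 0 = a * e2;
  gl_ray2 : x t2 = - b * e1 /\ y t2 = - b * e2 }.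

Variables (x y dx dy K sig : R -> R) (tau eps e1 e2 t2 a b : R).
Hypothesis D : gordon_loop x y dx dy K sig tau eps e1 e2 t2 a b.

Let tau_gt0 := gl_tau D.
Let e12 := gl_unit D.
Let Dx := gl_x D.
Let Dy := gl_y D.
Let DK := gl_K D.
Let Ds := gl_sig D.
Let sig0 := gl_sig0 D.
Let rho_gt0 := gl_rho D.
Let xper := gl_xper D.
Let yper := gl_yper D.
Let a_ge0 := gl_a D.
Let b_ge0 := gl_b D.
Let t2P := gl_t2 D.
Let u0E := gl_ray0 D.
Let u2E := gl_ray2 D.


Lemma sig_incr s t : 0 <= s -> s < t -> t <= tau -> sig s < sig t.
Proof.
move=> s0 st tt.
have Dst r : s <= r <= t -> is_derive r 1 sig (rho eps x y r)^-1.
  by move=> /andP[sr rt]; apply: Ds; rewrite (le_trans s0 sr) (le_trans rt tt).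
have [|c] := @MVT R sig (fun r => (rho eps x y r)^-1) s t st _ (is_derive_continuous_within Dst).
  by move=> r; rewrite in_itv/= => /andP[? ?]; apply: Dst; rewrite !ltW.
rewrite in_itv/= => /andP[sc ct] E; rewrite -subr_gt0 E mulr_gt0 ?subr_gt0//.
by rewrite invr_gt0 rho_gt0// (le_trans s0 (ltW sc)) (le_trans (ltW ct) tt).
Qed.

Lemma sig_ndecr s t : 0 <= s -> s <= t -> t <= tau -> sig s <= sig t.
Proof.
move=> s0; rewrite le_eqVlt => /predU1P[->//|st] tt; apply: ltW; exact: sig_incr.
Qed.

Lemma sig_tau_gt0 : 0 < sig tau.
Proof. by rewrite -sig0 sig_incr. Qed.

Definition freq eta := (pi - 2 * eta) / sig tau.

(* The second phase ends at pi - eta on [0, t2] and restarts from eta on [t2, tau],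
   so that no pole of cot is met; at time tau it is back to its value at 0. *)
Definition calib1 eta :=
  calib K sig x y eps e1 e2 (freq eta) eta (freq eta * (sig tau - sig t2) + eta).
Definition calib2 eta :=
  calib K sig x y eps e1 e2 (freq eta) eta (eta - freq eta * sig t2).

Lemma freqS eta : freq eta * sig tau = pi - 2 * eta.
Proof. by rewrite /freq  divfK// gt_eqF// sig_tau_gt0. Qed.

Lemma freq_angle eta s : 0 <= eta <= pi / 2 -> 0 <= s <= sig tau ->
  eta <= freq eta * s + eta <= pi - eta.
Proof.
move=> /andP[e0 e1'] /andP[s0 sS].
have w0 : 0 <= freq eta by rewrite /freq divr_ge0 ?(ltW sig_tau_gt0)//; lra.
have := freqS eta; have := mulr_ge0 w0 s0; have := ler_wpM2l w0 sS.
move: (freq eta * s) (freq eta * sig tau) => p q ? ? ?; lra.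
Qed.

Lemma sin_freq_neq0 eta s : 0 < eta < pi / 2 -> 0 <= s <= sig tau ->
  sin (freq eta * s + eta) != 0.
Proof.
move=> /andP[e0 e1'] sS.
have /andP[h1 h2] : eta <= freq eta * s + eta <= pi - eta.
  by apply: freq_angle => //; rewrite !ltW.
by rewrite gt_eqF// sin_gt0_pi//; apply/andP; split; lra.
Qed.

Lemma calib_derive eta a1 a2 t : 0 <= t <= tau ->
  let w := freq eta in
  sin (w * sig t + a1) != 0 -> sin (w * sig t + a2) != 0 ->
  let c1 := cot (w * sig t + a1) in
  let c2 := cot (w * sig t + a2) in
  let r := rho eps x y t in
  is_derive t 1 (calib K sig x y eps e1 e2 w a1 a2)
    (2^-1 * ((dx t - w * ((c1 + c2) * (x t / r) + (c2 - c1) * e1)) ^+ 2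
           + (dy t - w * ((c1 + c2) * (y t / r) + (c2 - c1) * e2)) ^+ 2
           + (w * ((c1 + c2) * (eps / r))) ^+ 2)).
Proof.
move=> tt; apply: is_derive_calib => //; [exact: rho_gt0|exact: Dx|exact: Dy|exact: DK|exact: Ds].
Qed.

Lemma calib_ndecr eta a1 a2 s t : 0 <= s -> s <= t -> t <= tau ->
  (forall r, s <= r <= t -> sin (freq eta * sig r + a1) != 0 /\
                            sin (freq eta * sig r + a2) != 0) ->
  calib K sig x y eps e1 e2 (freq eta) a1 a2 s <=
  calib K sig x y eps e1 e2 (freq eta) a1 a2 t.
Proof.
move=> s0 st tt nz; apply: (is_derive_ge0_le st) => [r rst|r _].
  have [n1 n2] := nz r rst.
  apply: calib_derive => //; case/andP: rst => sr rt.
  by rewrite (le_trans s0 sr) (le_trans rt tt).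
by rewrite /= mulr_ge0 ?invr_ge0// !addr_ge0// sqr_ge0.
Qed.

Lemma calib1_ndecr eta s t : 0 < eta < pi / 2 -> 0 <= s -> s <= t -> t <= t2 ->
  calib1 eta s <= calib1 eta t.
Proof.
move=> h s0 st tt; case/andP: t2P => t20 t2t.
apply: calib_ndecr => // [|r /andP[sr rt]]; first exact: le_trans tt t2t.
have r0 : 0 <= r := le_trans s0 sr.
have rt2 : r <= t2 := le_trans rt tt.
have m0 : 0 <= sig r by rewrite -sig0 sig_ndecr// (le_trans rt2).
have m1 : sig r <= sig t2 by rewrite sig_ndecr.
have m2 : sig t2 <= sig tau by rewrite sig_ndecr.
split; first by apply: sin_freq_neq0 => //; rewrite m0 (le_trans m1).
rewrite addrA -mulrDr; apply: sin_freq_neq0 => //.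
by apply/andP; split; lra.
Qed.

Lemma calib2_ndecr eta s t : 0 < eta < pi / 2 -> t2 <= s -> s <= t -> t <= tau ->
  calib2 eta s <= calib2 eta t.
Proof.
move=> h s0 st tt; case/andP: t2P => t20 t2t.
apply: calib_ndecr => // [|r /andP[sr rt]]; first exact: le_trans t20 s0.
have r0 : t2 <= r := le_trans s0 sr.
have rt2 : r <= tau := le_trans rt tt.
have m0 : 0 <= sig t2 by rewrite -sig0 sig_ndecr.
have m1 : sig t2 <= sig r by rewrite sig_ndecr.
have m2 : sig r <= sig tau by rewrite sig_ndecr// (le_trans t20).
split; first by apply: sin_freq_neq0 => //; rewrite m2 (le_trans m0).
rewrite (_ : _ + _ = freq eta * (sig r - sig t2) + eta); last by ring.
apply: sin_freq_neq0 => //; apply/andP; split; lra.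
Qed.

Lemma cotBpi (z : R) : cot (pi - z) = - cot z.
Proof. by rewrite /cot cosB sinB cospi sinpi !mul0r addr0 sub0r !mulN1r opprK mulNr. Qed.

(** Around the loop all cot terms cancel except where a phase jumps from pi - eta back to eta: the
    first phase between tau and 0, the second at [t2]. Since u is then on a ray, the accompanying G
    equals rho - a, resp. rho - b, and the jump gives it the factor 2 cot(eta). *)
Lemma calib_total eta : 0 < eta < pi / 2 ->
  (calib1 eta t2 - calib1 eta 0) + (calib2 eta tau - calib2 eta t2) =
  K tau - K 0 - 2 * freq eta ^+ 2 * tau + 2 * freq eta * cot eta *
  ((rho eps x y 0 - a) + (rho eps x y t2 - b)).
Proof.
move=> _; rewrite /calib1 /calib2 /calib sig0 !mulr0 !add0r.
have -> : rho eps x y tau = rho eps x y 0 by rewrite /rho xper yper.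
rewrite xper yper .
have -> : freq eta * sig t2 + (freq eta * (sig tau - sig t2) + eta) = pi - eta.
  by have := freqS eta; rewrite mulrBr; move: (freq _ * sig tau) (freq _ * sig t2) => p q; lra.
have -> : freq eta * sig t2 + (eta - freq eta * sig t2) = eta by ring.
have -> : freq eta * sig tau + eta = pi - eta by rewrite freqS; ring.
have -> : freq eta * sig tau + (eta - freq eta * sig t2) = freq eta * (sig tau - sig t2) + eta by ring.
rewrite !cotBpi.
have [-> ->] := u0E; have [-> ->] := u2E.
apply: subr0_eq; transitivity (2 * freq eta * cot eta * (a + b) * (1 - (e1 ^+ 2 + e2 ^+ 2))).
  ring.
by rewrite e12 subrr mulr0.
Qed.

Lemma rho_ray (c s : R) t : 0 <= eps -> 0 <= c -> s ^+ 2 = 1 -> x t = s * c * e1 -> y t = s * c * e2 ->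
  c <= rho eps x y t <= c + eps.
Proof.
move=> ep c0 s1 xt yt.
have E : x t ^+ 2 + y t ^+ 2 = c ^+ 2.
  by rewrite xt yt !exprMn s1 mul1r -mulrDr e12 mulr1.
have r0 := rho_ge0 eps x y t.
have := sqr_rho eps x y t; rewrite E => E2.
apply/andP; split; rewrite -(@ler_pXn2r _ 2)// ?nnegrE ?addr_ge0// E2.
  by rewrite lerDl sqr_ge0.
by rewrite sqrrD lerD2r lerDl mulrn_wge0// mulr_ge0.
Qed.

(** Both increments of the calibration are nonnegative, and on a ray G is at most [eps], which
    bounds the two jump terms. *)
Lemma gordon_sum_ge eta : 0 <= eps -> 0 < eta < pi / 2 ->
  2 * freq eta ^+ 2 * tau - 4 * freq eta * cot eta * eps <= K tau - K 0.
Proof.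
move=> ep h; case/andP: t2P => t20 t2t.
have := calib1_ndecr h (lexx 0) t20 (lexx t2).
have := calib2_ndecr h (lexx t2) t2t (lexx tau).
have := calib_total h.
have /andP[h1 h2] := h.
have c0 : 0 <= cot eta.
  by rewrite /cot divr_ge0// ltW// ?cos_gt0_pihalf ?sin_gt0_pi//; apply/andP; split; lra.
have w0 : 0 <= freq eta by rewrite /freq divr_ge0 ?(ltW sig_tau_gt0)//; lra.
have [x0E y0E] := u0E; have [x2E y2E] := u2E.
have /andP[_ A1] : a <= rho eps x y 0 <= a + eps.
  by apply: (@rho_ray _ 1) => //; rewrite ?expr1n// mul1r.
have /andP[_ A2] : b <= rho eps x y t2 <= b + eps.
  by apply: (@rho_ray _ (-1)) => //; rewrite ?sqrrN ?expr1n// mulN1r.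
have /(ler_wpM2l (mulr_ge0 w0 c0)) : (rho eps x y 0 - a) + (rho eps x y t2 - b) <= 2 * eps by lra.
move: (rho _ _ _ 0 - a + _) => G HG E Q2 Q1.
have E1 : 2 * freq eta * cot eta * G = 2 * (freq eta * cot eta * G) by ring.
have E2 : 4 * freq eta * cot eta * eps = 2 * (freq eta * cot eta * (2 * eps)) by ring.
rewrite E1 in E; rewrite E2.
lra.
Qed.
End Gordon.

(** * The bound for one pair, uniform in the loop *)

Section GordonBound.
Variable R : realType.

(** [S] depends on the loop and has to be eliminated. The square of (pi - 2 eta)/S is replaced by
    its tangent at pi/S0, and 1/S by its tangent at [S0]; the term linear in [S] that appears is
    absorbed by delta S, because delta S0^3 = 4 pi^2 tau. *)
Lemma gordon_sum_linear (tau S S0 delta eta c eps k : R) :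
  0 < tau -> 0 < S -> 0 < S0 -> delta * S0 ^+ 3 = 4 * pi ^+ 2 * tau ->
  0 < eta < pi / 2 -> 0 <= c * eps <= pi / S0 * tau ->
  2 * ((pi - 2 * eta) / S) ^+ 2 * tau - 4 * ((pi - 2 * eta) / S) * c * eps <= k ->
  8 * (pi - 2 * eta) * (pi / S0 * tau - c * eps) / S0 - 2 * (pi / S0) ^+ 2 * tau
  <= k + delta * S.
Proof.
move=> t0 S_gt0 S0_gt0 dS /andP[e0 e1] /andP[c0 c1] Hk.
have th0 : 0 < pi - 2 * eta by lra.
have thpi : pi - 2 * eta <= pi by lra.
move: (pi - 2 * eta) th0 thpi Hk => th th0 thpi Hk.
pose s0 := S0^-1; pose v := S^-1.
have dE : delta = 4 * pi ^+ 2 * tau * s0 ^+ 3.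
  by rewrite -dS /s0; field; rewrite gt_eqF.
pose m := pi * s0 * tau - c * eps.
have m0 : 0 <= m by rewrite subr_ge0.
have mle : m <= pi * s0 * tau by rewrite gerBl.
have H1 : 4 * th * v * m - 2 * (pi * s0) ^+ 2 * tau <= k.
  apply: le_trans Hk; rewrite -subr_ge0.
  rewrite (_ : _ - _ = 2 * tau * (th * v - pi * s0) ^+ 2); last by rewrite /m /v; ring.
  by rewrite mulr_ge0 ?sqr_ge0// mulr_ge0// ltW.
have H2 : 2 * s0 - S * s0 ^+ 2 <= v.
  rewrite -subr_ge0 (_ : _ - _ = v * (1 - S * s0) ^+ 2).
    by rewrite mulr_ge0 ?sqr_ge0// invr_ge0 ltW.
  by rewrite /v; field; rewrite gt_eqF.
have tm : 0 <= 4 * th * m by rewrite !mulr_ge0// ltW.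
have H4 : th * m <= pi * (pi * s0 * tau) by rewrite ler_pM// ltW.
have H5 := ler_wpM2l (mulr_ge0 (ltW S_gt0) (sqr_ge0 s0)) H4.
apply: (@le_trans _ _ (8 * th * m * s0 - 2 * (pi * s0) ^+ 2 * tau)); first by [].
by rewrite dE; nra.
Qed.

(** [eps0] is chosen before the loop; this uniformity is what lets the bound pass to limits of
    loops. The constant 6 pi^2 tau / S0^2 is the value of 2 pi^2 tau / S^2 + delta S at its minimum
    S = S0. *)
Lemma gordon_regularized (tau S0 delta gam : R) :
  0 < tau -> 0 < S0 -> delta * S0 ^+ 3 = 4 * pi ^+ 2 * tau -> 0 < gam ->
  exists2 eps0 : R, 0 < eps0 & forall eps, 0 <= eps <= eps0 ->
  forall x y dx dy K sig e1 e2 t2 a b,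
  gordon_loop x y dx dy K sig tau eps e1 e2 t2 a b ->
  6 * pi ^+ 2 * tau / S0 ^+ 2 - gam <= K tau - K 0 + delta * sig tau.
Proof.
move=> t0 S0_gt0 dS g0; have p0 := pi_gt0 R.
pose w0 := pi / S0; have w00 : 0 < w0 by rewrite divr_gt0.
(* Shortening pi to pi - 2 eta costs 16 eta w0 tau / S0, which this choice keeps below gam/2. *)
pose eta := Num.min (pi / 4) (gam * S0 / (32 * (w0 * tau))).
have eta0 : 0 < eta by rewrite lt_min !(divr_gt0, mulr_gt0).
have etapi : eta <= pi / 4 by rewrite ge_min lexx.
have etag : 16 * eta * (w0 * tau) / S0 <= gam / 2.
  have H : eta <= gam * S0 / (32 * (w0 * tau)) by rewrite ge_min lexx orbT.
  have k0 : 0 < 32 * (w0 * tau) by rewrite mulr_gt0// mulr_gt0.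
  by rewrite ler_pdivlMr // in H; rewrite ler_pdivrMr//; lra.
have c0 : 0 < cot eta.
  by rewrite /cot divr_gt0// ?cos_gt0_pihalf ?sin_gt0_pi//; apply/andP; split; lra.
(* The first bound keeps w0 tau - cot(eta) eps nonnegative; the second keeps the contribution of the
   jumps below the other gam/2. *)
exists (Num.min (w0 * tau / cot eta) (gam * S0 / (16 * (pi * cot eta)))).
  have k0 : 0 < 16 * (pi * cot eta) by rewrite mulr_gt0// mulr_gt0.
  have k1 : 0 < w0 * tau by rewrite mulr_gt0.
  have k2 : 0 < gam * S0 by rewrite mulr_gt0.
  by rewrite lt_min; apply/andP; split; exact: divr_gt0.
move=> eps /andP[ep]; rewrite le_min => /andP[ep1 ep2] x y dx dy K sig e1 e2 t2 a b D.
have h : 0 < eta < pi / 2 by rewrite eta0; lra.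
have := gordon_sum_ge D ep h; rewrite /freq.
have S_gt0 := sig_tau_gt0 D.
have ce : 0 <= cot eta * eps <= pi / S0 * tau.
  by apply/andP; split; [rewrite mulr_ge0// ltW|rewrite mulrC -ler_pdivlMr].
move=> /(gordon_sum_linear t0 S_gt0 S0_gt0 dS h ce); apply: le_trans.
have {}ep2 : 8 * pi * (cot eta * eps) / S0 <= gam / 2.
  have k0 : 0 < 16 * (pi * cot eta) by rewrite mulr_gt0// mulr_gt0.
  by rewrite ler_pdivlMr// in ep2; rewrite ler_pdivrMr//; lra.
rewrite -/w0; have /andP[ce0 _] := ce.
have E : 8 * (pi - 2 * eta) * (w0 * tau - cot eta * eps) / S0 - 2 * w0 ^+ 2 * tau =
  6 * pi ^+ 2 * tau / S0 ^+ 2 - 16 * eta * (w0 * tau) / S0 - 8 * pi * (cot eta * eps) / S0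
  + 16 * eta * (cot eta * eps) / S0.
  by rewrite /w0; field; rewrite gt_eqF.
have : 0 <= 16 * eta * (cot eta * eps) / S0.
  by apply: divr_ge0 (ltW S0_gt0); apply: mulr_ge0 => //; apply: mulr_ge0 (ltW eta0).
rewrite E; lra.
Qed.

(** At eta = 0 the phases reach the poles of cot, so statements there are obtained as limits from
    eta > 0. *)
Lemma le_at0 (F G : R -> R) (h : R) : 0 < h ->
  {for 0, continuous F} -> {for 0, continuous G} ->
  (forall eta, 0 < eta < h -> F eta <= G eta) -> F 0 <= G 0.
Proof.
move=> h0 cF cG FG.
have cF' : F @ 0^'+ --> F 0 by apply: cvg_at_right_filter.
have cG' : G @ 0^'+ --> G 0 by apply: cvg_at_right_filter.
apply: (ler_cvg_to cF' cG'); near=> z; apply: FG; apply/andP; split.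
  by near: z; exact: nbhs_right_gt.
by near: z; exact: nbhs_right_lt.
Unshelve. all: by end_near. Qed.

End GordonBound.

(** * The equality case, without regularization *)

Section Rigidity.
Variable R : realType.
Implicit Types (eta t : R).

Lemma eq0_closed_itv (F : R -> R) lo hi : lo < hi -> continuous F ->
  (forall t, lo < t < hi -> F t = 0) -> forall t, lo <= t <= hi -> F t = 0.
Proof.
move=> lh cF F0.
have ends (G : R -> R) : {for 0, continuous G} -> (forall s, 0 < s < hi - lo -> G s = 0) -> G 0 = 0.
  move=> cG G0; apply/eqP; rewrite eq_le.
  have d0 : 0 < hi - lo by rewrite subr_gt0.
  rewrite (@le_at0 _ G (cst 0) (hi - lo) d0) ?(@le_at0 _ (cst 0) G (hi - lo) d0)//.
  - exact: cst_continuous.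
  - by move=> s /G0 ->.
  - exact: cst_continuous.
  - by move=> s /G0 ->.
move=> t /andP[]; rewrite le_eqVlt => /predU1P[<- _|lt_t].
  rewrite -[lo]addr0; apply: (ends (fun s => F (lo + s))).
    apply: continuous_comp; last exact: cF.
    by apply: continuousD; [exact: cst_continuous|exact: cvg_id].
  by move=> s /andP[s0 s1]; apply: F0; apply/andP; split; lra.
rewrite le_eqVlt => /predU1P[->|th]; last by apply: F0; rewrite lt_t.
rewrite -[hi]subr0; apply: (ends (fun s => F (hi - s))).
  apply: continuous_comp; last exact: cF.
  by apply: continuousB; [exact: cst_continuous|exact: cvg_id].
by move=> s /andP[s0 s1]; apply: F0; apply/andP; split; lra.
Qed.

Variables (x y dx dy K sig : R -> R) (tau e1 e2 t2 a b : R).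
Hypothesis D : gordon_loop x y dx dy K sig tau 0 e1 e2 t2 a b.

Let S := sig tau.
Let k := K tau - K 0.
Notation fr := (freq sig tau).

Lemma rho_ray0 : rho 0 x y 0 = a /\ rho 0 x y t2 = b.
Proof.
have [x0E y0E] := gl_ray0 D; have [x2E y2E] := gl_ray2 D.
have /andP[A1 A2] : a <= rho 0 x y 0 <= a + 0.
  by apply: (rho_ray D (s := 1)); rewrite ?expr1n ?mul1r ?(gl_a D).
have /andP[A3 A4] : b <= rho 0 x y t2 <= b + 0.
  by apply: (rho_ray D (s := -1)); rewrite ?sqrrN ?expr1n ?mulN1r ?(gl_b D).
by split; apply/eqP; rewrite eq_le; lra.
Qed.

Lemma calib_total0 eta : 0 < eta < pi / 2 ->
  (calib1 x y K sig tau 0 e1 e2 t2 eta t2 - calib1 x y K sig tau 0 e1 e2 t2 eta 0)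
  + (calib2 x y K sig tau 0 e1 e2 t2 eta tau - calib2 x y K sig tau 0 e1 e2 t2 eta t2) =
  k - 2 * fr eta ^+ 2 * tau.
Proof. by move=> h; rewrite (calib_total D h); have [-> ->] := rho_ray0; rewrite !subrr addr0 mulr0 addr0. Qed.

Lemma freq_is_derive eta : is_derive eta 1 (fr) (- 2 / S).
Proof. by rewrite /freq; apply: is_derive_eq; rewrite /GRing.scale /S/=; ring. Qed.

Lemma calib_eta_continuous (A : R -> R) (dA : R) t : is_derive (0 : R) 1 A dA ->
  sin (fr 0 * sig t) != 0 -> sin (fr 0 * sig t + A 0) != 0 ->
  {for 0, continuous (fun eta => calib K sig x y 0 e1 e2 (fr eta) eta (A eta) t)}.
Proof.
move=> HA s1 s2; have Df := freq_is_derive 0.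
have D1 : is_derive (0 : R) 1 (fun eta => fr eta * sig t + eta) (- 2 / S * sig t + 1).
  by apply: is_derive_eq; rewrite /GRing.scale /=; ring.
have D2 : is_derive (0 : R) 1 (fun eta => fr eta * sig t + A eta) (- 2 / S * sig t + dA).
  by apply: is_derive_eq; rewrite /GRing.scale /=; ring.
rewrite -[fr 0 * sig t]addr0 in s1.
rewrite /calib; apply: (@is_derive_continuous _ _ _ _).
Qed.

Lemma fr0E : fr 0 = pi / S. Proof. by rewrite /freq mulr0 subr0. Qed.

(** [A] is the second phase as a function of eta. On [lo, hi] the calibration is monotone with total
    increment at most k - 2 fr^2 tau, which tends to 0 with eta when [k] is minimal. At interior
    times no pole is met even for eta = 0, so the limit calibration is constant there, and the
    squares in its derivative vanish. *)
Lemma calib_rigid (lo hi : R) (A : R -> R) (dA : R) :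
  is_derive (0 : R) 1 A dA -> 0 <= lo -> hi <= tau -> k = 2 * (pi / S) ^+ 2 * tau ->
  (forall eta, 0 < eta < pi / 2 -> forall s t, lo <= s -> s <= t -> t <= hi ->
    calib K sig x y 0 e1 e2 (fr eta) eta (A eta) s <=
    calib K sig x y 0 e1 e2 (fr eta) eta (A eta) t) ->
  (forall eta, 0 < eta < pi / 2 ->
    calib K sig x y 0 e1 e2 (fr eta) eta (A eta) hi -
    calib K sig x y 0 e1 e2 (fr eta) eta (A eta) lo <= k - 2 * fr eta ^+ 2 * tau) ->
  (forall t, lo < t < hi -> sin (fr 0 * sig t) != 0 /\ sin (fr 0 * sig t + A 0) != 0) ->
  forall t, lo < t < hi ->
  let c1 := cot (fr 0 * sig t + 0) in let c2 := cot (fr 0 * sig t + A 0) in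
  dx t = fr 0 * ((c1 + c2) * (x t / rho 0 x y t) + (c2 - c1) * e1) /\
  dy t = fr 0 * ((c1 + c2) * (y t / rho 0 x y t) + (c2 - c1) * e2).
Proof.
move=> HA lo0 hit kE mono tot nz.
pose Q eta t := calib K sig x y 0 e1 e2 (fr eta) eta (A eta) t.
have cQ t : lo < t < hi -> {for 0, continuous (Q ^~ t)}.
  by move=> /nz[n1 n2]; exact: (calib_eta_continuous HA).
have pih : 0 < pi / 2 :> R by rewrite divr_gt0// pi_gt0.
have cst s t : lo < s -> s <= t -> t < hi -> Q 0 s = Q 0 t.
  move=> ls st th.
  have cs : {for 0, continuous (Q ^~ s)} by apply: cQ; rewrite ls (le_lt_trans st).
  have ct : {for 0, continuous (Q ^~ t)} by apply: cQ; rewrite th (lt_le_trans ls).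
  apply/eqP; rewrite eq_le; apply/andP; split.
    apply: (@le_at0 _ (Q ^~ s) (Q ^~ t) (pi / 2)) => // eta h.
    by apply: mono => //; exact: ltW.
  pose G eta := Q eta s + (k - 2 * fr eta ^+ 2 * tau).
  have -> : Q 0 s = G 0 by rewrite /G fr0E kE subrr addr0.
  apply: (@le_at0 _ (Q ^~ t) G (pi / 2)) => // [|eta h].
    apply: continuousD => //.
    have Df := freq_is_derive 0; apply: (@is_derive_continuous _ _ _ _).
  have := tot eta h; have := mono eta h lo s (lexx _) (ltW ls) (ltW (le_lt_trans st th)).
  have := mono eta h t hi (ltW (lt_le_trans ls st)) (ltW th) (lexx _).
  by rewrite -!/(Q _ _) /G; lra.
move=> t tI c1 c2; have /andP[lt_t th] := tI.
have [n1 n2] := nz t tI.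
have t01 : 0 <= t <= tau by rewrite (le_trans lo0 (ltW lt_t)) (le_trans (ltW th) hit).
rewrite -[fr 0 * sig t]addr0 in n1.
have := calib_derive D t01 n1 n2.
move=> /=; set d := (2^-1 * (_ + _ + _)) => HQ.
have d0 : d = 0.
  apply: (is_derive_oo_eq0 (f := fun s => Q 0 s - Q 0 t) tI).
    move=> s /andP[ls sh]; have [st|/ltW ts] := leP s t.
      by rewrite (cst s t)// subrr.
    by rewrite (cst t s)// subrr.
  rewrite -[d]subr0; exact: is_deriveB.
move: d0; rewrite /d -/c1 -/c2.
have HH (p q r : R) : 2^-1 * (p ^+ 2 + q ^+ 2 + r ^+ 2) = 0 -> p = 0 /\ q = 0.
  move=> H; have := sqr_ge0 p; have := sqr_ge0 q; have := sqr_ge0 r => *.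
  have p0 : p ^+ 2 == 0 by rewrite eq_le; apply/andP; split; lra.
  have q0 : q ^+ 2 == 0 by rewrite eq_le; apply/andP; split; lra.
  by move: p0 q0; rewrite !sqrf_eq0 => /eqP-> /eqP->.
by move=> /HH[/subr0_eq-> /subr0_eq->].
Qed.

(** The hypothesis on [ddxt] is the derivative of u' = w p. The direction [f1], [f2] and the
    cotangents can be eliminated in favour of |u'|^2, and a central force remains. *)
Lemma kepler_field_algebra (xt yt f1 f2 c1 c2 w r dxt dyt ddxt : R) :
  r != 0 -> xt ^+ 2 + yt ^+ 2 = r ^+ 2 -> f1 ^+ 2 + f2 ^+ 2 = 1 ->
  dxt = w * ((c1 + c2) * (xt / r) + (c2 - c1) * f1) ->
  dyt = w * ((c1 + c2) * (yt / r) + (c2 - c1) * f2) ->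
  ddxt = w * ((- (1 + c1 ^+ 2) * (w / r) - (1 + c2 ^+ 2) * (w / r)) * (xt / r)
    + (c1 + c2) * ((dxt - xt / r * ((xt * dxt + yt * dyt) / r)) / r)
    + (- (1 + c2 ^+ 2) * (w / r) + (1 + c1 ^+ 2) * (w / r)) * f1) ->
  ddxt = - (2 * w ^+ 2 + 2^-1 * (dxt ^+ 2 + dyt ^+ 2)) * xt / r ^+ 2.
Proof.
move=> nr Hr F -> -> ->.
have [Ex Ey] : xt = r * (xt / r) /\ yt = r * (yt / r) by split; field.
have {}Hr : (xt / r) ^+ 2 + (yt / r) ^+ 2 = 1.
  by rewrite !expr_div_n -mulrDl Hr divff// expf_neq0.
move: Ex Ey Hr; set p := xt / r; set q := yt / r => Ex Ey Hr; rewrite Ex Ey.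
clearbody p q; apply: subr0_eq.
transitivity (p * w ^+ 2 / r * (2^-1 * (c1 + c2) ^+ 2 * (1 - (p ^+ 2 + q ^+ 2))
    + 2^-1 * (c2 - c1) ^+ 2 * (f1 ^+ 2 + f2 ^+ 2 - 1))); first by field.
by rewrite Hr F !subrr !mulr0 addr0 mulr0.
Qed.

Lemma field_kepler (lo hi w a1 a2 : R) (ddx ddy : R -> R) :
  0 <= lo -> hi <= tau ->
  (forall t, lo < t < hi -> sin (w * sig t + a1) != 0 /\ sin (w * sig t + a2) != 0) ->
  (forall t, lo < t < hi ->
    let c1 := cot (w * sig t + a1) in let c2 := cot (w * sig t + a2) in
    dx t = w * ((c1 + c2) * (x t / rho 0 x y t) + (c2 - c1) * e1) /\
    dy t = w * ((c1 + c2) * (y t / rho 0 x y t) + (c2 - c1) * e2)) ->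
  (forall t, 0 <= t <= tau -> is_derive t 1 dx (ddx t)) ->
  (forall t, 0 <= t <= tau -> is_derive t 1 dy (ddy t)) ->
  forall t, lo < t < hi ->
  let E := 2 * w ^+ 2 + 2^-1 * (dx t ^+ 2 + dy t ^+ 2) in
  ddx t = - E * x t / rho 0 x y t ^+ 2 /\ ddy t = - E * y t / rho 0 x y t ^+ 2.
Proof.
move=> lo0 hit nz fE Ddx Ddy t tI.
have /andP[lt_t th] := tI.
have t01 : 0 <= t <= tau by rewrite (le_trans lo0 (ltW lt_t)) (le_trans (ltW th) hit).
have r0 := gl_rho D t01.
have Dx := gl_x D t01; have Dy := gl_y D t01; have Ds := gl_sig D t01.
have Dr := is_derive_rho r0 Dx Dy.
have Dc (al : R) : sin (w * sig t + al) != 0 ->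
    is_derive t 1 (fun s => cot (w * sig s + al))
      (- (1 + cot (w * sig t + al) ^+ 2) * (w / rho 0 x y t)).
  move=> sa; have Da : is_derive t 1 (fun s => w * sig s + al) (w / rho 0 x y t).
    by apply: is_derive_eq; rewrite /GRing.scale /=; ring.
  exact: is_derive_comp Da (is_derive_cot sa).
have [n1 n2] := nz t tI.
have Dc1 := Dc a1 n1; have Dc2 := Dc a2 n2.
have nr : rho 0 x y t != 0 by rewrite gt_eqF.
have [Ex Ey] := fE t tI.
(* One computation for both coordinates: the first-order equation holds on an open interval, hence
   it may be differentiated. *)
have aux (z dz : R -> R) (ez ddz : R) : is_derive t 1 z (dz t) -> is_derive t 1 dz ddz ->
    (forall s, lo < s < hi -> dz s = w * ((cot (w * sig s + a1) + cot (w * sig s + a2)) *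
      (z s / rho 0 x y s) + (cot (w * sig s + a2) - cot (w * sig s + a1)) * ez)) ->
    ddz = w * ((- (1 + cot (w * sig t + a1) ^+ 2) * (w / rho 0 x y t)
        - (1 + cot (w * sig t + a2) ^+ 2) * (w / rho 0 x y t)) * (z t / rho 0 x y t)
      + (cot (w * sig t + a1) + cot (w * sig t + a2)) *
        ((dz t - z t / rho 0 x y t * ((x t * dx t + y t * dy t) / rho 0 x y t)) / rho 0 x y t)
      + (- (1 + cot (w * sig t + a2) ^+ 2) * (w / rho 0 x y t)
        + (1 + cot (w * sig t + a1) ^+ 2) * (w / rho 0 x y t)) * ez).
  move=> Dz Ddz zE; apply: subr0_eq.
  pose F s := dz s - w * ((cot (w * sig s + a1) + cot (w * sig s + a2)) * (z s * (rho 0 x y s)^-1)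
     + (cot (w * sig s + a2) - cot (w * sig s + a1)) * ez).
  apply: (is_derive_oo_eq0 (f := F) tI) => [s sI|].
    by rewrite /F (zE s sI) subrr.
  rewrite /F; apply: is_derive_eq; rewrite /GRing.scale /=.
  move: nr (cot (w * sig t + a1)) (cot (w * sig t + a2)).
  move: (rho 0 x y t) (x t) (y t) (z t) (dx t) (dy t) (dz t) => r' x' y' z' dx' dy' dz' nr' k1 k2.
  by field.
have Hr : x t ^+ 2 + y t ^+ 2 = rho 0 x y t ^+ 2 by rewrite sqr_rho expr0n addr0.
split.
  apply: (kepler_field_algebra nr Hr (gl_unit D) Ex Ey).
  by apply: (aux x dx e1 _ Dx (Ddx t t01)) => s sI; have [] := fE s sI.
rewrite [dx t ^+ 2 + _]addrC.
have Hr' : y t ^+ 2 + x t ^+ 2 = rho 0 x y t ^+ 2 by rewrite addrC.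
have He' : e2 ^+ 2 + e1 ^+ 2 = 1 by rewrite addrC (gl_unit D).
apply: (kepler_field_algebra nr Hr' He' Ey Ex).
have := aux y dy e2 _ Dy (Ddy t t01) (fun s sI => (fE s sI).2).
by rewrite (addrC (x t * dx t)).
Qed.

Lemma gordon_sum_ge0 : 2 * (pi / S) ^+ 2 * tau <= k.
Proof.
have pih : 0 < pi / 2 :> R by rewrite divr_gt0// pi_gt0.
rewrite -fr0E; apply: (@le_at0 _ (fun eta => 2 * fr eta ^+ 2 * tau) (fun=> k) _ pih).
- have Df := freq_is_derive 0; apply: (@is_derive_continuous _ _ _ _).
- exact: cst_continuous.
- by move=> eta h; have := gordon_sum_ge D (lexx 0) h; rewrite mulr0 subr0.
Qed.

Section Equality.
Variables (S0 delta : R).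
Hypothesis S0_gt0 : 0 < S0.
Hypothesis dS : delta * S0 ^+ 3 = 4 * pi ^+ 2 * tau.
Hypothesis tight : k + delta * S <= 6 * pi ^+ 2 * tau / S0 ^+ 2.

(** The excess of 2 pi^2 tau / S^2 + delta S over its minimum is (S - S0)^2 times a positive
    factor. *)
Lemma gordon_tight : S = S0 /\ k = 2 * (pi / S) ^+ 2 * tau.
Proof.
have t0 := gl_tau D; have S_gt0 : 0 < S := sig_tau_gt0 D; have p0 := pi_gt0 R.
have k0 := gordon_sum_ge0.
have dE : delta = 4 * pi ^+ 2 * tau / S0 ^+ 3 by rewrite -dS mulfK// expf_neq0// gt_eqF.
have E : 2 * (pi / S) ^+ 2 * tau + delta * S - 6 * pi ^+ 2 * tau / S0 ^+ 2 =
    (S - S0) ^+ 2 * (2 * pi ^+ 2 * tau * (2 * S + S0) / (S ^+ 2 * S0 ^+ 3)).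
  by rewrite dE; field; rewrite !gt_eqF.
have c0 : 0 < 2 * pi ^+ 2 * tau * (2 * S + S0) / (S ^+ 2 * S0 ^+ 3).
  apply: divr_gt0; last by rewrite mulr_gt0// exprn_gt0.
  by apply: mulr_gt0; [rewrite mulr_gt0// mulr_gt0// exprn_gt0|rewrite addr_gt0// mulr_gt0].
have sq : (S - S0) ^+ 2 * (2 * pi ^+ 2 * tau * (2 * S + S0) / (S ^+ 2 * S0 ^+ 3)) <= 0.
  by rewrite -E subr_le0; apply: le_trans tight; rewrite lerD2r.
have SS : S = S0.
  apply: subr0_eq; apply/eqP; rewrite -sqrf_eq0 eq_le sqr_ge0 andbT.
  by move: sq; rewrite pmulr_lle0.
split => //; apply/eqP; rewrite eq_le k0 andbT.
rewrite -(lerD2r (delta * S)); apply: le_trans tight _; rewrite -subr_ge0 E.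
by rewrite mulr_ge0 ?sqr_ge0// ltW.
Qed.

Variables ddx ddy : R -> R.
Hypothesis Dx : forall t, is_derive t 1 x (dx t).
Hypothesis Dy : forall t, is_derive t 1 y (dy t).
Hypothesis Ddx : forall t, is_derive t 1 dx (ddx t).
Hypothesis Ddy : forall t, is_derive t 1 dy (ddy t).
Hypothesis cddx : continuous ddx.
Hypothesis cddy : continuous ddy.

Let w := pi / S.

(** Each piece has its own second phase. The increment of the calibration over the other piece is
    nonnegative, so the total increment bounds the one over the piece considered, as [calib_rigid]
    asks. *)
Lemma pieces_kepler t : (0 < t < t2) \/ (t2 < t < tau) ->
  let E := 2 * w ^+ 2 + 2^-1 * (dx t ^+ 2 + dy t ^+ 2) in
  ddx t = - E * x t / rho 0 x y t ^+ 2 /\ ddy t = - E * y t / rho 0 x y t ^+ 2.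
Proof.
have t0 := gl_tau D; have S_gt0 : 0 < S := sig_tau_gt0 D; have p0 := pi_gt0 R.
have /andP[t20 t2t] := gl_t2 D.
have kE := gordon_tight.2.
have sin0 z : 0 < z < S -> sin (w * z) != 0.
  move=> /andP[z0 zS]; rewrite gt_eqF// sin_gt0_pi// mulr_gt0 ?divr_gt0//=.
  by rewrite mulrAC ltr_pdivrMr// ltr_pM2l.
have tot := calib_total0.
case=> tI.
- pose A eta := fr eta * (S - sig t2) + eta.
  have HA : is_derive (0 : R) 1 A (- 2 / S * (S - sig t2) + 1).
    by rewrite /A; apply: is_derive_eq; rewrite /GRing.scale /=; ring.
  have nz s : 0 < s < t2 -> sin (fr 0 * sig s) != 0 /\ sin (fr 0 * sig s + A 0) != 0.
    move=> /andP[s0 st].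
    have h1 : 0 < sig s by rewrite -(gl_sig0 D) (sig_incr D)// ltW// (lt_le_trans st).
    have h2 : sig s < sig t2 by rewrite (sig_incr D)// ltW.
    have h3 : sig t2 <= S by rewrite (sig_ndecr D).
    rewrite /A addr0 -mulrDr fr0E -/w; split; apply: sin0; apply/andP; split; lra.
  have rig := @calib_rigid 0 t2 A _ HA (lexx 0) t2t kE _ _ nz.
  apply: (@field_kepler 0 t2 w 0 (A 0)) => //.
  + by move=> s /nz; rewrite fr0E -/w addr0.
  + move=> s sI; rewrite /w -fr0E; apply: rig => // eta h.
      by move=> r1 r2 *; exact: (calib1_ndecr D).
    by have := calib2_ndecr D h (lexx _) t2t (lexx _); have := tot eta h; rewrite /calib1 /calib2 /A; lra.
- pose A eta := eta - fr eta * sig t2.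
  have HA : is_derive (0 : R) 1 A (1 - (- 2 / S * sig t2)).
    by rewrite /A; apply: is_derive_eq; rewrite /GRing.scale /=; ring.
  have nz s : t2 < s < tau -> sin (fr 0 * sig s) != 0 /\ sin (fr 0 * sig s + A 0) != 0.
    move=> /andP[s0 st].
    have h1 : 0 <= sig t2 by rewrite -(gl_sig0 D) (sig_ndecr D).
    have h2 : sig t2 < sig s by rewrite (sig_incr D)// ltW.
    have h3 : sig s < S by rewrite (sig_incr D)// ltW// (le_lt_trans t20).
    rewrite /A sub0r -mulrBr fr0E -/w; split; apply: sin0; apply/andP; split; lra.
  have rig := @calib_rigid t2 tau A _ HA t20 (lexx _) kE _ _ nz.
  apply: (@field_kepler t2 tau w 0 (A 0)) => //.
  + by move=> s /nz; rewrite fr0E -/w addr0.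
  + move=> s sI; rewrite /w -fr0E; apply: rig => // eta h.
      by move=> r1 r2 *; exact: (calib2_ndecr D).
    by have := calib1_ndecr D h (lexx _) t20 (lexx _); have := tot eta h; rewrite /calib1 /calib2 /A; lra.
Qed.

(** The coefficient E of the central force still contains |u'|. Its product with |u| turns out to be
    constant and equal to delta: this is the energy law |u'|^2 / 2 - delta/|u| = - 2 w^2, and it
    turns the force into delta u / |u|^3. *)
Lemma gordon_rigidity t : 0 <= t <= tau ->
  ddx t = - delta * x t / rho 0 x y t ^+ 3 /\ ddy t = - delta * y t / rho 0 x y t ^+ 3.
Proof.
have t0 := gl_tau D; have S_gt0 : 0 < S := sig_tau_gt0 D; have p0 := pi_gt0 R.
have /andP[t20 t2t] := gl_t2 D.
have [SS kE] := gordon_tight.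
pose E s := 2 * w ^+ 2 + 2^-1 * (dx s ^+ 2 + dy s ^+ 2).
pose H s := rho 0 x y s * E s.
pose dH s := (x s * dx s + y s * dy s) / rho 0 x y s * E s + rho 0 x y s * (dx s * ddx s + dy s * ddy s).
have DH s : 0 <= s <= tau -> is_derive s 1 H (dH s).
  move=> s01; have r0 := gl_rho D s01.
  have Dr := is_derive_rho r0 (Dx s) (Dy s).
  have d1 := Dx s; have d2 := Dy s; have d3 := Ddx s; have d4 := Ddy s.
  rewrite /H /E; apply: is_derive_eq; rewrite /GRing.scale /= /dH /E.
  by field; rewrite gt_eqF.
have dH0 s : (0 < s < t2) \/ (t2 < s < tau) -> dH s = 0.
  move=> sI; have s01 : 0 <= s <= tau by case: sI => /andP[h1 h2]; apply/andP; split; lra.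
  have nr : rho 0 x y s != 0 by rewrite gt_eqF// (gl_rho D s01).
  rewrite /dH; have [-> ->] := pieces_kepler sI; rewrite -/(E s).
  by field.
have H0 s : 0 <= s <= tau -> H s = H t2.
  move=> /andP[s0 st]; have [h|h] := leP t2 s.
    apply: esym; apply: (@is_derive_eq0_const _ H dH _ _ h) => [r /andP[r1 r2]|r /andP[r1 r2]].
      by apply: DH; apply/andP; split; lra.
    by apply: dH0; right; apply/andP; split; lra.
  apply: (@is_derive_eq0_const _ H dH _ _ (ltW h)) => [r /andP[r1 r2]|r /andP[r1 r2]].
    by apply: DH; apply/andP; split; lra.
  by apply: dH0; left; apply/andP; split; lra.
(* E is the constant [H] times sig'; integrating over the period gives H S = k + 2 w^2 tau = 4 w^2
   tau, and S = S0 identifies H with delta. *)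
have HE : H t2 = delta.
  have : K 0 + 2 * w ^+ 2 * 0 - H t2 * sig 0 = K tau + 2 * w ^+ 2 * tau - H t2 * sig tau.
    pose F s := K s + 2 * w ^+ 2 * s - H t2 * sig s.
    apply: (is_derive_eq0_const (f := F) (f' := fun=> 0) (ltW t0)) => // s s01.
    have d1 := gl_K D s01; have d2 := gl_sig D s01.
    rewrite /F; apply: is_derive_eq; rewrite /GRing.scale /= -(H0 s s01) /H /E.
    by field; rewrite gt_eqF// (gl_rho D s01).
  rewrite (gl_sig0 D) -/S !mulr0 subr0 addr0 => HH.
  have {HH} : H t2 * S = 4 * w ^+ 2 * tau by move: kE; rewrite /k -/w; lra.
  move=> HH; apply: (@mulIf _ (S0 ^+ 3)); first by rewrite expf_neq0// gt_eqF.
  rewrite dS -SS exprS mulrA HH /w; field; rewrite gt_eqF//.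
have crho : continuous (rho 0 x y).
  move=> s; apply: (@continuous_comp _ _ _ (fun r => x r ^+ 2 + y r ^+ 2 + 0 ^+ 2) Num.sqrt).
    have d1 := Dx s; have d2 := Dy s; apply: (@is_derive_continuous _ _ _ _).
  exact: sqrt_continuous.
have inner s : (0 < s < t2) \/ (t2 < s < tau) ->
    ddx s * rho 0 x y s ^+ 3 + delta * x s = 0 /\ ddy s * rho 0 x y s ^+ 3 + delta * y s = 0.
  move=> sI; have s01 : 0 <= s <= tau by case: sI => /andP[h1 h2]; apply/andP; split; lra.
  have nr : rho 0 x y s != 0 by rewrite gt_eqF// (gl_rho D s01).
  have [-> ->] := pieces_kepler sI.
  by rewrite -HE -(H0 s s01) /H /E; split; field.
move=> t01.
(* Multiplied by rho^3, the equation is an identity between continuous functions and extends to the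
   excluded times 0, [t2] and [tau]. *)
have cF (z ddz : R -> R) : continuous z -> continuous ddz ->
    continuous (fun s => ddz s * rho 0 x y s ^+ 3 + delta * z s).
  move=> cz cddz s; apply: cvgD.
    apply: cvgM; first exact: cddz.
    apply: (@continuous_comp _ _ _ (rho 0 x y) (fun r => r ^+ 3)); first exact: crho.
    exact: exprn_continuous.
  by apply: cvgM; [exact: cvg_cst|exact: cz].
have cx : continuous x by move=> s; have d1 := Dx s; exact: is_derive_continuous d1.
have cy : continuous y by move=> s; have d1 := Dy s; exact: is_derive_continuous d1.
have key (F : R -> R) : continuous F ->
    (forall s, (0 < s < t2) \/ (t2 < s < tau) -> F s = 0) -> F t = 0.
  move=> cf F0; have /andP[h1 h2] := t01; have [lt2|gt2] := ltP t t2.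
    apply: (eq0_closed_itv (le_lt_trans h1 lt2) cf); last by rewrite h1 ltW.
    by move=> s sI; apply: F0; left.
  have [lt2t|] := ltP t2 tau.
    apply: (eq0_closed_itv lt2t cf); last by rewrite gt2.
    by move=> s sI; apply: F0; right.
  move=> tt2; have E2 : t2 = tau by apply/eqP; rewrite eq_le t2t.
  apply: (eq0_closed_itv t0 cf) => //.
  by move=> s sI; apply: F0; left; rewrite E2.
have nr : rho 0 x y t ^+ 3 != 0 by rewrite expf_neq0// gt_eqF// (gl_rho D t01).
have h1 := key _ (cF x ddx cx cddx) (fun s sI => (inner s sI).1).
have h2 := key _ (cF y ddy cy cddy) (fun s sI => (inner s sI).2).
split; apply: (mulIf nr); rewrite divfK//; move: h1 h2 => /=; lra.
Qed.

End Equality.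
End Rigidity.

(** * Winding numbers *)

Section Winding.
Variable R : realType.
Implicit Types (x y th : R -> R) (t tau : R).

Lemma cosDpi_int (s : int) (z : R) : s = 1 \/ s = -1 ->
  cos (z + pi * s%:~R) = - cos z /\ sin (z + pi * s%:~R) = - sin z.
Proof.
case=> ->; rewrite ?mulrNz ?mulr1z ?mulrN mulr1.
  by rewrite cosD sinD cospi sinpi !mulr0 subr0 addr0 !mulrN1.
by rewrite cosB sinB cospi sinpi !mulr0 subr0 addr0 !mulrN1.
Qed.

Lemma IVT_itv (f : R -> R) (a b v : R) : a <= b -> {within `[a, b], continuous f} ->
  (f a <= v <= f b) || (f b <= v <= f a) -> exists2 c, a <= c <= b & f c = v.
Proof.
move=> ab cf fv; have [|c cab <-] := @IVT R f a b v ab cf.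
  by rewrite ge_min le_max; case/orP: fv => /andP[-> ->]; rewrite ?orbT.
by exists c => //; move: cab; rewrite in_itv.
Qed.

(** The angle changes by 2 pi in absolute value over the period, so at some time it has changed by
    exactly pi. *)
Lemma winding_antipode x y tau (s : int) : 0 < tau -> s = 1 \/ s = -1 ->
  winding tau x y s -> exists e1 e2 t2 a b : R,
  [/\ e1 ^+ 2 + e2 ^+ 2 = 1, 0 <= a, 0 <= b, 0 <= t2 <= tau &
      (x 0 = a * e1 /\ y 0 = a * e2) /\ (x t2 = - b * e1 /\ y t2 = - b * e2)].
Proof.
move=> t0 s1 [th [cth [E dth]]].
have [t2 t2I t2E] : exists2 c, 0 <= c <= tau & th c = th 0 + pi * s%:~R.
  apply: (IVT_itv (ltW t0) cth); have p0 := pi_gt0 R.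
  move: dth; case: s1 => ->; rewrite ?mulrNz ?mulr1z => dth.
    by apply/orP; left; lra.
  by apply/orP; right; lra.
exists (cos (th 0)), (sin (th 0)), t2, (Num.sqrt (x 0 ^+ 2 + y 0 ^+ 2)),
  (Num.sqrt (x t2 ^+ 2 + y t2 ^+ 2)); split; rewrite ?sqrtr_ge0//.
  exact: cos2Dsin2.
split; first by apply: E; rewrite lexx ltW.
have := E t2 t2I; rewrite t2E; have [-> ->] := cosDpi_int (th 0) s1.
by rewrite !mulrN !mulNr.
Qed.

Lemma unit_angle (p q : R) : p ^+ 2 + q ^+ 2 = 1 -> exists phi, p = cos phi /\ q = sin phi.
Proof.
move=> pq.
have p1 : -1 <= p <= 1.
  by apply/andP; split; nra.
have Ec : cos (acos p) = p by apply: acosK; rewrite in_itv.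
have Es : sin (acos p) = `|q|.
  by rewrite sin_acos// -pq addrAC subrr add0r sqrtr_sqr.
have [q0|/ltW q0] := leP 0 q.
  by exists (acos p); rewrite Ec Es ger0_norm.
by exists (- acos p); rewrite cosN sinN Ec Es ler0_norm// opprK.
Qed.

(** The angle is an integral of (x dy - y dx)/|u|^2. It is a lift because the squared distance
    between u/|u| and (cos th, sin th) vanishes at 0 and has zero derivative. *)
Lemma angle_lift x y dx dy tau : 0 < tau ->
  (forall t, is_derive t 1 x (dx t)) -> (forall t, is_derive t 1 y (dy t)) ->
  continuous dx -> continuous dy -> (forall t, 0 < rho 0 x y t) ->
  exists2 th : R -> R,
    forall t, 0 <= t <= tau -> is_derive t 1 th ((x t * dy t - y t * dx t) / rho 0 x y t ^+ 2) &
    forall t, 0 <= t <= tau -> x t = rho 0 x y t * cos (th t) /\ y t = rho 0 x y t * sin (th t).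
Proof.
move=> t0 Dx Dy cdx cdy r0.
have cx : continuous x by move=> t; exact: is_derive_continuous (Dx t).
have cy : continuous y by move=> t; exact: is_derive_continuous (Dy t).
have Dr t := is_derive_rho (r0 t) (Dx t) (Dy t).
have cr : continuous (rho 0 x y) by move=> t; exact: is_derive_continuous (Dr t).
have nr t : rho 0 x y t != 0 by rewrite gt_eqF.
pose h t := (x t * dy t - y t * dx t) / rho 0 x y t ^+ 2.
have [H H0 DH] : exists2 H : R -> R, H 0 = 0 & forall t, -1 < t -> is_derive t 1 H (h t).
  apply: antiderivative => t; apply: cvgM.
    apply: cvgB; first by apply: cvgM; [exact: cx|exact: cdy].
    by apply: cvgM; [exact: cy|exact: cdx].
  apply: cvgV; first by rewrite expf_neq0.
  by apply: cvgM; exact: cr.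
have Hr t : x t ^+ 2 + y t ^+ 2 = rho 0 x y t ^+ 2 by rewrite sqr_rho expr0n addr0.
have Hr1 t : (x t / rho 0 x y t) ^+ 2 + (y t / rho 0 x y t) ^+ 2 = 1.
  by rewrite !expr_div_n -mulrDl Hr divff// expf_neq0.
have [phi [phi1 phi2]] := unit_angle (Hr1 0).
exists (fun t => H t + phi) => t t01.
  have := DH t; rewrite (lt_le_trans _ (andP t01).1)// => /(_ isT) D.
  by apply: is_derive_eq; rewrite addr0.
pose F s := (x s / rho 0 x y s - cos (H s + phi)) ^+ 2 + (y s / rho 0 x y s - sin (H s + phi)) ^+ 2.
have Ft : F t = 0.
  have -> : 0 = F 0 by rewrite /F H0 add0r -phi1 -phi2 !subrr expr0n addr0.
  apply/esym; apply: (@is_derive_eq0_const _ F (fun=> 0)); first by case/andP: t01.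
    move=> s /andP[s0 st].
    have D := DH s (lt_le_trans (ltrN10 R) s0).
    have Da : is_derive s 1 (fun s => H s + phi) (h s).
      by apply: is_derive_eq; rewrite addr0.
    rewrite /F; apply: is_derive_eq; rewrite /GRing.scale /= /h.
    move: (cos _) (sin _) (nr s) (Hr s) => c si.
    move: (rho 0 x y s) (x s) (y s) (dx s) (dy s) => r xs ys dxs dys nrs Hrs.
    transitivity (2 * ((xs / r - c) * dxs + (ys / r - si) * dys) / r ^+ 3
      * (r ^+ 2 - (xs ^+ 2 + ys ^+ 2))); first by field.
    by rewrite Hrs subrr mulr0.
  by [].
move: Ft; rewrite /F => /eqP; rewrite paddr_eq0 ?sqr_ge0// !sqrf_eq0 !subr_eq0 => /andP[/eqP <- /eqP <-].
by split; field.
Qed.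

Lemma cos_lt1 (z : R) : 0 < z < pi *+ 2 -> cos z < 1.
Proof.
move=> /andP[z0 z1]; rewrite lt_neqAle cos_le1 andbT; apply/eqP => c1.
have : sin (z / 2) ^+ 2 = 0.
  have := cos_mulr2n (z / 2); rewrite (_ : z / 2 *+ 2 = z); last by field.
  by rewrite c1 cos2sin2 => E; lra.
move/eqP; rewrite sqrf_eq0 => /eqP s0.
have : 0 < sin (z / 2) by apply: sin_gt0_pi; lra.
by rewrite s0 ltxx.
Qed.

(** Rouché's argument: as (p, q) is closer to (x, y) than the origin is, the difference of the two
    angles keeps a positive cosine, so it cannot move by pi. Over the period it moves by a multiple
    of 2 pi, hence by 0. *)
Lemma winding_close x y (p q th thp : R -> R) (r : R -> R) tau (s : int) : 0 < tau -> s = 1 \/ s = -1 ->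
  {within `[0, tau], continuous th} -> {within `[0, tau], continuous thp} ->
  (forall t, 0 <= t <= tau -> [/\ 0 < r t, x t = r t * cos (th t) & y t = r t * sin (th t)]) ->
  (forall t, 0 <= t <= tau ->
       p t = Num.sqrt (p t ^+ 2 + q t ^+ 2) * cos (thp t) /\
       q t = Num.sqrt (p t ^+ 2 + q t ^+ 2) * sin (thp t)) ->
  (forall t, 0 <= t <= tau -> (p t - x t) ^+ 2 + (q t - y t) ^+ 2 < x t ^+ 2 + y t ^+ 2) ->
  x tau = x 0 -> y tau = y 0 ->
  thp tau - thp 0 = 2 * pi * s%:~R ->
  th tau - th 0 = 2 * pi * s%:~R.
Proof.
move=> t0 s1 cth cthp E Ep close x0 y0 dthp.
pose d t := thp t - th t.
have cd : {within `[0, tau], continuous d} by move=> t; apply: cvgB; [exact: cthp|exact: cth].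
have cosd t : 0 <= t <= tau -> 0 < cos (d t).
  move=> tI; have [r0 xE yE] := E t tI; have [pE qE] := Ep t tI.
  have := close t tI.
  have pq : 0 <= Num.sqrt (p t ^+ 2 + q t ^+ 2) by exact: sqrtr_ge0.
  move: (Num.sqrt _) pq pE qE => g g0 -> ->; rewrite xE yE /d cosB.
  have := cos2Dsin2 (thp t); have := cos2Dsin2 (th t).
  move: (cos (thp t)) (sin (thp t)) (cos (th t)) (sin (th t)) => c1 k1 c2 k2 h1 h2 h3.
  have h4 : (g * c1 - r t * c2) ^+ 2 + (g * k1 - r t * k2) ^+ 2 - ((r t * c2) ^+ 2 + (r t * k2) ^+ 2)
    = g ^+ 2 * (c1 ^+ 2 + k1 ^+ 2) - 2 * (r t * g) * (c1 * c2 + k1 * k2) by ring.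
  rewrite h2 mulr1 in h4.
  rewrite ltNge; apply/negP => neg.
  have := mulr_ge0_le0 (mulr_ge0 (ltW r0) g0) neg; have := sqr_ge0 g; lra.
have d0pi : `|d tau - d 0| < pi.
  rewrite ltNge; apply/negP => big.
  have pi0 := pi_gt0 R.
  have I0 : 0 <= (0 : R) <= tau by rewrite lexx ltW.
  have [far|far] : d tau - d 0 <= - pi \/ pi <= d tau - d 0.
    by move: big; rewrite ler_normr => /orP[]; [right|left; lra].
  - have [|c cI cE] := @IVT_itv d 0 tau (d 0 - pi) (ltW t0) cd.
      by apply/orP; right; apply/andP; split; lra.
    have := cosd c cI; have := cosd 0 I0; rewrite cE cosB cospi sinpi; lra.
  - have [|c cI cE] := @IVT_itv d 0 tau (d 0 + pi) (ltW t0) cd.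
      by apply/orP; left; apply/andP; split; lra.
    have := cosd c cI; have := cosd 0 I0; rewrite cE cosD cospi sinpi; lra.
have [r0 xE0 yE0] := E 0 (introT andP (conj (lexx 0) (ltW t0))).
have [r1 xE1 yE1] := E tau (introT andP (conj (ltW t0) (lexx tau))).
have rr : r tau = r 0.
  apply/eqP; rewrite -(@eqrXn2 _ 2) ?ltW//; apply/eqP.
  transitivity (x tau ^+ 2 + y tau ^+ 2).
    by rewrite xE1 yE1 !exprMn -mulrDr cos2Dsin2 mulr1.
  by rewrite x0 y0 xE0 yE0 !exprMn -mulrDr cos2Dsin2 mulr1.
have nr : r 0 != 0 by rewrite gt_eqF.
have c1 : cos (th tau) = cos (th 0) by apply: (mulfI nr); rewrite -{1}rr -xE1 -xE0.
have c2 : sin (th tau) = sin (th 0) by apply: (mulfI nr); rewrite -{1}rr -yE1 -yE0.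
have c3 : cos (th tau - th 0) = 1 by rewrite cosB c1 c2 -!expr2 cos2Dsin2.
have c4 : sin (th tau - th 0) = 0 by rewrite sinB c1 c2 mulrC subrr.
have dE : d tau - d 0 = 2 * pi * s%:~R - (th tau - th 0) by rewrite -dthp /d; ring.
have c5 : cos (d tau - d 0) = 1.
  rewrite dE cosB c3 c4 mulr0 addr0 mulr1 mulrAC.
  case: s1 => ->; rewrite ?mulrNz ?mulr1z ?mulrN ?mulNr ?cosN mulr1 mulrC mulr_natr; exact: cos2pi.
suff : d tau - d 0 = 0 by rewrite dE => /subr0_eq ->.
apply/eqP; apply: contraT => nz.
suff : cos `|d tau - d 0| < 1 by rewrite cos_norm c5 ltxx.
by apply: cos_lt1; rewrite normr_gt0 nz (lt_trans d0pi)// mulr2n ltrDl pi_gt0.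
Qed.

End Winding.

(** * Kepler orbits *)

Section KeplerAction.
Variable R : realType.
Implicit Types t : R.

Lemma is_derive_gt0_lt (f f' : R -> R) (a b : R) : a < b ->
  (forall t, a <= t <= b -> is_derive t 1 f (f' t)) ->
  (forall t, a < t < b -> 0 < f' t) -> f a < f b.
Proof.
move=> ab df f'0.
have [|c] := @MVT R f f' a b ab _ (is_derive_continuous_within df).
  by move=> t; rewrite in_itv/= => /andP[at_ tb]; apply: df; rewrite !ltW.
by rewrite in_itv/= => /f'0 c0 E; rewrite -subr_gt0 E mulr_gt0// subr_gt0.
Qed.

Variables (x y dx dy K sig th : R -> R) (tau delta S0 : R) (s : int).
Local Notation rh := (rho 0 x y).
Hypothesis tau_gt0 : 0 < tau.
Hypothesis Dx : forall t, is_derive t 1 x (dx t).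
Hypothesis Dy : forall t, is_derive t 1 y (dy t).
Hypothesis Ddx : forall t, is_derive t 1 dx (- delta * x t / rh t ^+ 3).
Hypothesis Ddy : forall t, is_derive t 1 dy (- delta * y t / rh t ^+ 3).
Hypothesis r0 : forall t, 0 < rh t.
Hypothesis perx : x tau = x 0.
Hypothesis pery : y tau = y 0.
Hypothesis perdx : dx tau = dx 0.
Hypothesis perdy : dy tau = dy 0.
Hypothesis energy : 2^-1 * (dx 0 ^+ 2 + dy 0 ^+ 2) - delta / rh 0 < 0.
Hypothesis Dth : forall t, 0 <= t <= tau ->
  is_derive t 1 th ((x t * dy t - y t * dx t) / rh t ^+ 2).
Hypothesis thE : forall t, 0 <= t <= tau -> x t = rh t * cos (th t) /\ y t = rh t * sin (th t).
Hypothesis s1 : s = 1 \/ s = -1.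
Hypothesis dth : th tau - th 0 = 2 * pi * s%:~R.
Hypothesis DK : forall t, 0 <= t <= tau -> is_derive t 1 K (2^-1 * (dx t ^+ 2 + dy t ^+ 2)).
Hypothesis Ds : forall t, 0 <= t <= tau -> is_derive t 1 sig (rh t)^-1.
Hypothesis sig0 : sig 0 = 0.
Hypothesis S0_gt0 : 0 < S0.
Hypothesis delta_gt0 : 0 < delta.
Hypothesis dS : delta * S0 ^+ 3 = 4 * pi ^+ 2 * tau.

Let nr t : rh t != 0. Proof. by rewrite gt_eqF. Qed.
Let Dr t := is_derive_rho (r0 t) (Dx t) (Dy t).
Let Hr t : x t ^+ 2 + y t ^+ 2 = rh t ^+ 2.
Proof. by rewrite sqr_rho expr0n addr0. Qed.
Let DV t := is_deriveV (nr t) (Dr t).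

Lemma cst_of_derive0 (f : R -> R) t : 0 <= t <= tau ->
  (forall t, 0 <= t <= tau -> is_derive t 1 f 0) -> f t = f 0.
Proof.
move=> /andP[h1 h2] df; apply: esym; apply: (@is_derive_eq0_const _ f (fun=> 0) _ _ h1) => // u /andP[u0 ut].
by apply: df; rewrite u0 (le_trans ut).
Qed.

Let h := 2^-1 * (dx 0 ^+ 2 + dy 0 ^+ 2) - delta / rh 0.

Lemma energy_cst t : 0 <= t <= tau -> 2^-1 * (dx t ^+ 2 + dy t ^+ 2) - delta / rh t = h.
Proof.
move=> t01; apply: (@cst_of_derive0 (fun t => 2^-1 * (dx t ^+ 2 + dy t ^+ 2) - delta * (rh t)^-1) _ t01).
move=> u _; have d1 := Ddx u; have d2 := Ddy u; have d3 := DV u.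
apply: is_derive_eq; rewrite /GRing.scale /=.
by have := nr u; move: (rh u) => r nru; field.
Qed.

Lemma angmom_cst t : 0 <= t <= tau -> x t * dy t - y t * dx t = x 0 * dy 0 - y 0 * dx 0.
Proof.
move=> t01; apply: (@cst_of_derive0 (fun t => x t * dy t - y t * dx t) _ t01).
move=> u _; have d1 := Ddx u; have d2 := Ddy u; have d3 := Dx u; have d4 := Dy u.
apply: is_derive_eq; rewrite /GRing.scale /=.
by have := nr u; move: (rh u) => r nru; field.
Qed.

Let e1 := cos (th 0).
Let e2 := sin (th 0).
Let ue t := x t * e1 + y t * e2.
Let ve t := dx t * e1 + dy t * e2.
Let uv t := x t * dx t + y t * dy t.
(** With [sig] as fictitious time, [F] is the derivative of [G], and G'' + 4 w^2 G = B. Here B -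
    delta is the component along e of the Laplace-Runge-Lenz vector, and - 2 w^2 is the energy. *)
Let G t := rh t - ue t.
Let F t := uv t - rh t * ve t.
Let B := delta + ((dx 0 ^+ 2 + dy 0 ^+ 2) * ue 0 - uv 0 * ve 0 - delta * ue 0 * (rh 0)^-1).

Lemma LRL_cst t : 0 <= t <= tau ->
  delta + ((dx t ^+ 2 + dy t ^+ 2) * ue t - uv t * ve t - delta * ue t * (rh t)^-1) = B.
Proof.
move=> t01; apply: (@cst_of_derive0 (fun t => delta + ((dx t ^+ 2 + dy t ^+ 2) * ue t - uv t * ve t - delta * ue t * (rh t)^-1)) _ t01).
move=> u _; have d1 := Ddx u; have d2 := Ddy u; have d3 := DV u.
rewrite /ue /uv /ve; apply: is_derive_eq; rewrite /GRing.scale /=.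
have := nr u; have := Hr u; move: (rh u) (x u) (y u) (dx u) (dy u) => r xu yu p q Hru nru.
apply: subr0_eq.
transitivity (delta * (xu ^+ 2 + yu ^+ 2 - r ^+ 2) * (p * e1 + q * e2) / r ^+ 3); first by field.
by rewrite Hru subrr mulr0 !mul0r.
Qed.

Let w := Num.sqrt (- h / 2).

Lemma w_gt0 : 0 < w. Proof. by rewrite sqrtr_gt0 divr_gt0// oppr_gt0. Qed.

Lemma sqr_w : h = - 2 * w ^+ 2.
Proof. rewrite sqr_sqrtr; first by field. by rewrite divr_ge0// oppr_ge0 ltW. Qed.

Lemma G_derive t : 0 <= t <= tau -> is_derive t 1 G (F t / rh t).
Proof.
move=> _; have d4 := Dx t; have d5 := Dy t; have d3 := Dr t.
rewrite /G /ue; apply: is_derive_eq; rewrite /GRing.scale /= /F /uv /ve.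
by have := nr t; move: (rh t) => r nru; field.
Qed.

Lemma F_derive t : 0 <= t <= tau -> is_derive t 1 F ((- 4 * w ^+ 2 * G t + B) / rh t).
Proof.
move=> t01; rewrite (_ : - 4 * w ^+ 2 = 2 * h); last by rewrite sqr_w; ring.
rewrite -(LRL_cst t01) -(energy_cst t01).
have d1 := Ddx t; have d2 := Ddy t; have d3 := Dr t; have d4 := Dx t; have d5 := Dy t.
rewrite /F /uv /ve /G; apply: is_derive_eq; rewrite /GRing.scale /= /ue.
have := nr t; have := Hr t; move: (rh t) (x t) (y t) (dx t) (dy t) => r xu yu p q Hru nru.
apply: subr0_eq.
transitivity (- delta * (xu ^+ 2 + yu ^+ 2 - r ^+ 2) / r ^+ 3); first by field.
by rewrite Hru subrr mulr0 !mul0r.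
Qed.

Lemma F0 : F 0 = 0.
Proof.
have [xE yE] := thE (introT andP (conj (lexx 0) (ltW tau_gt0))).
by rewrite /F /uv /ve {1}xE {1}yE -/e1 -/e2; ring.
Qed.

Lemma GE t : 0 <= t <= tau -> G t = rh t * (1 - cos (th t - th 0)).
Proof.
move=> t01; have [xE yE] := thE t01.
by rewrite /G /ue xE yE cosB /e1 /e2; rewrite -/(rh t); ring.
Qed.

(** The solution of the oscillator equation that starts from G = F = 0. Uniqueness: the quadratic
    form [Q] of the deviation is conserved and vanishes at 0. *)
Lemma G_explicit t : 0 <= t <= tau ->
  G t = B / (4 * w ^+ 2) * (1 - cos (2 * w * sig t)).
Proof.
move=> t01.
have nw : w != 0 by rewrite gt_eqF// w_gt0.
pose X u := F u - B / (2 * w) * sin (2 * w * sig u).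
pose Y u := G u - B / (4 * w ^+ 2) * (1 - cos (2 * w * sig u)).
pose Q u := X u ^+ 2 + 4 * w ^+ 2 * Y u ^+ 2.
have Q0 : Q t = 0.
  have {1}-> : 0 = Q 0.
    rewrite /Q /X /Y sig0 mulr0 sin0 cos0 F0 GE ?lexx ?ltW//.
    by rewrite subrr cos0 !(subrr, mulr0, expr0n, addr0).
  apply: (@cst_of_derive0 Q _ t01) => u u01.
  have d1 := F_derive u01; have d2 := G_derive u01; have d3 := Ds u01.
  have Da : is_derive u 1 (fun v => 2 * w * sig v) (2 * w / rh u).
    by apply: is_derive_eq; rewrite /GRing.scale /=; ring.
  rewrite /Q /X /Y; apply: is_derive_eq; rewrite /GRing.scale /=.
  have := nr u; move: (rh u) (F u) (G u) (cos _) (sin _) => r Fu Gu c si nru.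
  by field; rewrite nru nw.
have q0 : 0 <= 4 * w ^+ 2 * Y t ^+ 2.
  by apply: mulr_ge0; [apply: mulr_ge0 => //; exact: sqr_ge0|exact: sqr_ge0].
move/eqP: Q0; rewrite /Q (paddr_eq0 (sqr_ge0 _) q0) => /andP[_].
by rewrite mulf_eq0 mulf_eq0 pnatr_eq0 !sqrf_eq0 (negPf nw)/= /Y subr_eq0 => /eqP.
Qed.

(** By conservation of angular momentum the angle is strictly monotone. Inside a single turn it does
    not come back to the initial direction, the only one where G vanishes. *)
Lemma G_gt0 t : 0 < t < tau -> 0 < G t.
Proof.
move=> /andP[t0 tt].
have p0 := pi_gt0 R.
pose c := x 0 * dy 0 - y 0 * dx 0.
pose psi u := s%:~R * (th u - th 0).
have Dpsi u : 0 <= u <= tau -> is_derive u 1 psi (s%:~R * c / rh u ^+ 2).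
  move=> u01; have d1 := Dth u01; rewrite (angmom_cst u01) in d1.
  by rewrite /psi /c; apply: is_derive_eq; rewrite /GRing.scale /=; ring.
have psi0 : psi 0 = 0 by rewrite /psi subrr mulr0.
have psitau : psi tau = pi *+ 2.
  by rewrite /psi dth; case: s1 => ->; rewrite ?mulrNz ?mulr1z; ring.
have cpos : 0 < s%:~R * c.
  rewrite ltNge; apply/negP => neg.
  have : psi tau <= psi 0; last by rewrite psi0 psitau mulr2n; lra.
  rewrite -lerN2.
  apply: (@is_derive_ge0_le _ (fun u => - psi u) (fun u => - (s%:~R * c / rh u ^+ 2)) _ _ (ltW tau_gt0)).
    by move=> u /Dpsi ?; exact: is_deriveN.
  by move=> u _; rewrite oppr_ge0 mulr_le0_ge0// invr_ge0 sqr_ge0.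
have incr a b : 0 <= a -> a < b -> b <= tau -> psi a < psi b.
  move=> a0 ab bt; apply: (@is_derive_gt0_lt psi (fun u => s%:~R * c / rh u ^+ 2)) => //.
    by move=> u /andP[u1 u2]; apply: Dpsi; rewrite (le_trans a0 u1) (le_trans u2 bt).
  by move=> u _; rewrite divr_gt0// exprn_gt0.
rewrite GE ?ltW//.
rewrite mulr_gt0// subr_gt0.
have -> : cos (th t - th 0) = cos (psi t).
  by rewrite /psi; case: s1 => ->; rewrite ?mulrNz ?mulr1z ?mulN1r ?mul1r ?cosN.
by apply: cos_lt1; rewrite -psitau -{1}psi0 !incr// ltW.
Qed.

(** G is positive inside the period and zero at its end, so [sig tau] is the first positive zero of
    1 - cos(2 w sig). *)
Lemma kepler_period : w * sig tau = pi.
Proof.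
have p0 := pi_gt0 R; have w0 := w_gt0.
have tI : 0 <= tau <= tau by rewrite lexx ltW.
have sigincr a b : 0 <= a -> a < b -> b <= tau -> sig a < sig b.
  move=> a0 ab bt; apply: (@is_derive_gt0_lt sig (fun u => (rh u)^-1)) => //.
    by move=> u /andP[u1 u2]; apply: Ds; rewrite (le_trans a0 u1) (le_trans u2 bt).
  by move=> u _; rewrite invr_gt0.
have S_gt0 : 0 < sig tau by rewrite -sig0 sigincr.
have half : 0 < tau / 2 < tau by have := tau_gt0; move=> ?; apply/andP; split; lra.
have B0 : B / (4 * w ^+ 2) != 0.
  apply/eqP => b0; have := G_gt0 half; rewrite G_explicit ?b0 ?mul0r ?ltxx//.
  by case/andP: half => /ltW-> /ltW->.
have ctau : cos (2 * w * sig tau) = 1.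
  have : G tau = 0 by rewrite /G /ue perx pery -/(ue 0) /rho perx pery -/(rh 0) -/(G 0) GE ?subrr ?cos0 ?subrr ?mulr0// lexx ltW.
  by rewrite G_explicit// => /eqP; rewrite mulf_eq0 (negPf B0)/= subr_eq0 => /eqP.
have [lt|gt|//] := ltgtP (w * sig tau) pi.
  have := @cos_lt1 _ (2 * w * sig tau); rewrite ctau ltxx => H; exfalso.
  suff : false by []. apply: H; rewrite -mulrA mulr_gt0 ?mulr_gt0//= mulr2n; lra.
have cs : {within `[0, tau], continuous sig} := is_derive_continuous_within Ds.
have pw : 0 < pi / w < sig tau by rewrite divr_gt0//= ltr_pdivrMr// mulrC.
have [|c /andP[c0 ct] cE] := @IVT_itv _ sig 0 tau (pi / w) (ltW tau_gt0) cs.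
  by apply/orP; left; rewrite sig0; case/andP: pw => /ltW-> /ltW->.
have c0' : 0 < c.
  rewrite lt_neqAle c0 andbT; apply/eqP => E; move: pw; rewrite -cE -E sig0 ltxx//.
have ct' : c < tau.
  rewrite lt_neqAle ct andbT; apply/eqP => E; move: pw; rewrite -cE E ltxx andbF//.
have := G_gt0 (introT andP (conj c0' ct')); rewrite G_explicit ?c0//.
rewrite cE (_ : 2 * w * (pi / w) = pi *+ 2); last by field; rewrite gt_eqF.
by rewrite cos2pi subrr mulr0 ltxx.
Qed.

(** Over a period, the virial identity (u . u')' = |u'|^2 - delta/|u| gives K tau - K 0 = delta S /
    2, and the energy law then gives delta S = 4 w^2 tau. With w = pi/S this reads delta S^3 = 4
    pi^2 tau, so S = S0 whatever the eccentricity. *)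
Lemma kepler_action : K tau - K 0 + delta * sig tau = 6 * pi ^+ 2 * tau / S0 ^+ 2.
Proof.
have p0 := pi_gt0 R; have w0 := w_gt0.
have t01 : 0 <= tau <= tau by rewrite lexx ltW.
have wS := kepler_period.
have virial : uv tau - 2 * K tau + delta * sig tau = uv 0 - 2 * K 0 + delta * sig 0.
  apply: (@cst_of_derive0 (fun t => uv t - 2 * K t + delta * sig t) _ t01) => u u01.
  have d6 := DK u01; have d7 := Ds u01.
  rewrite /uv; apply: is_derive_eq; rewrite /GRing.scale /=.
  have := nr u; have := Hr u; move: (rh u) (x u) (y u) (dx u) (dy u) => r xu yu p q Hru nru.
  apply: subr0_eq.
  transitivity (- delta * (xu ^+ 2 + yu ^+ 2 - r ^+ 2) / r ^+ 3); first by field.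
  by rewrite Hru subrr mulr0 !mul0r.
have en : K tau - delta * sig tau - h * tau = K 0 - delta * sig 0 - h * 0.
  apply: (@cst_of_derive0 (fun t => K t - delta * sig t - h * t) _ t01) => u u01.
  have d6 := DK u01; have d7 := Ds u01.
  by apply: is_derive_eq; rewrite /GRing.scale /= -(energy_cst u01); ring.
have uvE : uv tau = uv 0 by rewrite /uv perx pery perdx perdy.
rewrite uvE sig0 !mulr0 in virial en.
have dSE : delta * sig tau = 4 * w ^+ 2 * tau by move: en; rewrite sqr_w; lra.
have S_gt0 : 0 < sig tau by rewrite -(pmulr_rgt0 _ w0) wS.
have ws : w = pi / sig tau by rewrite -wS mulfK// gt_eqF.
have : sig tau ^+ 3 = S0 ^+ 3.
  have nd : delta != 0 by rewrite gt_eqF.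
  apply: (mulfI nd).
  rewrite dS exprS mulrA dSE ws; field; by rewrite gt_eqF.
move=> /eqP; rewrite eqrXn2 ?ltW// => /eqP SE.
have -> : K tau - K 0 = delta * sig tau / 2 by lra.
rewrite dSE ws SE; field; by rewrite gt_eqF.
Qed.

End KeplerAction.

(** * Integrals over a period and weak derivatives *)

Section Measure.
Variable R : realType.
Local Notation mu := (@lebesgue_measure R).

(** The integral of a nonnegative function is a supremum over the simple functions below it, which
    makes it monotone on arbitrary functions. It is applied to the integrand of [action], whose
    measurability is not established. *)
Lemma ge0_le_integral_any (D : set R) (f g : R -> \bar R) :
  (forall t, D t -> (0 <= f t)%E) -> (forall t, D t -> (f t <= g t)%E) ->
  (\int[mu]_(t in D) f t <= \int[mu]_(t in D) g t)%E.
Proof.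
move=> f0 fg; rewrite !ge0_integralE//; last first.
  by move=> t Dt; exact: le_trans (f0 t Dt) (fg t Dt).
apply: ge_ereal_sup => _ [h /= hf <-]; apply: ereal_sup_ubound => /=.
exists h => // t; apply: le_trans (hf t) _.
by rewrite /patch; case: ifPn => // /set_mem /fg.
Qed.

Lemma within_continuous_measurable (a b : R) (f : R -> R) :
  {within `[a, b], continuous f} -> measurable_fun (`[a, b] : set R) f.
Proof. by move=> cf; exact: measurable_realfun.subspace_continuous_measurable_fun. Qed.

Variables (tau : R).
Hypothesis tau_gt0 : 0 < tau.
Local Notation I := (`[0%R, tau]%classic : set R).

(** |g| <= 1 + g^2, on an interval of finite length. *)
Lemma sqr_integrable (g : R -> R) : measurable_fun I g -> (sqint tau g < +oo)%E ->
  mu.-integrable I (EFin \o g).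
Proof.
move=> mg gfin; apply/integrableP; split; first exact/measurable_EFinP.
apply: (@le_lt_trans _ _ (\int[mu]_(t in I) (1%:E + (g t ^+ 2)%:E))%E).
  apply: ge0_le_integral_any => // t _.
  by rewrite /= -EFinD lee_fin; have := sqr_ge0 (`|g t| - 1); rewrite -(real_normK (num_real (g t))); nra.
rewrite ge0_integralD//.
- rewrite integral_cst//= mul1e lebesgue_measure_itv/= lte_fin tau_gt0.
  by rewrite lte_add_pinfty// -EFinB ltry.
- by move=> t _; rewrite lee_fin sqr_ge0.
- by apply/measurable_EFinP; apply: measurable_funX.
Qed.

Lemma weak_deriv_continuous (q v : loop R) i c : weak_deriv tau q v ->
  {within I, continuous (q i c)}.
Proof.
move=> /(_ i c)[_ [mv [vfin qE]]].
have iv := sqr_integrable mv vfin.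
have cF := parameterized_integral_continuous (ltW tau_gt0) iv.
have qE' t : t \in I -> q i c 0 + parameterized_integral mu 0 t (v i c) = q i c t.
  move=> /set_mem; rewrite /= in_itv/= => /andP[t0 tt].
  have it : mu.-integrable (`[0, t] : set R) (EFin \o v i c).
    by apply: integrableS iv => //; apply: subset_itvl; rewrite bnd_simp.
  apply: EFin_inj; rewrite qE ?t0// EFinD; congr (_ + _)%E.
  by rewrite /parameterized_integral /Rintegral fineK//; exact: integrable_fin_num.
apply: (@subspace_eq_continuous _ I R (fun t => q i c 0 + parameterized_integral mu 0 t (v i c))).
  exact: qE'.
move=> t; apply: cvgD; [exact: cvg_cst|exact: cF].
Qed.

Lemma ae_neq (a : R) : {ae mu, forall t, t <> a}.
Proof.
exists [set a]; split => //; first exact: lebesgue_measure_set1.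
by move=> t /= /contrapT.
Qed.

(** Lebesgue differentiation of the integral that represents [q]; the two end points form a null
    set. *)
Lemma weak_deriv_ae (q v : loop R) i c : weak_deriv tau q v ->
  (forall t, derivable (q i c) t 1) ->
  {ae mu, forall t, I t -> v i c t = derive1 (q i c) t}.
Proof.
move=> /(_ i c)[_ [mv [vfin qE]]] dq.
have iv := sqr_integrable mv vfin.
pose f := v i c \_ I.
have ifT : mu.-integrable setT (EFin \o f).
  by rewrite -restrict_EFin; apply/(integrable_mkcond _ _).1.
have locf : locally_integrable setT f by exact: integrable_locally.
have int0 y : mu.-integrable [set` Interval (BLeft 0) (BRight y)] (EFin \o f).
  by apply: integrableS ifT.
have := FTC1 int0 locf.
move=> /= HF; have FF := ae_filter_ringOfSetsType mu.
apply: filterS3 HF (ae_neq 0) (ae_neq tau) => t HF t0 tt It.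
have t0tau : 0 < t < tau.
  move: It; rewrite /= in_itv/= => /andP[h1 h2].
  by rewrite !lt_neqAle h1 h2 !andbT; apply/andP; split; apply/eqP => // /esym.
have /andP[h1 h2] := t0tau.
have [|dF F'] := HF; first by rewrite lte_fin.
have <- : f t = v i c t by rewrite /f patchE mem_set.
rewrite -F' !derive1E.
have -> : 'D_1 (q i c) t = 'D_1 (fun s => q i c s - q i c 0) t.
  have d := derivableP (dq t).
  have [_ ->] // : is_derive t 1 (fun s => q i c s - q i c 0) ('D_1 (q i c) t).
  by apply: is_derive_eq; rewrite subr0.
apply: near_eq_derive.
have : \forall s \near t, s \in `]0, tau[%R by apply: near_in_itvoo; rewrite in_itv/= h1.
apply: filterS => s; rewrite in_itv/= => /andP[s0 st].
have sI : 0 <= s <= tau by rewrite !ltW.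
apply: EFin_inj; rewrite EFinB (qE s sI) addeAC subee// add0e.
rewrite /Rintegral fineK; last first.
  by apply: integrable_fin_num => //; exact: int0.
apply: eq_integral => u; rewrite inE/= in_itv/= => /andP[u0 us].
by rewrite /f patchE mem_set//= in_itv/= u0 (le_trans us (ltW st)).
Qed.

End Measure.

(** * The lower bound on the completion *)

Section Lagrangian.
Variable R : realType.
Implicit Types (m e : 'I_3 -> R) (q v p : loop R) (t eps : R).

Lemma sum_bodies (V : nmodType) (F : 'I_3 -> V) : \sum_(i < 3) F i = F b1 + F b2 + F b3.
Proof.
rewrite !big_ord_recl big_ord0 addr0 addrA.
by congr (F _ + F _ + F _); apply/val_inj.
Qed.

Lemma sum_coords (V : nmodType) (F : 'I_2 -> V) : \sum_(c < 2) F c = F x0 + F x1.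
Proof.
rewrite !big_ord_recl big_ord0 addr0.
by congr (F _ + F _); apply/val_inj.
Qed.

Definition sep q (i j : 'I_3) (c : 'I_2) t := q i c t - q j c t.

Definition pair_lagr eps m e q v (i j : 'I_3) t :=
  m i * m j * (2^-1 * (sep v i j x0 t ^+ 2 + sep v i j x1 t ^+ 2)
    + delta m e i j * (rho eps (sep q i j x0) (sep q i j x1) t)^-1).

Definition lagr eps m e q v t :=
  pair_lagr eps m e q v b1 b2 t + pair_lagr eps m e q v b2 b3 t + pair_lagr eps m e q v b3 b1 t.

Definition kinetic m v t := 2^-1 * \sum_(i < 3) m i * \sum_(c < 2) (v i c t) ^+ 2.

(** Lagrange's identity for masses of sum 1; the last term is the kinetic energy of the centre of
    mass. *)
Lemma kineticE m v t : \sum_(i < 3) m i = 1 ->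
  kinetic m v t =
    m b1 * m b2 * (2^-1 * (sep v b1 b2 x0 t ^+ 2 + sep v b1 b2 x1 t ^+ 2))
  + m b2 * m b3 * (2^-1 * (sep v b2 b3 x0 t ^+ 2 + sep v b2 b3 x1 t ^+ 2))
  + m b3 * m b1 * (2^-1 * (sep v b3 b1 x0 t ^+ 2 + sep v b3 b1 x1 t ^+ 2))
  + 2^-1 * \sum_(c < 2) (\sum_(i < 3) m i * v i c t) ^+ 2.
Proof.
rewrite /kinetic sum_coords !sum_bodies !sum_coords /sep => m1.
move: (m b1) (m b2) (m b3) m1 => m1 m2 m3 E.
have -> : m3 = 1 - m1 - m2 by rewrite -E; ring.
by field.
Qed.

Lemma distE q i j t : dist (at_time q t) i j = rho 0 (sep q i j x0) (sep q i j x1) t.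
Proof. by rewrite /dist /at_time /rho /sep expr0n addr0. Qed.

Definition collision_free q t := forall i j : 'I_3, i != j -> exists c, q i c t != q j c t.

Lemma collision_free_rho q t i j : collision_free q t -> i != j ->
  0 < rho 0 (sep q i j x0) (sep q i j x1) t.
Proof.
move=> cf /cf[c qc]; rewrite /rho sqrtr_gt0 expr0n addr0 /sep.
have cE : c = x0 \/ c = x1.
  by case: c {qc} => [[|[|]]] // ?; [left|right]; apply/val_inj.
case: cE => E; rewrite {c}E in qc.
  by rewrite ltr_pwDl ?sqr_ge0// lt_neqAle sqr_ge0 andbT eq_sym sqrf_eq0 subr_eq0.
by rewrite ltr_wpDl ?sqr_ge0// lt_neqAle sqr_ge0 andbT eq_sym sqrf_eq0 subr_eq0.
Qed.

Lemma U_collision_free m e q t : collision_free q t ->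
  U m e (at_time q t) = (Uterm m e (at_time q t) b1 b2 + Uterm m e (at_time q t) b2 b3
    + Uterm m e (at_time q t) b3 b1)%:E.
Proof.
move=> cf; rewrite /U ifF//; apply/negbTE/negP => /existsP[i /existsP[j /andP[ij /forallP H]]].
by have [c /eqP] := cf i j ij; apply; exact: (eqP (H c)).
Qed.

Lemma rho_eps_ge eps q i j t :
  rho 0 (sep q i j x0) (sep q i j x1) t <= rho eps (sep q i j x0) (sep q i j x1) t.
Proof. by rewrite /rho ler_wsqrtr// lerD2l expr0n sqr_ge0. Qed.

Lemma rho_ge_eps eps (x y : R -> R) t : 0 <= eps -> eps <= rho eps x y t.
Proof.
move=> e0; rewrite -{1}[eps]ger0_norm// -sqrtr_sqr ler_wsqrtr//.
by rewrite lerDr addr_ge0// sqr_ge0.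
Qed.

(** At a collision the right-hand side is infinite. Elsewhere the left-hand side omits the
    nonnegative centre-of-mass term and has larger denominators. *)
Lemma lagr_le_action eps m e q v t : 0 < eps -> (forall i, 0 < m i) -> \sum_(i < 3) m i = 1 ->
  0 < delta m e b1 b2 -> 0 < delta m e b2 b3 -> 0 < delta m e b3 b1 ->
  ((lagr eps m e q v t)%:E <= (kinetic m v t)%:E + U m e (at_time q t))%E.
Proof.
move=> e0 m0 m1 d12 d23 d31.
have [/existsP[i /existsP[j /andP[ij /forallP H]]]|nc] :=
    boolP [exists i, exists j, (i != j) && [forall c, at_time q t i c == at_time q t j c]].
  rewrite /U ifT ?addey ?leey//.
  by apply/existsP; exists i; apply/existsP; exists j; rewrite ij; apply/forallP.
have cf : collision_free q t.
  move=> i j ij; apply/existsP; rewrite -negb_forall; apply: contra nc => H.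
  by apply/existsP; exists i; apply/existsP; exists j; rewrite ij.
rewrite (U_collision_free _ _ cf) -EFinD lee_fin (kineticE _ _ m1) /lagr /pair_lagr /Uterm.
have term i j : i != j -> 0 < delta m e i j ->
    m i * m j * (delta m e i j * (rho eps (sep q i j x0) (sep q i j x1) t)^-1)
    <= m i * m j * delta m e i j / dist (at_time q t) i j.
  move=> ij dij; have r0 := collision_free_rho cf ij.
  rewrite distE -[leRHS]mulrA ler_wpM2l//; first by rewrite mulr_ge0// ltW.
  rewrite ler_wpM2l ?(ltW dij)//.
  by rewrite lef_pV2 ?posrE// ?rho_eps_ge// (lt_le_trans r0)// rho_eps_ge.
have := term b1 b2 isT d12; have := term b2 b3 isT d23; have := term b3 b1 isT d31.
have : 0 <= 2^-1 * \sum_(c < 2) (\sum_(i < 3) m i * v i c t) ^+ 2.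
  by rewrite mulr_ge0 ?invr_ge0// sumr_ge0// => c _; exact: sqr_ge0.
rewrite !(mulrDr (m _ * m _)); lra.
Qed.

Lemma lagr0E m e q v t : \sum_(i < 3) m i = 1 -> collision_free q t ->
  (forall c, \sum_(i < 3) m i * v i c t = 0) ->
  ((kinetic m v t)%:E + U m e (at_time q t) = (lagr 0 m e q v t)%:E)%E.
Proof.
move=> m1 cf v0.
rewrite (U_collision_free _ _ cf) -EFinD (kineticE _ _ m1) /lagr /pair_lagr /Uterm !distE.
by rewrite big1 => [|c _]; [congr EFin; rewrite mulr0; ring|rewrite v0 expr0n].
Qed.

(** Reverse triangle inequality for the vectors (x, y, eps) and (x', y', eps), by Cauchy-Schwarz. *)
Lemma rho_lipschitz eps (x y x' y' : R -> R) t :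
  (rho eps x' y' t - rho eps x y t) ^+ 2 <= (x t - x' t) ^+ 2 + (y t - y' t) ^+ 2.
Proof.
have := sqr_rho eps x y t; have := sqr_rho eps x' y' t.
have := rho_ge0 eps x y t; have := rho_ge0 eps x' y' t.
move: (rho _ _ _ _) (rho _ _ _ _) (x t) (y t) (x' t) (y' t) => r r' a b a' b' r0 r'0 E E'.
suff : a * a' + b * b' + eps ^+ 2 <= r * r' by rewrite sqrrB E E'; nra.
rewrite leNgt; apply/negP => lt.
have : (r * r') ^+ 2 < (a * a' + b * b' + eps ^+ 2) ^+ 2.
  by rewrite ltr_pXn2r// nnegrE ?mulr_ge0// ltW// (le_lt_trans _ lt)// mulr_ge0.
rewrite exprMn E E' ltNge => /negP; apply; rewrite -subr_ge0.
rewrite (_ : _ - _ = (a * b' - b * a') ^+ 2 + eps ^+ 2 * ((a - a') ^+ 2 + (b - b') ^+ 2)); last by ring.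
by rewrite addr_ge0 ?sqr_ge0// mulr_ge0 ?addr_ge0 ?sqr_ge0.
Qed.

(** Both radii are at least [eps], so the inverse is Lipschitz with constant 1/eps^2. The parameter
    [kap] trades the distance for its square, the quantity whose integral [dist2] controls. *)
Lemma inv_rho_close eps kap (x y x' y' : R -> R) t : 0 < eps -> 0 < kap ->
  (rho eps x y t)^-1 <= (rho eps x' y' t)^-1
    + (kap + ((x t - x' t) ^+ 2 + (y t - y' t) ^+ 2) / kap) / eps ^+ 2.
Proof.
move=> e0 k0; have := rho_lipschitz eps x y x' y' t.
have := rho_ge_eps x y t (ltW e0); have := rho_ge_eps x' y' t (ltW e0).
move: (rho eps x y t) (rho eps x' y' t) ((_ - _) ^+ 2 + (_ - _) ^+ 2) => r r' z hr' hr hz.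
have r0 : 0 < r := lt_le_trans e0 hr; have r'0 : 0 < r' := lt_le_trans e0 hr'.
have z0 : 0 <= z := le_trans (sqr_ge0 _) hz.
have E : r^-1 = r'^-1 + (r' - r) / (r * r') by field; rewrite !gt_eqF.
rewrite E lerD2l; have [neg|pos] := leP (r' - r) 0.
  apply: (@le_trans _ _ 0); first by rewrite mulr_le0_ge0// invr_ge0 (ltW (mulr_gt0 r0 r'0)).
  by apply: divr_ge0; [apply: addr_ge0 (ltW k0) _; apply: divr_ge0 z0 (ltW k0)|exact: sqr_ge0].
apply: (@le_trans _ _ ((r' - r) / eps ^+ 2)).
  rewrite ler_wpM2l ?(ltW pos)// lef_pV2 ?posrE ?mulr_gt0 ?exprn_gt0// expr2.
  by apply: ler_pM => //; exact: ltW.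
rewrite ler_wpM2r ?invr_ge0 ?sqr_ge0//.
rewrite -(ler_pM2r k0) (mulrDl kap) divfK ?gt_eqF//.
move: hz pos; set d := r' - r => hz pos; have := sqr_ge0 (kap - d); nra.
Qed.

End Lagrangian.

(** * Comparing the regularized Lagrangians of two nearby loops *)

Section ActionBound.
Variable R : realType.
Local Notation mu := (@lebesgue_measure R).
Implicit Types (m e : 'I_3 -> R) (q v p w : loop R) (t eps : R).

(** The share of body [k] in the integrand of [dist2]. *)
Definition gap q v p w (k : 'I_3) t : R :=
  \sum_(c < 2) ((q k c t - p k c t) ^+ 2 + (v k c t - w k c t) ^+ 2).

Lemma gap_ge0 q v p w k t : 0 <= gap q v p w k t.
Proof. by apply: sumr_ge0 => c _; rewrite addr_ge0 ?sqr_ge0. Qed.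

Lemma young_sqr (kap a b : R) : 0 < kap ->
  b ^+ 2 <= (1 + kap) * a ^+ 2 + (1 + kap^-1) * (a - b) ^+ 2.
Proof.
move=> k0; rewrite -subr_ge0.
rewrite (_ : _ - _ = kap^-1 * ((1 + kap) * a - b) ^+ 2); last by field; rewrite gt_eqF.
by rewrite mulr_ge0 ?sqr_ge0// invr_ge0 ltW.
Qed.

Lemma sqr_subr_le (a b : R) : (a - b) ^+ 2 <= 2 * (a ^+ 2 + b ^+ 2).
Proof. by have := sqr_ge0 (a + b); nra. Qed.

Lemma pair_lagr_close eps kap m e q v p w i j t : 0 < eps -> 0 < kap ->
  0 < m i -> 0 < m j -> m i <= 1 -> m j <= 1 -> 0 < delta m e i j ->
  pair_lagr eps m e p w i j t <= (1 + kap) * pair_lagr eps m e q v i j t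
    + delta m e i j / eps ^+ 2 * kap
    + (1 + kap^-1 + delta m e i j / (eps ^+ 2 * kap)) * (2 * (gap q v p w i t + gap q v p w j t)).
Proof.
move=> e0 k0 mi mj mi1 mj1.
have mm0 : 0 < m i * m j by rewrite mulr_gt0.
have mm1 : m i * m j <= 1 by rewrite mulr_ile1// ltW.
rewrite /pair_lagr; move: (delta m e i j) (m i * m j) mm0 mm1 => d M M0 M1 d0.
have Hr := inv_rho_close (sep p i j x0) (sep p i j x1) (sep q i j x0) (sep q i j x1) t e0 k0.
have rq : 0 <= (rho eps (sep q i j x0) (sep q i j x1) t)^-1 by rewrite invr_ge0 rho_ge0.
have H0 := young_sqr (sep v i j x0 t) (sep w i j x0 t) k0.
have H1 := young_sqr (sep v i j x1 t) (sep w i j x1 t) k0.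
rewrite -!/(sep _ _ _ _ _) in Hr.
move: (rho eps (sep p i j x0) _ t)^-1 (rho _ _ _ _)^-1 rq Hr => rp rq rq0 Hr.
have d2 c (f g : loop R) : (sep f i j c t - sep g i j c t) ^+ 2 <=
    2 * ((f i c t - g i c t) ^+ 2 + (f j c t - g j c t) ^+ 2).
  rewrite (_ : sep f i j c t - sep g i j c t = (f i c t - g i c t) - (f j c t - g j c t)).
    exact: sqr_subr_le.
  by rewrite /sep; ring.
pose a := (sep v i j x0 t - sep w i j x0 t) ^+ 2 + (sep v i j x1 t - sep w i j x1 t) ^+ 2.
pose b := (sep p i j x0 t - sep q i j x0 t) ^+ 2 + (sep p i j x1 t - sep q i j x1 t) ^+ 2.
have ab : a + b <= 2 * (gap q v p w i t + gap q v p w j t).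
  have := d2 x0 q p; have := d2 x1 q p; have := d2 x0 v w; have := d2 x1 v w.
  rewrite /a /b /gap !sum_coords ![(sep p _ _ _ _ - _) ^+ 2](sqrrB) ![(sep q _ _ _ _ - sep p _ _ _ _) ^+ 2]sqrrB; lra.
move: (2 * (gap _ _ _ _ i t + _)) ab => N ab.
have a0 : 0 <= a by rewrite addr_ge0 ?sqr_ge0.
have b0 : 0 <= b by rewrite addr_ge0 ?sqr_ge0.
set W := sep w i j x0 t ^+ 2 + sep w i j x1 t ^+ 2.
set V := sep v i j x0 t ^+ 2 + sep v i j x1 t ^+ 2.
pose k := 1 + kap^-1; pose ie := (eps ^+ 2)^-1.
have ik0 : 0 < kap^-1 by rewrite invr_gt0.
have ie0 : 0 < ie by rewrite invr_gt0 exprn_gt0.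
have HW : W <= (1 + kap) * V + k * a by rewrite /W /V /k /a; lra.
have Hr' : rp <= rq + (kap + b * kap^-1) * ie by [].
have Hd := ler_wpM2l (ltW d0) Hr'.
have H2 : M * (2^-1 * W + d * rp) <=
    M * (2^-1 * ((1 + kap) * V + k * a) + d * (rq + (kap + b * kap^-1) * ie)).
  by rewrite ler_wpM2l ?(ltW M0)//; lra.
apply: (le_trans H2).
have -> : d / (eps ^+ 2 * kap) = d * ie * kap^-1 by rewrite /ie; field; rewrite !gt_eqF.
rewrite -/ie -/k.
have die : 0 < d * ie by rewrite mulr_gt0.
have dik : 0 < d * ie * kap^-1 by rewrite mulr_gt0.
have k1 : 0 < k by rewrite addr_gt0.
have t1 : M * (2^-1 * (k * a)) <= k * N.
  have : k * a <= k * N by rewrite ler_wpM2l ?(ltW k1)//; lra.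
  have ka : 0 <= k * a by rewrite mulr_ge0 ?(ltW k1).
  have : M * (k * a) <= 1 * (k * a) by rewrite ler_wpM2r.
  lra.
have t2 : M * (d * ie * kap) <= d * ie * kap.
  by rewrite -[leRHS]mul1r ler_wpM2r// mulr_ge0 ?(ltW die) ?(ltW k0).
have t3 : M * (d * ie * kap^-1 * b) <= d * ie * kap^-1 * N.
  have : d * ie * kap^-1 * b <= d * ie * kap^-1 * N by rewrite ler_wpM2l ?(ltW dik)//; lra.
  apply: le_trans; rewrite -[leRHS]mul1r ler_wpM2r//.
  exact: mulr_ge0 (ltW dik) b0.
have t4 : 0 <= M * (kap * (d * rq)) by rewrite mulr_ge0 ?(ltW M0)// mulr_ge0 ?(ltW k0)// mulr_ge0 ?(ltW d0).
apply: (@le_trans _ _ ((1 + kap) * (M * (2^-1 * V + d * rq)) - M * (kap * (d * rq))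
  + M * (2^-1 * (k * a)) + M * (d * ie * kap) + M * (d * ie * kap^-1 * b))).
  by rewrite le_eqVlt; apply/orP; left; apply/eqP; ring.
lra.
Qed.

(** Meant for [kap] fixed first and the loops taken close afterwards. The factor 4 is a 2 from
    squaring a difference, times a 2 because each body belongs to two pairs. *)
Lemma lagr_close eps kap m e q v p w t : 0 < eps -> 0 < kap ->
  (forall i, 0 < m i) -> \sum_(i < 3) m i = 1 ->
  0 < delta m e b1 b2 -> 0 < delta m e b2 b3 -> 0 < delta m e b3 b1 ->
  forall D, D = delta m e b1 b2 + delta m e b2 b3 + delta m e b3 b1 ->
  lagr eps m e p w t <= (1 + kap) * lagr eps m e q v t + D / eps ^+ 2 * kap
    + 4 * (1 + kap^-1 + D / (eps ^+ 2 * kap)) * \sum_(k < 3) gap q v p w k t.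
Proof.
move=> e0 k0 m0 m1 d12 d23 d31 D ->.
have mle i : m i <= 1.
  by rewrite -m1 (bigD1 i)//= lerDl sumr_ge0// => j _; exact: ltW.
have A1 := pair_lagr_close q v p w t e0 k0 (m0 b1) (m0 b2) (mle b1) (mle b2) d12.
have A2 := pair_lagr_close q v p w t e0 k0 (m0 b2) (m0 b3) (mle b2) (mle b3) d23.
have A3 := pair_lagr_close q v p w t e0 k0 (m0 b3) (m0 b1) (mle b3) (mle b1) d31.
rewrite sum_bodies /lagr.
have := gap_ge0 q v p w b1 t; have := gap_ge0 q v p w b2 t; have := gap_ge0 q v p w b3 t.
move: A1 A2 A3.
move: (gap _ _ _ _ b1 t) (gap _ _ _ _ b2 t) (gap _ _ _ _ b3 t) => g1 g2 g3.
move: (delta m e b1 b2) (delta m e b2 b3) (delta m e b3 b1) d12 d23 d31 => D1 D2 D3 d12 d23 d31.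
have ii : 0 < (eps ^+ 2 * kap)^-1 by rewrite invr_gt0 mulr_gt0// exprn_gt0.
move: (pair_lagr _ _ _ p w b1 b2 t) (pair_lagr _ _ _ p w b2 b3 t) (pair_lagr _ _ _ p w b3 b1 t).
move: (pair_lagr _ _ _ q v b1 b2 t) (pair_lagr _ _ _ q v b2 b3 t) (pair_lagr _ _ _ q v b3 b1 t).
move: (eps ^+ 2 * kap)^-1 (eps ^+ 2)^-1 kap^-1 ii => ii ie ik ii0 l1 l2 l3 p1 p2 p3 A1 A2 A3 g30 g20 g10.
have key Da Db Dc (x y z : R) : 0 < Db -> 0 < Dc -> 0 <= x -> 0 <= y ->
  (1 + ik + Da * ii) * (2 * (x + y)) <= (1 + ik + (Da + Db + Dc) * ii) * (2 * (x + y)).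
  move=> db dc x0 y0; rewrite ler_wpM2r ?mulr_ge0 ?addr_ge0// lerD2l ler_wpM2r ?(ltW ii0)//; lra.
have B1 := key D1 D2 D3 g1 g2 0 d23 d31 g10 g20.
have B2 := key D2 D3 D1 g2 g3 0 d31 d12 g20 g30.
have B3 := key D3 D1 D2 g3 g1 0 d12 d23 g30 g10.
rewrite (_ : D2 + D3 + D1 = D1 + D2 + D3) in B2; last by ring.
rewrite (_ : D3 + D1 + D2 = D1 + D2 + D3) in B3; last by ring.
move: A1 A2 A3 B1 B2 B3; move: (1 + ik + (D1 + D2 + D3) * ii) (1 + ik + D1 * ii) (1 + ik + D2 * ii) (1 + ik + D3 * ii).
move=> Q Q1 Q2 Q3; lra.
Qed.

End ActionBound.

(** * The lower bound on smooth loops *)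

Section OmegaBound.
Variable R : realType.
Local Notation mu := (@lebesgue_measure R).
Implicit Types (m e : 'I_3 -> R) (q v p w : loop R) (t eps tau : R).

Lemma smooth_is_derive (g : R -> R) : smooth g ->
  [/\ forall t, is_derive t 1 g (derive1 g t),
      forall t, is_derive t 1 (derive1 g) (derive1 (derive1 g) t) & continuous (derive1 g)].
Proof.
move=> sg.
have D1 t : is_derive t 1 g (derive1 g t) by rewrite derive1E; apply: derivableP; exact: (sg 0%N t).
have D2 t : is_derive t 1 (derive1 g) (derive1 (derive1 g) t).
  by rewrite [X in is_derive _ _ _ X]derive1E; apply: derivableP; exact: (sg 1%N t).
by split => // t; exact: is_derive_continuous (D2 t).
Qed.

Lemma rho_continuous eps (x y dx dy : R -> R) :
  (forall t, is_derive t 1 x (dx t)) -> (forall t, is_derive t 1 y (dy t)) ->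
  (forall t, 0 < rho eps x y t) ->
  continuous (rho eps x y) /\ continuous (fun t => (rho eps x y t)^-1).
Proof.
move=> Dx Dy r0; have cr : continuous (rho eps x y).
  by move=> t; exact: is_derive_continuous (is_derive_rho (r0 t) (Dx t) (Dy t)).
by split => // t; apply: cvgV; [rewrite gt_eqF|exact: cr].
Qed.

Lemma loop_antiderivatives eps (x y dx dy : R -> R) :
  (forall t, is_derive t 1 x (dx t)) -> (forall t, is_derive t 1 y (dy t)) ->
  continuous dx -> continuous dy -> (forall t, 0 < rho eps x y t) ->
  exists K sig : R -> R, [/\ forall t, 0 <= t -> is_derive t 1 K (2^-1 * (dx t ^+ 2 + dy t ^+ 2)),
    forall t, 0 <= t -> is_derive t 1 sig (rho eps x y t)^-1, K 0 = 0 & sig 0 = 0].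
Proof.
move=> Dx Dy cdx cdy r0.
have [K K0 DK] : exists2 K : R -> R, K 0 = 0 &
    forall t, -1 < t -> is_derive t 1 K (2^-1 * (dx t ^+ 2 + dy t ^+ 2)).
  apply: antiderivative => t; apply: cvgM; first exact: cvg_cst.
  by apply: cvgD; apply: cvgM; (exact: cdx || exact: cdy).
have [sig s0 Ds] := antiderivative (rho_continuous Dx Dy r0).2.
by exists K, sig; split => // t t0; [apply: DK|apply: Ds]; exact: lt_le_trans (ltrN10 R) t0.
Qed.

Definition velocity q : loop R := fun i c => derive1 (q i c).

Definition C1_loop q := forall i c, (forall t, is_derive t 1 (q i c) (velocity q i c t)) /\
  continuous (velocity q i c).

Lemma sep_is_derive q i j c t : C1_loop q ->
  is_derive t 1 (sep q i j c) (sep (velocity q) i j c t).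
Proof. by move=> Cq; have [di _] := Cq i c; have [dj _] := Cq j c; exact: is_deriveB. Qed.

Lemma sep_continuous q i j c : C1_loop q -> continuous (sep (velocity q) i j c).
Proof. by move=> Cq t; apply: cvgB; [exact: (Cq i c).2|exact: (Cq j c).2]. Qed.

(** Normalized to vanish at 0, so that the values at [tau] are the kinetic action and the integral
    of 1/rho over a period. *)
Definition pair_antiderivative eps q i j (K sig : R -> R) :=
  [/\ forall t, 0 <= t -> is_derive t 1 K
         (2^-1 * (sep (velocity q) i j x0 t ^+ 2 + sep (velocity q) i j x1 t ^+ 2)),
      forall t, 0 <= t -> is_derive t 1 sig (rho eps (sep q i j x0) (sep q i j x1) t)^-1,
      K 0 = 0 & sig 0 = 0].

Lemma pair_antiderivatives eps q i j : C1_loop q ->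
  (forall t, 0 < rho eps (sep q i j x0) (sep q i j x1) t) ->
  exists K sig : R -> R, pair_antiderivative eps q i j K sig.
Proof.
move=> Cq r0; apply: (@loop_antiderivatives _ _ _ (sep (velocity q) i j x0)
  (sep (velocity q) i j x1)) => //; try exact: sep_continuous.
  by move=> t; exact: sep_is_derive.
by move=> t; exact: sep_is_derive.
Qed.

Lemma pair_lagr_continuous eps m e q i j : C1_loop q ->
  (forall t, 0 < rho eps (sep q i j x0) (sep q i j x1) t) ->
  continuous (pair_lagr eps m e q (velocity q) i j).
Proof.
move=> Cq r0 t; apply: cvgM; first exact: cvg_cst.
have cs c : continuous (sep (velocity q) i j c) := sep_continuous Cq.
apply: cvgD; apply: cvgM; try exact: cvg_cst.
  by apply: cvgD; apply: cvgM; exact: cs.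
apply: (rho_continuous _ _ r0).2 => u; exact: sep_is_derive.
Qed.

Lemma integral_lagr eps m e q tau K1 s1 K2 s2 K3 s3 : 0 < tau -> C1_loop q ->
  (forall i j, i != j -> forall t, 0 < rho eps (sep q i j x0) (sep q i j x1) t) ->
  pair_antiderivative eps q b1 b2 K1 s1 ->
  pair_antiderivative eps q b2 b3 K2 s2 ->
  pair_antiderivative eps q b3 b1 K3 s3 ->
  (\int[mu]_(t in `[0%R, tau]) (lagr eps m e q (velocity q) t)%:E =
   (m b1 * m b2 * (K1 tau + delta m e b1 b2 * s1 tau)
  + m b2 * m b3 * (K2 tau + delta m e b2 b3 * s2 tau)
  + m b3 * m b1 * (K3 tau + delta m e b3 b1 * s3 tau))%:E)%E.
Proof.
move=> tau0 Cq r0 [DK1 Ds1 K10 s10] [DK2 Ds2 K20 s20] [DK3 Ds3 K30 s30].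
pose H t := m b1 * m b2 * (K1 t + delta m e b1 b2 * s1 t)
  + m b2 * m b3 * (K2 t + delta m e b2 b3 * s2 t)
  + m b3 * m b1 * (K3 t + delta m e b3 b1 * s3 t).
transitivity (H tau - H 0)%:E; last first.
  by congr EFin; rewrite /H K10 K20 K30 s10 s20 s30; ring.
apply: (@integral_antiderivative R (lagr eps m e q (velocity q)) H 0 tau tau0).
  move=> t; apply: cvgD; last by apply: pair_lagr_continuous => //; exact: r0.
  by apply: cvgD; apply: pair_lagr_continuous => //; exact: r0.
move=> t /andP[t0 _].
have d1 := DK1 t t0; have d2 := DK2 t t0; have d3 := DK3 t t0.
have d4 := Ds1 t t0; have d5 := Ds2 t t0; have d6 := Ds3 t t0.
rewrite /H; apply: is_derive_eq; rewrite /GRing.scale /= /lagr /pair_lagr; ring.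
Qed.

Lemma Omega_C1 m tau k1 k2 k3 q : Omega m tau k1 k2 k3 q -> C1_loop q.
Proof.
move=> [H _] i c; have [sq _] := H i c.
by have [D1 _ cq] := smooth_is_derive sq.
Qed.

Lemma rho_pos eps (x y : R -> R) t : 0 < eps -> 0 < rho eps x y t.
Proof. by move=> e0; apply: lt_le_trans e0 (rho_ge_eps _ _ _ (ltW e0)). Qed.

Definition kepler_min tau S0 : R := 6 * pi ^+ 2 * tau / S0 ^+ 2.

Lemma winding_gordon_loop eps q i j tau (s : int) K sig : 0 < tau -> s = 1 \/ s = -1 ->
  C1_loop q -> (forall c t, q i c (t + tau) = q i c t) -> (forall c t, q j c (t + tau) = q j c t) ->
  (forall t, 0 < rho eps (sep q i j x0) (sep q i j x1) t) ->
  winding tau (sep q i j x0) (sep q i j x1) s ->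
  pair_antiderivative eps q i j K sig ->
  exists e1 e2 t2 a b : R, gordon_loop (sep q i j x0) (sep q i j x1)
    (sep (velocity q) i j x0) (sep (velocity q) i j x1) K sig tau eps e1 e2 t2 a b.
Proof.
move=> tau0 s1 Cq pi_ pj r0 W [DK Ds K0 sg0].
have [e1 [e2 [t2 [a [b [H1 H2 H3 H4 [H5 H6]]]]]]] := winding_antipode tau0 s1 W.
have per c : sep q i j c tau = sep q i j c 0.
  by rewrite /sep -{1 2}[tau]add0r pi_ pj.
exists e1, e2, t2, a, b; split => //; try by move=> t _; exact: sep_is_derive.
  by move=> t /andP[t0 _]; exact: DK.
by move=> t /andP[t0 _]; exact: Ds.
Qed.

Section Bound.
Variables (m e : 'I_3 -> R) (tau : R) (s : int) (S12 S23 S31 : R).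
Hypothesis m0 : forall i, 0 < m i.
Hypothesis m1 : \sum_(i < 3) m i = 1.
Hypothesis d12 : 0 < delta m e b1 b2.
Hypothesis d23 : 0 < delta m e b2 b3.
Hypothesis d31 : 0 < delta m e b3 b1.
Hypothesis tau0 : 0 < tau.
Hypothesis s1 : s = 1 \/ s = -1.
Hypothesis S12_gt0 : 0 < S12.
Hypothesis S23_gt0 : 0 < S23.
Hypothesis S31_gt0 : 0 < S31.
Hypothesis S12E : delta m e b1 b2 * S12 ^+ 3 = 4 * pi ^+ 2 * tau.
Hypothesis S23E : delta m e b2 b3 * S23 ^+ 3 = 4 * pi ^+ 2 * tau.
Hypothesis S31E : delta m e b3 b1 * S31 ^+ 3 = 4 * pi ^+ 2 * tau.

Definition min_action : R := m b1 * m b2 * kepler_min tau S12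
  + m b2 * m b3 * kepler_min tau S23 + m b3 * m b1 * kepler_min tau S31.

Lemma mass_prod_le1 i j : m i * m j <= 1.
Proof.
have mle k : m k <= 1 by rewrite -m1 (bigD1 k)//= lerDl sumr_ge0// => l _; exact: ltW.
by rewrite mulr_ile1// ltW.
Qed.

(** One [eps], the minimum of three thresholds, serves all pairs and all loops. Each pair may lose
    gam/3, since m_i m_j <= 1. *)
Lemma Omega_lagr_ge (gam : R) : 0 < gam -> exists2 eps : R, 0 < eps &
  forall p, Omega m tau s s s p ->
  ((min_action - gam)%:E <= \int[mu]_(t in `[0%R, tau]) (lagr eps m e p (velocity p) t)%:E)%E.
Proof.
move=> g0; have g3 : 0 < gam / 3 by rewrite divr_gt0.
have [ea ea0 Ha] := gordon_regularized tau0 S12_gt0 S12E g3.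
have [eb eb0 Hb] := gordon_regularized tau0 S23_gt0 S23E g3.
have [ec ec0 Hc] := gordon_regularized tau0 S31_gt0 S31E g3.
pose eps := Num.min ea (Num.min eb ec).
have eps0 : 0 < eps by rewrite !lt_min ea0 eb0 ec0.
exists eps => // p Op; have Cp := Omega_C1 Op.
have rp i j t : 0 < rho eps (sep p i j x0) (sep p i j x1) t by exact: rho_pos.
have [K1 [g1 A1]] := pair_antiderivatives Cp (rp b1 b2).
have [K2 [g2 A2]] := pair_antiderivatives Cp (rp b2 b3).
have [K3 [g3' A3]] := pair_antiderivatives Cp (rp b3 b1).
rewrite (integral_lagr m e tau0 Cp _ A1 A2 A3)// lee_fin.
have [per [_ [_ [W1 [W2 W3]]]]] := Op.
have pr i c t : p i c (t + tau) = p i c t by exact: (per i c).2.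
have [e1 [e2 [t2 [a [b G1]]]]] := winding_gordon_loop tau0 s1 Cp (pr b1) (pr b2) (rp b1 b2) W1 A1.
have [e1' [e2' [t2' [a' [b' G2]]]]] := winding_gordon_loop tau0 s1 Cp (pr b2) (pr b3) (rp b2 b3) W2 A2.
have [f1 [f2 [u2 [c [d G3]]]]] := winding_gordon_loop tau0 s1 Cp (pr b3) (pr b1) (rp b3 b1) W3 A3.
have epa : 0 <= eps <= ea by rewrite (ltW eps0) ge_min lexx.
have epb : 0 <= eps <= eb by rewrite (ltW eps0) !ge_min lexx orbT.
have epc : 0 <= eps <= ec by rewrite (ltW eps0) !ge_min lexx !orbT.
have h1 : kepler_min tau S12 - gam / 3 <= K1 tau + delta m e b1 b2 * g1 tau.
  by have := Ha eps epa _ _ _ _ _ _ _ _ _ _ _ G1; have [_ _ -> _] := A1; rewrite subr0.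
have h2 : kepler_min tau S23 - gam / 3 <= K2 tau + delta m e b2 b3 * g2 tau.
  by have := Hb eps epb _ _ _ _ _ _ _ _ _ _ _ G2; have [_ _ -> _] := A2; rewrite subr0.
have h3 : kepler_min tau S31 - gam / 3 <= K3 tau + delta m e b3 b1 * g3' tau.
  by have := Hc eps epc _ _ _ _ _ _ _ _ _ _ _ G3; have [_ _ -> _] := A3; rewrite subr0.
have w i j (k l : R) : 0 < m i -> 0 < m j -> k - gam / 3 <= l -> m i * m j * k - gam / 3 <= m i * m j * l.
  move=> mi mj kl; have mm : 0 <= m i * m j by rewrite mulr_ge0// ltW.
  have := ler_wpM2l mm kl; have := ler_wpM2r (ltW g3) (mass_prod_le1 i j).
  rewrite mulrBr; lra.
have := w b1 b2 _ _ (m0 b1) (m0 b2) h1.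
have := w b2 b3 _ _ (m0 b2) (m0 b3) h2.
have := w b3 b1 _ _ (m0 b3) (m0 b1) h3.
by rewrite /min_action; lra.
Qed.

End Bound.
End OmegaBound.

(** * Passage of the lower bound to the W^{1,2}-closure *)

Section ActionGe.
Variable R : realType.
Local Notation mu := (@lebesgue_measure R).
Implicit Types (m e : 'I_3 -> R) (q v p w : loop R) (t eps tau : R).

Lemma within_rho_measurable eps (x y : R -> R) tau : 0 < eps ->
  {within `[0, tau], continuous x} -> {within `[0, tau], continuous y} ->
  measurable_fun (`[0, tau] : set R) (fun t => (rho eps x y t)^-1).
Proof.
move=> e0 cx cy; apply: within_continuous_measurable => t.
apply: cvgV; first by rewrite gt_eqF// rho_pos.
apply: (@continuous_cvg _ _ _ _ _ _ (@Num.sqrt R)); first exact: sqrt_continuous.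
apply: cvgD; last exact: cvg_cst.
by apply: cvgD; apply: cvgM; (exact: cx || exact: cy).
Qed.

Section Fixed.
Variables (tau : R).
Hypothesis tau0 : 0 < tau.
Local Notation I := (`[0%R, tau]%classic : set R).

Lemma lagr_measurable eps m e q v : 0 < eps -> weak_deriv tau q v ->
  measurable_fun I (lagr eps m e q v).
Proof.
move=> e0 wd.
have cq i c := weak_deriv_continuous tau0 (i:=i) (c:=c) wd.
have cs i j c : {within I, continuous (sep q i j c)}.
  by move=> t; apply: cvgB; exact: cq.
have mv i c : measurable_fun I (v i c) by have [_ []] := wd i c.
have ms i j c : measurable_fun I (sep v i j c) by exact: measurable_funB.
have mp i j : measurable_fun I (pair_lagr eps m e q v i j).
  apply: measurable_funM => //; apply: measurable_funD.
    by apply: measurable_funM => //; apply: measurable_funD; apply: measurable_funX.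
  by apply: measurable_funM => //; exact: within_rho_measurable.
by apply: measurable_funD => //; apply: measurable_funD.
Qed.

Lemma lagr_ge0 eps m e q v t : (forall i, 0 < m i) ->
  0 < delta m e b1 b2 -> 0 < delta m e b2 b3 -> 0 < delta m e b3 b1 -> 0 <= lagr eps m e q v t.
Proof.
move=> m0 d12 d23 d31.
have P i j : 0 < delta m e i j -> 0 <= pair_lagr eps m e q v i j t.
  move=> d; rewrite /pair_lagr mulr_ge0//; first by rewrite mulr_ge0// ltW.
  apply: addr_ge0; apply: mulr_ge0; rewrite ?invr_ge0 ?rho_ge0 ?(ltW d)//.
  by rewrite addr_ge0 ?sqr_ge0.
by rewrite !addr_ge0// P.
Qed.

Lemma integral_gap q v p w :
  (forall i c, [/\ measurable_fun I (q i c), measurable_fun I (v i c),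
     measurable_fun I (p i c) & measurable_fun I (w i c)]) ->
  (\int[mu]_(t in I) (\sum_(k < 3) gap q v p w k t)%:E = dist2 tau q v p w)%E.
Proof.
move=> mm.
have mg k c : measurable_fun I (fun t => (q k c t - p k c t) ^+ 2) /\
              measurable_fun I (fun t => (v k c t - w k c t) ^+ 2).
  by have [? ? ? ?] := mm k c; split; apply: measurable_funX; exact: measurable_funB.
have mk k c : measurable_fun I (fun t => (q k c t - p k c t) ^+ 2 + (v k c t - w k c t) ^+ 2).
  by have [? ?] := mg k c; exact: measurable_funD.
have mk' k c := proj2 (measurable_EFinP _ _) (mk k c).
have g0 k c t : (0 <= ((q k c t - p k c t) ^+ 2 + (v k c t - w k c t) ^+ 2)%:E)%E.
  by rewrite lee_fin addr_ge0 ?sqr_ge0.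
have mgap k : measurable_fun I (fun t => (gap q v p w k t)%:E).
  by apply/measurable_EFinP; exact: measurable_sum.
under eq_integral do rewrite -sumEFin.
rewrite ge0_integral_sum//; last by move=> k t _; rewrite lee_fin gap_ge0.
apply: eq_bigr => k _; rewrite /gap.
under eq_integral do rewrite -sumEFin.
rewrite ge0_integral_sum//; last by move=> c; exact: mk'.
apply: eq_bigr => c _.
under eq_integral do rewrite EFinD.
have [m1 m2] := mg k c.
rewrite ge0_integralD//; try exact/measurable_EFinP.
  by move=> t _; rewrite lee_fin sqr_ge0.
by move=> t _; rewrite lee_fin sqr_ge0.
Qed.

End Fixed.

Section Bound.
Variables (m e : 'I_3 -> R) (tau : R) (s : int) (S12 S23 S31 : R).
Hypothesis m0 : forall i, 0 < m i.
Hypothesis m1 : \sum_(i < 3) m i = 1.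
Hypothesis d12 : 0 < delta m e b1 b2.
Hypothesis d23 : 0 < delta m e b2 b3.
Hypothesis d31 : 0 < delta m e b3 b1.
Hypothesis tau0 : 0 < tau.
Hypothesis s1 : s = 1 \/ s = -1.
Hypothesis S12_gt0 : 0 < S12.
Hypothesis S23_gt0 : 0 < S23.
Hypothesis S31_gt0 : 0 < S31.
Hypothesis S12E : delta m e b1 b2 * S12 ^+ 3 = 4 * pi ^+ 2 * tau.
Hypothesis S23E : delta m e b2 b3 * S23 ^+ 3 = 4 * pi ^+ 2 * tau.
Hypothesis S31E : delta m e b3 b1 * S31 ^+ 3 = 4 * pi ^+ 2 * tau.

Lemma lagr_integral_le_action eps q v : 0 < eps ->
  (\int[mu]_(t in `[0%R, tau]) (lagr eps m e q v t)%:E <= action m e tau q v)%E.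
Proof.
move=> e0; apply: ge0_le_integral_any => t _; first by rewrite lee_fin lagr_ge0.
exact: lagr_le_action.
Qed.

(** The tolerance [gam] is spent in thirds: on the regularization, on the terms carrying [kap], and
    on the W^{1,2} distance to a loop of [Omega]. They are chosen in that order, each depending on
    the previous ones. *)
Lemma action_ge q v : Xset m tau s s s q v ->
  ((min_action m tau S12 S23 S31)%:E <= action m e tau q v)%E.
Proof.
move=> [wd close].
set I := (`[0%R, tau]%classic : set R).
have A0 : (0 <= action m e tau q v)%E.
  apply: le_trans (lagr_integral_le_action q v ltr01).
  by apply: integral_ge0 => t _; rewrite lee_fin lagr_ge0.
case AE : (action m e tau q v) A0 => [A| |//] A0; last by rewrite leey.
rewrite lee_fin in A0 *.
apply/ler_addgt0Pr => gam gam0.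
have g3 : 0 < gam / 3 by rewrite divr_gt0.
have [eps e0 low] := Omega_lagr_ge m0 m1 tau0 s1 S12_gt0 S23_gt0 S31_gt0 S12E S23E S31E g3.
pose D := delta m e b1 b2 + delta m e b2 b3 + delta m e b3 b1.
have D0 : 0 < D := addr_gt0 (addr_gt0 d12 d23) d31.
(* A bound for everything that [kap] multiplies in the integrated comparison; the summand 1 makes it
   positive. *)
pose B := A + D / eps ^+ 2 * tau + 1.
have e2 : 0 < eps ^+ 2 by rewrite exprn_gt0.
have De : 0 <= D / eps ^+ 2 * tau by rewrite mulr_ge0 ?(ltW tau0)// divr_ge0 ?(ltW D0) ?(ltW e2).
have B0 : 0 < B by rewrite /B; lra.
pose kap := gam / 3 / B.
have k0 : 0 < kap by rewrite divr_gt0.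
pose C := 4 * (1 + kap^-1 + D / (eps ^+ 2 * kap)).
have C0 : 0 < C.
  apply: mulr_gt0 => //; apply: addr_gt0; first by rewrite addr_gt0 ?invr_gt0.
  by apply: divr_gt0 => //; exact: mulr_gt0.
have [p [Op dp]] := close (gam / 3 / C) (divr_gt0 g3 C0).
have Cp := Omega_C1 Op.
have cp i c : continuous (p i c) by move=> t; exact: is_derive_continuous ((Cp i c).1 t).
have cw i c : continuous (velocity p i c) := (Cp i c).2.
have mq i c : measurable_fun I (q i c).
  exact: within_continuous_measurable (weak_deriv_continuous tau0 (i:=i) (c:=c) wd).
have mc (g : R -> R) : continuous g -> measurable_fun I g.
  by move=> cg; apply: within_continuous_measurable; exact: continuous_subspaceT.
have mN : measurable_fun I (fun t => \sum_(k < 3) gap q v p (velocity p) k t).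
  apply: measurable_sum => k; apply: measurable_sum => c.
  have [_ [mv _]] := wd k c.
  by apply: measurable_funD; apply: measurable_funX; apply: measurable_funB => //; exact: mc.
have N0 t : 0 <= \sum_(k < 3) gap q v p (velocity p) k t by rewrite sumr_ge0// => k _; exact: gap_ge0.
have mL : measurable_fun I (lagr eps m e q v) by exact: lagr_measurable.
have L0 t : 0 <= lagr eps m e q v t by exact: lagr_ge0.
have up : (\int[mu]_(t in I) (lagr eps m e p (velocity p) t)%:E <=
    \int[mu]_(t in I) (((1 + kap)%:E * (lagr eps m e q v t)%:E + (D / eps ^+ 2 * kap)%:E)
     + C%:E * (\sum_(k < 3) gap q v p (velocity p) k t)%:E))%E.
  apply: ge0_le_integral_any => t _; first by rewrite lee_fin lagr_ge0.
  rewrite -!EFinM -!EFinD lee_fin; exact: lagr_close.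
have kk : 0 <= 1 + kap by rewrite addr_ge0// ltW.
have Dk : 0 <= D / eps ^+ 2 * kap by rewrite mulr_ge0 ?(ltW k0)// divr_ge0 ?(ltW D0) ?(ltW e2).
have mI : measurable I by exact: measurable_itv.
rewrite ge0_integralD// in up; last 4 first.
- by move=> t _; rewrite -EFinM -EFinD lee_fin addr_ge0// mulr_ge0.
- apply: emeasurable_funD => //; apply: emeasurable_funM => //; exact/measurable_EFinP.
- by move=> t _; rewrite -EFinM lee_fin mulr_ge0 ?(ltW C0).
- by apply: emeasurable_funM => //; exact/measurable_EFinP.
rewrite ge0_integralD// in up; last 2 first.
- by move=> t _; rewrite -EFinM lee_fin mulr_ge0.
- by apply: emeasurable_funM => //; exact/measurable_EFinP.
rewrite integral_cst//= lebesgue_measure_itv/= lte_fin tau0 -EFinB subr0 in up.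
rewrite !ge0_integralZl_EFin// in up; try exact/measurable_EFinP; try exact: ltW.
rewrite integral_gap in up; last first.
  by move=> i c; split => //; [have [_ []] := wd i c|exact: mc|exact: mc].
have A1 := lagr_integral_le_action q v e0; rewrite AE in A1.
have fin : ((min_action m tau S12 S23 S31 - gam / 3)%:E <=
    (1 + kap)%:E * A%:E + (D / eps ^+ 2 * kap * tau)%:E + C%:E * (gam / 3 / C)%:E)%E.
  apply: le_trans (low p Op) _; apply: le_trans up _.
  apply: leeD; last by apply: lee_wpmul2l; rewrite ?lee_fin ?(ltW C0)//; exact: ltW dp.
  by apply: leeD => //; apply: lee_wpmul2l => //; rewrite lee_fin.
rewrite -!EFinM -!EFinD lee_fin in fin.
have CC : C * (gam / 3 / C) = gam / 3 by rewrite mulrC divfK// gt_eqF.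
have kB : kap * B = gam / 3 by rewrite divfK// gt_eqF.
rewrite CC in fin; move: kB; rewrite /B.
have -> : kap * (A + D / eps ^+ 2 * tau + 1) = kap * A + D / eps ^+ 2 * kap * tau + kap by ring.
move: fin; lra.
- by move=> t _; rewrite lee_fin.
- by move=> t _; rewrite lee_fin.
Qed.

End Bound.
End ActionGe.

(** * Uniform approximation of C^1 loops of the closure *)

Section SmoothLimits.
Variable R : realType.
Local Notation mu := (@lebesgue_measure R).
Implicit Types (m e : 'I_3 -> R) (q v p w : loop R) (t eps tau : R).

(** The same [t0] serves all periodic functions, so that a relation between several of them can be
    moved into the period. *)
Lemma period_reduce tau t : 0 < tau ->
  exists2 t0, 0 <= t0 <= tau & forall (T : Type) (g : R -> T), (forall u, g (u + tau) = g u) -> g t = g t0.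
Proof.
move=> tau0.
pose n := Num.floor (t / tau).
exists (t - n%:~R * tau).
  have := floor_itv (t / tau); rewrite -/n => /andP[h1 h2].
  rewrite ler_pdivlMr// in h1; rewrite ltr_pdivrMr// intrD mulrDl mul1r in h2.
  by apply/andP; split; lra.
move=> T g pg.
have pn (k : nat) u : g (u + k%:R * tau) = g u.
  elim: k u => [|k IH] u; first by rewrite mul0r addr0.
  by rewrite -natr1 mulrDl mul1r addrA pg IH.
case: n => k; first by rewrite -[RHS](pn k) pmulrn subrK.
by rewrite NegzE mulrNz mulNr opprK -pmulrn pn.
Qed.

Lemma sqint_le_dist2 tau q v p w i c :
  (sqint tau (fun t => q i c t - p i c t)%R + sqint tau (fun t => v i c t - w i c t)%R
   <= dist2 tau q v p w)%E.
Proof.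
have s0 (g : R -> R) : (0 <= sqint tau g)%E by apply: integral_ge0 => t _; rewrite lee_fin sqr_ge0.
rewrite /dist2 (bigD1 i)//= (bigD1 c)//=.
by apply: le_trans (leeDl _ _) (leeDl _ _); apply: sume_ge0 => k _;
  [exact: adde_ge0|apply: sume_ge0 => l _; exact: adde_ge0].
Qed.

(** Sobolev embedding in dimension one. Since 2 |d d'| <= d^2 + d'^2, both H - d^2 and H + d^2 are
    nondecreasing, so d(t)^2 exceeds any d(u)^2 by at most H tau - H 0; averaging over u produces
    the term 1/tau. *)
Lemma sup_le_H1 (d d' H : R -> R) tau : 0 < tau ->
  (forall t, 0 <= t <= tau -> is_derive t 1 d (d' t)) ->
  (forall t, 0 <= t <= tau -> is_derive t 1 H (d t ^+ 2 + d' t ^+ 2)) ->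
  forall t, 0 <= t <= tau -> d t ^+ 2 <= (1 + tau^-1) * (H tau - H 0).
Proof.
move=> tau0 Dd DH t /andP[t0 tt].
have Dm u : 0 <= u <= tau -> is_derive u 1 (fun s => H s - d s ^+ 2) ((d u - d' u) ^+ 2).
  move=> u01; have d1 := Dd u u01; have d2 := DH u u01.
  by apply: is_derive_eq; rewrite /GRing.scale /=; ring.
have Dp u : 0 <= u <= tau -> is_derive u 1 (fun s => H s + d s ^+ 2) ((d u + d' u) ^+ 2).
  move=> u01; have d1 := Dd u u01; have d2 := DH u u01.
  by apply: is_derive_eq; rewrite /GRing.scale /=; ring.
have mono (f f' : R -> R) (a b : R) : (forall u, 0 <= u <= tau -> is_derive u 1 f (f' u)) -> (forall u, 0 <= f' u) ->
    0 <= a -> a <= b -> b <= tau -> f a <= f b.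
  move=> Df f0 a0 ab bt; apply: (@is_derive_ge0_le _ f f' a b ab) => // u /andP[h1 h2].
  by apply: Df; rewrite (le_trans a0 h1) (le_trans h2 bt).
pose M := d t ^+ 2 - (H tau - H 0).
have Hm (a b : R) : 0 <= a -> a <= b -> b <= tau -> H a <= H b.
  by apply: (@mono H (fun u => d u ^+ 2 + d' u ^+ 2)) => // u; rewrite addr_ge0 ?sqr_ge0.
have low u : 0 <= u <= tau -> M <= d u ^+ 2.
  move=> /andP[u0 ut].
  have h1 : H 0 <= H (Num.min t u) by apply: Hm; rewrite ?le_min ?t0// ge_min tt.
  have h2 : H (Num.max t u) <= H tau by apply: Hm; rewrite ?ge_max ?tt// le_max t0.
  rewrite /M; have [tu|ut'] := leP t u.
    rewrite (min_idPl tu) in h1; rewrite (max_idPr tu) in h2.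
    by have := mono _ _ t u Dp (fun u => sqr_ge0 _) t0 tu ut; lra.
  rewrite (min_idPr (ltW ut')) in h1; rewrite (max_idPl (ltW ut')) in h2.
  by have := mono _ _ u t Dm (fun u => sqr_ge0 _) u0 (ltW ut') tt; lra.
have : H 0 - M * 0 <= H tau - M * tau.
  apply: (@is_derive_ge0_le _ (fun s => H s - M * s) (fun u => d u ^+ 2 + d' u ^+ 2 - M)); first exact: ltW.
    move=> u u01; have d2 := DH u u01.
    by apply: is_derive_eq; rewrite /GRing.scale /=; ring.
  move=> u /andP[h1 h2]; rewrite subr_ge0; apply: le_trans (low u _) _.
    by rewrite !ltW.
  by rewrite lerDl sqr_ge0.
rewrite mulr0 subr0 => h.
have : M <= (H tau - H 0) / tau by rewrite ler_pdivlMr//; lra.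
by rewrite /M => hM; rewrite mulrDl mul1r (mulrC tau^-1); lra.
Qed.

(** The weak derivative of a C^1 loop is almost everywhere the classical one, so [dist2] bounds the
    W^{1,2} norm of q - p, and thereby its supremum. *)
Lemma Xset_sup_close m tau k1 k2 k3 q v (h : R) : 0 < tau -> 0 < h -> C1_loop q ->
  Xset m tau k1 k2 k3 q v ->
  exists2 p, Omega m tau k1 k2 k3 p & forall i c t, 0 <= t <= tau -> (q i c t - p i c t) ^+ 2 < h.
Proof.
move=> tau0 h0 Cq [wd close].
have c0 : 0 < 1 + tau^-1 by rewrite addr_gt0// invr_gt0.
have [p [Op dp]] := close (h / (1 + tau^-1)) (divr_gt0 h0 c0).
exists p => // i c t t01; have Cp := Omega_C1 Op.
have := le_lt_trans (sqint_le_dist2 tau q v p (velocity p) i c) dp.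
pose d u := q i c u - p i c u; pose d' u := velocity q i c u - velocity p i c u.
have Dd (u : R) : is_derive u 1 d (d' u).
  by have [d1 _] := Cq i c; have [d2 _] := Cp i c; exact: is_deriveB.
have cd : continuous d by move=> u; exact: is_derive_continuous (Dd u).
have cd' : continuous d' by move=> u; apply: cvgB; [exact: (Cq i c).2|exact: (Cp i c).2].
have csq (g : R -> R) : continuous g -> continuous (fun u => g u ^+ 2).
  by move=> cg u; apply: cvgM; exact: cg.
have [H1 _ DH1] := antiderivative (csq _ cd).
have [H2 _ DH2] := antiderivative (csq _ cd').
have pos (u : R) : 0 <= u <= tau -> -1 < u by move=> /andP[u0 _]; exact: lt_le_trans (ltrN10 R) u0.
have E1 : sqint tau d = (H1 tau - H1 0)%:E.
  apply: (@integral_antiderivative R (fun u => d u ^+ 2)) => //; first exact: csq.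
  by move=> u /pos; exact: DH1.
have E2 : sqint tau (fun u => v i c u - velocity p i c u) = (H2 tau - H2 0)%:E.
  transitivity (sqint tau d').
    have mI (g : R -> R) : continuous g -> measurable_fun (`[0, tau] : set R) g.
      by move=> cg; apply: within_continuous_measurable; exact: continuous_subspaceT.
    have [_ [mv _]] := wd i c.
    apply: ae_eq_integral => //.
    - apply/measurable_EFinP; apply: measurable_funX; apply: measurable_funB => //.
      by apply: mI; exact: (Cp i c).2.
    - by apply/measurable_EFinP; apply: measurable_funX; exact: mI.
    - have ae := weak_deriv_ae tau0 wd (fun u => let: DeriveDef H _ := (Cq i c).1 u in H).
      have FF := ae_filter_ringOfSetsType mu.
      by apply: filterS ae => u Hu Iu; rewrite /d' (Hu Iu).
  apply: (@integral_antiderivative R (fun u => d' u ^+ 2)) => //; first exact: csq.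
  by move=> u /pos; exact: DH2.
rewrite E1 E2 -EFinD lte_fin => lt.
have DH (u : R) : 0 <= u <= tau -> is_derive u 1 (fun s => H1 s + H2 s) (d u ^+ 2 + d' u ^+ 2).
  by move=> /pos u0; have a1 := DH1 u u0; have a2 := DH2 u u0; exact: is_deriveD.
have := sup_le_H1 tau0 (fun u _ => Dd u) DH t01; move/le_lt_trans; apply.
rewrite -ltr_pdivlMl// mulrC; lra.
Qed.

End SmoothLimits.

(** * Minimizers *)

Section LimitLoops.
Variable R : realType.
Local Notation mu := (@lebesgue_measure R).
Implicit Types (m e : 'I_3 -> R) (q v p w : loop R) (t eps tau : R).

Lemma Xset_periodic m tau k1 k2 k3 q v i c : Xset m tau k1 k2 k3 q v ->
  forall t, q i c (t + tau) = q i c t.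
Proof. by move=> [wd _]; exact: (wd i c).1. Qed.

(** The constraint holds on the approximating loops, and (sum m_i a_i)^2 <= sum m_i a_i^2, for
    masses of sum 1, bounds the defect of the limit. *)
Lemma Xset_center m tau k1 k2 k3 q v c t : 0 < tau -> (forall i, 0 < m i) ->
  \sum_(i < 3) m i = 1 -> C1_loop q -> Xset m tau k1 k2 k3 q v ->
  \sum_(i < 3) m i * q i c t = 0.
Proof.
move=> tau0 m0 m1 Cq Xq.
have [t0 t01 red] := period_reduce t tau0.
rewrite (red _ (fun u => \sum_(i < 3) m i * q i c u)); last first.
  by move=> u; apply: eq_bigr => i _; rewrite (Xset_periodic _ _ Xq).
apply/eqP; rewrite -sqrf_eq0 eq_le sqr_ge0 andbT; apply/ler_addgt0Pr => h h0.
have [p Op cl] := Xset_sup_close tau0 h0 Cq Xq.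
rewrite add0r; apply: ltW.
have [_ [com _]] := Op.
have -> : \sum_(i < 3) m i * q i c t0 = \sum_(i < 3) m i * (q i c t0 - p i c t0).
  by under [RHS]eq_bigr do rewrite mulrBr; rewrite sumrB com subr0.
have := cl b1 c t0 t01; have := cl b2 c t0 t01; have := cl b3 c t0 t01.
rewrite !sum_bodies in m1 *; have := m0 b1; have := m0 b2; have := m0 b3.
move: (m b1) (m b2) (m b3) m1 (q b1 _ _ - _) (q b2 _ _ - _) (q b3 _ _ - _) => m1 m2 m3 E a b d.
move=> p3 p2 p1 hd hb ha.
apply: (@le_lt_trans _ _ (m1 * a ^+ 2 + m2 * b ^+ 2 + m3 * d ^+ 2)).
  rewrite -subr_ge0.
  have -> : m1 * a ^+ 2 + m2 * b ^+ 2 + m3 * d ^+ 2 - (m1 * a + m2 * b + m3 * d) ^+ 2 =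
    m1 * m2 * (a - b) ^+ 2 + m2 * m3 * (b - d) ^+ 2 + m3 * m1 * (d - a) ^+ 2.
    have -> : m3 = 1 - m1 - m2 by rewrite -E; ring.
    ring.
  by rewrite !addr_ge0// mulr_ge0 ?sqr_ge0// mulr_ge0// ltW.
rewrite -[h]mul1r -E !mulrDl !ltrD// ltr_pM2l//.
Qed.

Lemma center_velocity m q c t : C1_loop q -> (forall t, \sum_(i < 3) m i * q i c t = 0) ->
  \sum_(i < 3) m i * velocity q i c t = 0.
Proof.
move=> Cq com.
have d1 := (Cq b1 c).1 t; have d2 := (Cq b2 c).1 t; have d3 := (Cq b3 c).1 t.
apply: (@is_derive_oo_eq0 _ (fun s => \sum_(i < 3) m i * q i c s) (t - 1) (t + 1) t) => //.
  by apply/andP; split; lra.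
under eq_fun do rewrite sum_bodies.
by apply: is_derive_eq; rewrite /GRing.scale /= sum_bodies; ring.
Qed.

Lemma positive_min (f : R -> R) a b : a <= b -> continuous f -> (forall t, 0 < f t) ->
  exists2 mn, 0 < mn & forall t, a <= t <= b -> mn <= f t.
Proof.
move=> ab cf f0.
have [c cab cmin] := @EVT_min R f a b ab (continuous_subspaceT cf).
exists (f c) => // t tab; apply: cmin; by rewrite in_itv.
Qed.

Definition cyclic_pair (i j : 'I_3) := [|| (i == b1) && (j == b2), (i == b2) && (j == b3) | (i == b3) && (j == b1)].

Lemma cyclic_pair_neq i j : cyclic_pair i j -> i != j.
Proof. by move=> /or3P[] /andP[/eqP-> /eqP->]. Qed.

(** Without collisions the separations stay at a positive distance [mn] from 0, so a uniformly close
    loop of [Omega] has the same winding number. *)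
Lemma Xset_winding m tau (s : int) q v i j : 0 < tau -> s = 1 \/ s = -1 -> C1_loop q ->
  Xset m tau s s s q v -> (forall t, collision_free q t) -> cyclic_pair i j ->
  exists th : R -> R, [/\
    forall t, 0 <= t <= tau -> is_derive t 1 th
      ((sep q i j x0 t * sep (velocity q) i j x1 t - sep q i j x1 t * sep (velocity q) i j x0 t)
        / rho 0 (sep q i j x0) (sep q i j x1) t ^+ 2),
    forall t, 0 <= t <= tau ->
      sep q i j x0 t = rho 0 (sep q i j x0) (sep q i j x1) t * cos (th t) /\
      sep q i j x1 t = rho 0 (sep q i j x0) (sep q i j x1) t * sin (th t) &
    th tau - th 0 = 2 * pi * s%:~R].
Proof.
move=> tau0 s1 Cq Xq cf cyc; have ij := cyclic_pair_neq cyc.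
have r0 t := collision_free_rho (cf t) ij.
have Ds c t := sep_is_derive i j c t Cq.
have cs c := sep_continuous (i := i) (j := j) (c := c) Cq.
have [th Dth thE] := angle_lift tau0 (Ds x0) (Ds x1) (cs x0) (cs x1) r0.
exists th; split => //.
have [cr _] := rho_continuous (Ds x0) (Ds x1) r0.
have [mn mn0 mnP] := positive_min (ltW tau0) cr r0.
(* A separation involves two bodies, so each of its two coordinates then has a squared error below 2
   (1/8 + 1/8) mn^2 = mn^2 / 2. *)
have h0 : 0 < mn ^+ 2 / 8 by rewrite divr_gt0// exprn_gt0.
have [p Op cl] := Xset_sup_close tau0 h0 Cq Xq.
have [_ [_ [_ [W1 [W2 W3]]]]] := Op.
have [thp [cthp [thpE dthp]]] : winding tau (sep p i j x0) (sep p i j x1) s.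
  by move: cyc => /or3P[] /andP[/eqP-> /eqP->].
have per c : sep q i j c tau = sep q i j c 0.
  by rewrite /sep -{1 2}[tau]add0r !(Xset_periodic _ _ Xq).
apply: (@winding_close _ (sep q i j x0) (sep q i j x1) (sep p i j x0) (sep p i j x1) th thp
  (rho 0 (sep q i j x0) (sep q i j x1)) tau s tau0 s1 _ cthp) => //.
- exact: is_derive_continuous_within Dth.
- by move=> t t01; have [? ?] := thE t t01; split.
- move=> t t01.
  have d2 c : (sep p i j c t - sep q i j c t) ^+ 2 < mn ^+ 2 / 2.
    rewrite (_ : sep p i j c t - sep q i j c t = (q j c t - p j c t) - (q i c t - p i c t)); last by rewrite /sep; ring.
    apply: le_lt_trans (sqr_subr_le _ _) _.
    by have := cl i c t t01; have := cl j c t t01; lra.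
  have : mn ^+ 2 <= sep q i j x0 t ^+ 2 + sep q i j x1 t ^+ 2.
    have := sqr_rho 0 (sep q i j x0) (sep q i j x1) t; rewrite expr0n addr0 => <-.
    by rewrite ler_pXn2r// ?nnegrE ?(ltW mn0) ?(ltW (r0 t))// mnP.
  by have := d2 x0; have := d2 x1; lra.
Qed.

(** The weak derivative may be replaced by the velocity outside a null set, and the centre-of-mass
    term of the kinetic splitting vanishes. *)
Lemma action_C1 m e tau (s : int) q v : 0 < tau -> (forall i, 0 < m i) ->
  \sum_(i < 3) m i = 1 -> C1_loop q -> Xset m tau s s s q v -> (forall t, collision_free q t) ->
  action m e tau q v = (\int[mu]_(t in `[0%R, tau]) (lagr 0 m e q (velocity q) t)%:E)%E.
Proof.
move=> tau0 m0 m1 Cq Xq cf; have [wd _] := Xq.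
pose Us t := Uterm m e (at_time q t) b1 b2 + Uterm m e (at_time q t) b2 b3
    + Uterm m e (at_time q t) b3 b1.
have cU : continuous Us.
  have ct i j : i != j -> continuous (fun t => Uterm m e (at_time q t) i j).
    move=> ij t; rewrite /Uterm; apply: cvgM; first exact: cvg_cst.
    under eq_fun do rewrite distE.
    rewrite distE; apply: (rho_continuous _ _ _).2 => u; try exact: sep_is_derive.
    exact: collision_free_rho.
  by move=> t; apply: cvgD; [apply: cvgD|]; exact: ct.
have mI (g : R -> R) : continuous g -> measurable_fun (`[0, tau] : set R) g.
  by move=> cg; apply: within_continuous_measurable; exact: continuous_subspaceT.
have mkin w : (forall i c, measurable_fun (`[0, tau] : set R) (w i c)) ->
    measurable_fun (`[0, tau] : set R) (kinetic m w).
  move=> mw; apply: measurable_funM => //; apply: measurable_sum => i.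
  by apply: measurable_funM => //; apply: measurable_sum => c; exact: measurable_funX.
transitivity (\int[mu]_(t in `[0%R, tau]) (kinetic m v t + Us t)%:E)%E.
  by apply: eq_integral => t _; rewrite (U_collision_free _ _ (cf t)).
transitivity (\int[mu]_(t in `[0%R, tau]) (kinetic m (velocity q) t + Us t)%:E)%E; last first.
  apply: eq_integral => t _; rewrite -lagr0E//; first by rewrite (U_collision_free _ _ (cf t)).
  by move=> c; apply: center_velocity => // u; exact: Xset_center Xq.
apply: ae_eq_integral => //.
- apply/measurable_EFinP; apply: measurable_funD; last exact: mI.
  by apply: mkin => i c; have [_ []] := wd i c.
- apply/measurable_EFinP; apply: measurable_funD; last exact: mI.
  by apply: mkin => i c; apply: mI; exact: (Cq i c).2.
- have ae i c := weak_deriv_ae tau0 wd (fun u => let: DeriveDef H _ := (Cq i c).1 u in H).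
  have FF := ae_filter_ringOfSetsType mu.
  have B i : {ae mu, forall t, `[0, tau]%classic t ->
      v i x0 t = velocity q i x0 t /\ v i x1 t = velocity q i x1 t}.
    by apply: filterS2 (ae i x0) (ae i x1) => t h0 h1 It; rewrite (h0 It) (h1 It).
  apply: filterS3 (B b1) (B b2) (B b3) => t B1 B2 B3 It.
  have [h1 h2] := B1 It; have [h3 h4] := B2 It; have [h5 h6] := B3 It.
  congr EFin; congr (_ + _); rewrite /kinetic !sum_bodies !sum_coords.
  by rewrite h1 h2 h3 h4 h5 h6.
Qed.

End LimitLoops.

(** * Finite action excludes collisions of C^1 loops *)

Section NoCollision.
Variable R : realType.
Local Notation mu := (@lebesgue_measure R).
Implicit Types (m e : 'I_3 -> R) (q v p w : loop R) (t eps tau : R).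

Lemma continuous_itv_bound (f : R -> R) (a b : R) : a <= b -> continuous f ->
  exists2 C, 1 <= C & forall t, a <= t <= b -> `|f t| <= C.
Proof.
move=> ab cf.
have cn : {within `[a, b], continuous (fun t => `|f t|)}.
  by apply: continuous_subspaceT => t; apply: cvg_norm; exact: cf.
have [c cab cmax] := EVT_max ab cn.
exists (Num.max 1 `|f c|); first by rewrite le_max lexx.
by move=> t tab; rewrite le_max cmax ?orbT// in_itv.
Qed.

(* A Lipschitz curve gives 1/|u| >= 1/(C |t - t0|), which is not integrable. *)
Lemma collision_blowup (x y dx dy : R -> R) tau t0 (A : R) : 0 <= t0 < tau ->
  (forall t, is_derive t 1 x (dx t)) -> (forall t, is_derive t 1 y (dy t)) ->
  continuous dx -> continuous dy -> x t0 = 0 -> y t0 = 0 ->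
  exists2 eps, 0 < eps & forall sig : R -> R,
    (forall t, 0 <= t <= tau -> is_derive t 1 sig (rho eps x y t)^-1) -> A < sig tau - sig 0.
Proof.
move=> /andP[t00 t0t] Dx Dy cdx cdy xt yt.
have [C1 C11 C1P] := continuous_itv_bound (ltW t0t) cdx.
have [C2 C21 C2P] := continuous_itv_bound (ltW t0t) cdy.
pose C := C1 + C2; pose d := tau - t0.
have C0 : 0 < C by rewrite /C; lra.
have d0 : 0 < d by rewrite subr_gt0.
have lip (f df : R -> R) D s : (forall t, is_derive t 1 f (df t)) ->
    (forall t, t0 <= t <= tau -> `|df t| <= D) -> f t0 = 0 -> t0 <= s <= tau -> `|f s| <= D * (s - t0).
  move=> Df bd f0 /andP[s0 st].
  have bd' t : t0 < t < s -> - D <= df t <= D.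
    by move=> /andP[h1 h2]; rewrite -ler_norml bd// (ltW h1) (le_trans (ltW h2) st).
  have : D * t0 - f t0 <= D * s - f s.
    apply: (@is_derive_ge0_le _ (fun t => D * t - f t) (fun t => D - df t)) => //.
      by move=> t _; have d1 := Df t; apply: is_derive_eq; rewrite /GRing.scale /=; ring.
    by move=> t /bd' /andP[]; lra.
  have : D * t0 + f t0 <= D * s + f s.
    apply: (@is_derive_ge0_le _ (fun t => D * t + f t) (fun t => D + df t)) => //.
      by move=> t _; have d1 := Df t; apply: is_derive_eq; rewrite /GRing.scale /=; ring.
    by move=> t /bd' /andP[]; lra.
  by rewrite f0 ler_norml => h1 h2; apply/andP; split; lra.
pose k := 2 * C; have k0 : 0 < k by rewrite mulr_gt0.
have kd : 0 < k * d by rewrite mulr_gt0.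
(* The integral of 1/(k s + eps) over [0, d] is ln(1 + k d / eps) / k, which this value makes at
   least |A| + 1. *)
exists (k * d * expR (- (k * (`|A| + 1)))); first by rewrite mulr_gt0// expR_gt0.
set eps := k * d * _; have e0 : 0 < eps by rewrite mulr_gt0// expR_gt0.
move=> sig Dsig.
have r0 t : 0 < rho eps x y t by exact: rho_pos.
have rle t : t0 <= t <= tau -> rho eps x y t <= k * (t - t0) + eps.
  move=> tI; have /andP[tt0 _] := tI.
  have h1 := lip x dx C1 t Dx C1P xt tI; have h2 := lip y dy C2 t Dy C2P yt tI.
  have z0 : 0 <= t - t0 by rewrite subr_ge0.
  have P : 0 <= k * (t - t0) + eps by rewrite addr_ge0 ?(ltW e0)// mulr_ge0 ?(ltW k0).
  rewrite -(@ler_pXn2r _ 2)// ?nnegrE ?rho_ge0// sqr_rho.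
  rewrite -(real_normK (num_real (x t))) -(real_normK (num_real (y t))).
  have n1 : 0 <= `|x t| := normr_ge0 _; have n2 : 0 <= `|y t| := normr_ge0 _.
  have : `|x t| + `|y t| <= C * (t - t0) by rewrite /C mulrDl lerD.
  move: P; rewrite /k; set z := C * (t - t0) => P hz.
  rewrite -mulrA -/z in P *; nra.
have low : (ln (k * d + eps) - ln eps) / k <= sig tau - sig t0.
  pose F t := sig t - ln (k * (t - t0) + eps) / k.
  have : F t0 <= F tau.
    apply: (@is_derive_ge0_le _ F (fun t => (rho eps x y t)^-1 - (k * (t - t0) + eps)^-1)); first exact: ltW.
      move=> t /andP[h1 h2].
      have P : 0 < k * (t - t0) + eps by rewrite ltr_wpDl// mulr_ge0 ?(ltW k0)// subr_ge0.
      have D1 : is_derive t 1 (fun s => k * (s - t0) + eps) k.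
        by apply: is_derive_eq; rewrite /GRing.scale /=; ring.
      have D2 := is_derive_comp D1 (is_derive1_ln P).
      have D3 := Dsig t (introT andP (conj (le_trans t00 h1) h2)).
      rewrite /F; apply: is_derive_eq; rewrite /GRing.scale /=.
      by field; rewrite !gt_eqF.
    move=> t /andP[h1 h2]; rewrite subr_ge0.
    have P : 0 < k * (t - t0) + eps by rewrite ltr_wpDl// mulr_ge0 ?(ltW k0)// subr_ge0 ltW.
    by rewrite lef_pV2 ?posrE// rle// !ltW.
  rewrite /F subrr mulr0 add0r -/d mulrBl; lra.
have s00 : sig 0 <= sig t0.
  apply: (@is_derive_ge0_le _ sig (fun t => (rho eps x y t)^-1)) => //.
    by move=> t /andP[h1 h2]; apply: Dsig; rewrite h1 (le_trans h2 (ltW t0t)).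
  by move=> t _; rewrite invr_ge0 rho_ge0.
have lneps : ln eps = ln (k * d) - k * (`|A| + 1).
  by rewrite lnM ?posrE ?expR_gt0// expRK.
have lnle : ln (k * d) <= ln (k * d + eps).
  by rewrite ler_ln ?posrE ?addr_gt0// lerDl ltW.
have : (k * (`|A| + 1)) / k <= (ln (k * d + eps) - ln eps) / k.
  by rewrite ler_pM2r ?invr_gt0// lneps; lra.
rewrite mulrAC mulfV ?gt_eqF// mul1r.
have := ler_norm A; lra.
Qed.

(** The regularized actions stay below [action], while at a collision their potential part exceeds
    any bound for small eps. *)
Lemma no_collision m e tau (s : int) q v : 0 < tau -> (forall i, 0 < m i) ->
  \sum_(i < 3) m i = 1 ->
  0 < delta m e b1 b2 -> 0 < delta m e b2 b3 -> 0 < delta m e b3 b1 ->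
  C1_loop q -> Xset m tau s s s q v -> (action m e tau q v < +oo)%E ->
  forall t, collision_free q t.
Proof.
move=> tau0 m0 m1 d12 d23 d31 Cq Xq fin.
have dpos i j : cyclic_pair i j -> 0 < delta m e i j by move=> /or3P[] /andP[/eqP-> /eqP->].
have main i j t : cyclic_pair i j -> exists c, q i c t != q j c t.
  move=> cyc; have [//|nex] := pselect (exists c, q i c t != q j c t).
  exfalso.
  have zt c : sep q i j c t = 0.
    apply/eqP; rewrite subr_eq0; apply: contraT => H; exfalso; apply: nex; by exists c.
  have per c u : sep q i j c (u + tau) = sep q i j c u by rewrite /sep !(Xset_periodic _ _ Xq).
  have [t1 t1I red] := period_reduce t tau0.
  (* The divergence is found to the right of the collision, so a collision at time tau is moved to
     0. *)
  have [t0 t0I zt0] : exists2 t0, 0 <= t0 < tau & forall c, sep q i j c t0 = 0.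
    move: t1I => /andP[h1]; rewrite le_eqVlt => /predU1P[E|h2].
      exists 0; first by rewrite lexx.
      by move=> c; rewrite -per add0r -E -(red _ (sep q i j c) (per c)).
    exists t1; first by rewrite h1.
    by move=> c; rewrite -(red _ (sep q i j c) (per c)).
  have A0 : (0 <= action m e tau q v)%E.
    apply: le_trans (lagr_integral_le_action tau m0 m1 d12 d23 d31 q v ltr01).
    by apply: integral_ge0 => u _; rewrite lee_fin lagr_ge0.
  case AE : (action m e tau q v) A0 fin => [A| |] // A0 _.
  have k0 : 0 < m i * m j * delta m e i j by rewrite mulr_gt0 ?dpos// mulr_gt0.
  have Ds c u := sep_is_derive i j c u Cq.
  have cs c := sep_continuous (i := i) (j := j) (c := c) Cq.
  have [eps e0 big] := @collision_blowup (sep q i j x0) (sep q i j x1) _ _ tau t0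
    (A / (m i * m j * delta m e i j)) t0I (Ds x0) (Ds x1) (cs x0) (cs x1) (zt0 x0) (zt0 x1).
  have rp u : 0 < rho eps (sep q i j x0) (sep q i j x1) u by exact: rho_pos.
  have [K [sig [_ Dsig _ _]]] := pair_antiderivatives Cq rp.
  have Dsig' u : 0 <= u <= tau -> is_derive u 1 sig (rho eps (sep q i j x0) (sep q i j x1) u)^-1.
    by move=> /andP[u0 _]; exact: Dsig.
  have := big sig Dsig'; rewrite ltr_pdivrMr// ltNge => /negP; apply.
  have := lagr_integral_le_action tau m0 m1 d12 d23 d31 q v e0; rewrite AE.
  rewrite -lee_fin; apply: le_trans.
  pose M := m i * m j * delta m e i j.
  pose f u := M * (rho eps (sep q i j x0) (sep q i j x1) u)^-1.
  have cf : continuous f.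
    move=> u; apply: cvgM; first exact: cvg_cst.
    exact: (rho_continuous (Ds x0) (Ds x1) rp).2.
  have Df u : 0 <= u <= tau -> is_derive u 1 (fun u => M * sig u) (f u).
    by move=> /Dsig' d1; apply: is_derive_eq; rewrite /GRing.scale /=.
  have -> : (sig tau - sig 0) * (m i * m j * delta m e i j) = M * sig tau - M * sig 0.
    by rewrite -/M; ring.
  rewrite -(integral_antiderivative tau0 cf Df).
  apply: ge0_le_integral_any => u _.
    by rewrite lee_fin mulr_ge0 ?invr_ge0 ?rho_ge0// ltW.
  rewrite lee_fin /f /M.
  have P k l : 0 < delta m e k l -> 0 <= pair_lagr eps m e q v k l u.
    move=> dk; apply: mulr_ge0; first by rewrite mulr_ge0// ltW.
    apply: addr_ge0; apply: mulr_ge0; rewrite ?invr_ge0 ?rho_ge0 ?(ltW dk)//.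
    by rewrite addr_ge0 ?sqr_ge0.
  have Q : m i * m j * delta m e i j * (rho eps (sep q i j x0) (sep q i j x1) u)^-1
     <= pair_lagr eps m e q v i j u.
    rewrite /pair_lagr [leRHS]mulrDr -[leLHS]mulrA lerDr mulr_ge0//; first by rewrite mulr_ge0// ltW.
    by rewrite mulr_ge0 ?invr_ge0// addr_ge0 ?sqr_ge0.
  apply: le_trans Q _; rewrite /lagr.
  have := P b1 b2 d12; have := P b2 b3 d23; have := P b3 b1 d31.
  by move: cyc => /or3P[] /andP[/eqP-> /eqP->]; lra.
move=> t i j ij.
have [cyc|ncyc] := boolP (cyclic_pair i j); first exact: main.
have [cyc|ncyc'] := boolP (cyclic_pair j i).
  by have [c H] := main j i t cyc; exists c; rewrite eq_sym.
exfalso; move: ij ncyc ncyc'.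
by case: i => [[|[|[|]]]] // ?; case: j => [[|[|[|]]]].
Qed.

End NoCollision.

(** * Minimal action and the three Kepler problems *)

Section Minimizers.
Variable R : realType.
Local Notation mu := (@lebesgue_measure R).
Implicit Types (q v p w : loop R) (t eps : R).
Variables (m e : 'I_3 -> R) (tau : R) (s : int) (S12 S23 S31 : R).
Hypothesis m0 : forall i, 0 < m i.
Hypothesis m1 : \sum_(i < 3) m i = 1.
Hypothesis d12 : 0 < delta m e b1 b2.
Hypothesis d23 : 0 < delta m e b2 b3.
Hypothesis d31 : 0 < delta m e b3 b1.
Hypothesis tau0 : 0 < tau.
Hypothesis s1 : s = 1 \/ s = -1.
Hypothesis S12_gt0 : 0 < S12.
Hypothesis S23_gt0 : 0 < S23.
Hypothesis S31_gt0 : 0 < S31.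
Hypothesis S12E : delta m e b1 b2 * S12 ^+ 3 = 4 * pi ^+ 2 * tau.
Hypothesis S23E : delta m e b2 b3 * S23 ^+ 3 = 4 * pi ^+ 2 * tau.
Hypothesis S31E : delta m e b3 b1 * S31 ^+ 3 = 4 * pi ^+ 2 * tau.

Lemma derive1_periodic (f : R -> R) : (forall t, f (t + tau) = f t) ->
  forall t, derive1 f (t + tau) = derive1 f t.
Proof.
by move=> pf t; rewrite /derive1; under eq_fun do rewrite addrA !pf.
Qed.

Lemma velocity_periodic q i c : (forall t, q i c (t + tau) = q i c t) ->
  forall t, velocity q i c (t + tau) = velocity q i c t.
Proof. exact: derive1_periodic. Qed.

Lemma periodic_at_tau (f : R -> R) : (forall t, f (t + tau) = f t) -> f tau = f 0.
Proof. by move=> pf; rewrite -{1}[tau]add0r pf. Qed.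

Definition pair_kepler q (i j : 'I_3) t := forall c,
  sep (velocity (velocity q)) i j c t =
    - delta m e i j * sep q i j c t / rho 0 (sep q i j x0) (sep q i j x1) t ^+ 3.

Lemma Xset_gordon_loop q v i j K sig : C1_loop q -> Xset m tau s s s q v ->
  (forall t, collision_free q t) -> cyclic_pair i j -> pair_antiderivative 0 q i j K sig ->
  exists e1 e2 t2 a b : R, gordon_loop (sep q i j x0) (sep q i j x1)
    (sep (velocity q) i j x0) (sep (velocity q) i j x1) K sig tau 0 e1 e2 t2 a b.
Proof.
move=> Cq Xq cf cyc A; have ij := cyclic_pair_neq cyc.
apply: (winding_gordon_loop tau0 s1 Cq) => //.
- by move=> c t; rewrite (Xset_periodic _ _ Xq).
- by move=> c t; rewrite (Xset_periodic _ _ Xq).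
- by move=> t; exact: collision_free_rho.
have [th [Dth thE dth]] := Xset_winding tau0 s1 Cq Xq cf cyc.
exists th; split; first exact: is_derive_continuous_within Dth.
split => // t t01.
have -> : Num.sqrt (sep q i j x0 t ^+ 2 + sep q i j x1 t ^+ 2) = rho 0 (sep q i j x0) (sep q i j x1) t.
  by rewrite /rho expr0n addr0.
exact: thE.
Qed.

Section OneLoop.
Variables (q v : loop R).
Hypothesis Cq : C1_loop q.
Hypothesis Xq : Xset m tau s s s q v.
Hypothesis cf : forall t, collision_free q t.

Let per i c t : q i c (t + tau) = q i c t.
Proof. exact: (Xset_periodic i c Xq). Qed.

Let r0 i j : i != j -> forall t, 0 < rho 0 (sep q i j x0) (sep q i j x1) t.
Proof. by move=> ij t; exact: collision_free_rho. Qed.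

Lemma action_pairs K1 g1 K2 g2 K3 g3 :
  pair_antiderivative 0 q b1 b2 K1 g1 -> pair_antiderivative 0 q b2 b3 K2 g2 ->
  pair_antiderivative 0 q b3 b1 K3 g3 ->
  action m e tau q v = (m b1 * m b2 * (K1 tau + delta m e b1 b2 * g1 tau)
  + m b2 * m b3 * (K2 tau + delta m e b2 b3 * g2 tau)
  + m b3 * m b1 * (K3 tau + delta m e b3 b1 * g3 tau))%:E.
Proof.
move=> A1 A2 A3; rewrite (action_C1 e tau0 m0 m1 Cq Xq cf).
exact: integral_lagr tau0 Cq r0 A1 A2 A3.
Qed.

(** [gordon_regularized] includes eps = 0, where the tolerance can be sent to 0. *)
Lemma pair_action_ge i j K sig S0 : cyclic_pair i j -> 0 < S0 ->
  delta m e i j * S0 ^+ 3 = 4 * pi ^+ 2 * tau -> pair_antiderivative 0 q i j K sig ->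
  kepler_min tau S0 <= K tau + delta m e i j * sig tau.
Proof.
move=> cyc S00 SE A.
have [e1 [e2 [t2 [a [b G]]]]] := Xset_gordon_loop Cq Xq cf cyc A.
apply/ler_addgt0Pr => gam g0; rewrite -lerBlDr.
have [eps0 ep0 H] := gordon_regularized tau0 S00 SE g0.
have z : 0 <= (0 : R) <= eps0 by rewrite lexx ltW.
have := H 0 z _ _ _ _ _ _ _ _ _ _ _ G.
by have [_ _ -> _] := A; rewrite subr0.
Qed.

Lemma pair_kepler_action i j K sig S0 : cyclic_pair i j -> 0 < S0 -> 0 < delta m e i j ->
  delta m e i j * S0 ^+ 3 = 4 * pi ^+ 2 * tau -> pair_antiderivative 0 q i j K sig ->
  C1_loop (velocity q) -> (forall t, pair_kepler q i j t) ->
  2^-1 * (sep (velocity q) i j x0 0 ^+ 2 + sep (velocity q) i j x1 0 ^+ 2)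
    - delta m e i j / rho 0 (sep q i j x0) (sep q i j x1) 0 < 0 ->
  K tau + delta m e i j * sig tau = kepler_min tau S0.
Proof.
move=> cyc S00 d0 SE [DK Ds K0 sg0] Cv kep en; have ij := cyclic_pair_neq cyc.
have [th [Dth thE dth]] := Xset_winding tau0 s1 Cq Xq cf cyc.
have sper c : sep q i j c tau = sep q i j c 0.
  by apply: (periodic_at_tau (f := sep q i j c)) => t; rewrite /sep !per.
have vper c : sep (velocity q) i j c tau = sep (velocity q) i j c 0.
  apply: (periodic_at_tau (f := sep (velocity q) i j c)) => t.
  by rewrite /sep !velocity_periodic.
have Dacc c t : is_derive t 1 (sep (velocity q) i j c)
    (- delta m e i j * sep q i j c t / rho 0 (sep q i j x0) (sep q i j x1) t ^+ 3).
  by rewrite -kep; exact: sep_is_derive.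
have := @kepler_action R (sep q i j x0) (sep q i j x1) (sep (velocity q) i j x0)
  (sep (velocity q) i j x1) K sig th tau (delta m e i j) S0 s tau0
  (fun t => sep_is_derive i j x0 t Cq) (fun t => sep_is_derive i j x1 t Cq)
  (Dacc x0) (Dacc x1) (r0 ij) (sper x0) (sper x1) (vper x0) (vper x1) en Dth thE s1 dth.
rewrite /kepler_min K0 subr0; apply => //.
  by move=> t /andP[t0 _]; exact: DK.
by move=> t /andP[t0 _]; exact: Ds.
Qed.

Lemma pair_kepler_rigid i j K sig S0 : cyclic_pair i j -> 0 < S0 ->
  delta m e i j * S0 ^+ 3 = 4 * pi ^+ 2 * tau -> pair_antiderivative 0 q i j K sig ->
  C1_loop (velocity q) -> K tau + delta m e i j * sig tau <= kepler_min tau S0 ->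
  forall t, pair_kepler q i j t.
Proof.
move=> cyc S00 SE A Cv tight.
have [e1 [e2 [t2 [a [b G]]]]] := Xset_gordon_loop Cq Xq cf cyc A.
have tight' : K tau - K 0 + delta m e i j * sig tau <= 6 * pi ^+ 2 * tau / S0 ^+ 2.
  by have [_ _ -> _] := A; rewrite subr0.
have rig := gordon_rigidity G S00 SE tight'
  (fun t => sep_is_derive i j x0 t Cq) (fun t => sep_is_derive i j x1 t Cq)
  (fun t => sep_is_derive i j x0 t Cv) (fun t => sep_is_derive i j x1 t Cv)
  (sep_continuous Cv) (sep_continuous Cv).
move=> t c.
have [t0 t0I red] := period_reduce t tau0.
have vp k d u : velocity q k d (u + tau) = velocity q k d u by exact: velocity_periodic.
have ap k d u : velocity (velocity q) k d (u + tau) = velocity (velocity q) k d u.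
  exact: velocity_periodic.
have sp d u : sep q i j d (u + tau) = sep q i j d u by rewrite /sep !per.
rewrite (red _ (sep (velocity (velocity q)) i j c)); last by move=> u; rewrite /sep !ap.
rewrite (red _ (sep q i j c)) // (red _ (rho 0 (sep q i j x0) (sep q i j x1))); last first.
  by move=> u; rewrite /rho !sp.
have [h0 h1] := rig t0 t0I.
by case: c => [[|[|]]] // lt; [rewrite (_ : Ordinal lt = x0) //|rewrite (_ : Ordinal lt = x1) //]; apply/val_inj.
Qed.

(** Every pair is bounded below by its own minimum and the weights m_i m_j are positive, so equality
    of the sums makes the three bounds tight. *)
Lemma action_minimal_kepler : C1_loop (velocity q) ->
  action m e tau q v = (min_action m tau S12 S23 S31)%:E ->
  forall i j t, cyclic_pair i j -> pair_kepler q i j t.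
Proof.
move=> Cv AE.
have [K1 [g1 A1]] := pair_antiderivatives Cq (@r0 b1 b2 isT).
have [K2 [g2 A2]] := pair_antiderivatives Cq (@r0 b2 b3 isT).
have [K3 [g3 A3]] := pair_antiderivatives Cq (@r0 b3 b1 isT).
move: AE; rewrite (action_pairs A1 A2 A3) => -[]; rewrite /min_action => E.
have h1 := pair_action_ge (i := b1) (j := b2) isT S12_gt0 S12E A1.
have h2 := pair_action_ge (i := b2) (j := b3) isT S23_gt0 S23E A2.
have h3 := pair_action_ge (i := b3) (j := b1) isT S31_gt0 S31E A3.
have p12 : 0 < m b1 * m b2 by rewrite mulr_gt0.
have p23 : 0 < m b2 * m b3 by rewrite mulr_gt0.
have p31 : 0 < m b3 * m b1 by rewrite mulr_gt0.
have k1 := ler_wpM2l (ltW p12) h1.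
have k2 := ler_wpM2l (ltW p23) h2.
have k3 := ler_wpM2l (ltW p31) h3.
have t1 : K1 tau + delta m e b1 b2 * g1 tau <= kepler_min tau S12 by rewrite -(ler_pM2l p12); lra.
have t2 : K2 tau + delta m e b2 b3 * g2 tau <= kepler_min tau S23 by rewrite -(ler_pM2l p23); lra.
have t3 : K3 tau + delta m e b3 b1 * g3 tau <= kepler_min tau S31 by rewrite -(ler_pM2l p31); lra.
move=> i j t /or3P[] /andP[/eqP-> /eqP->].
- exact: (pair_kepler_rigid _ S12_gt0 S12E A1).
- exact: (pair_kepler_rigid _ S23_gt0 S23E A2).
- exact: (pair_kepler_rigid _ S31_gt0 S31E A3).
Qed.

Lemma kepler_action_minimal : C1_loop (velocity q) ->
  (forall i j t, cyclic_pair i j -> pair_kepler q i j t) ->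
  (forall i j, cyclic_pair i j ->
    2^-1 * (sep (velocity q) i j x0 0 ^+ 2 + sep (velocity q) i j x1 0 ^+ 2)
    - delta m e i j / rho 0 (sep q i j x0) (sep q i j x1) 0 < 0) ->
  action m e tau q v = (min_action m tau S12 S23 S31)%:E.
Proof.
move=> Cv kep en.
have [K1 [g1 A1]] := pair_antiderivatives Cq (@r0 b1 b2 isT).
have [K2 [g2 A2]] := pair_antiderivatives Cq (@r0 b2 b3 isT).
have [K3 [g3 A3]] := pair_antiderivatives Cq (@r0 b3 b1 isT).
rewrite (action_pairs A1 A2 A3) /min_action; congr EFin.
congr (_ * _ + _ * _ + _ * _).
- exact: (pair_kepler_action (i:=b1) (j:=b2) isT S12_gt0 d12 S12E A1 Cv (fun t => kep b1 b2 t isT) (en b1 b2 isT)).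
- exact: (pair_kepler_action (i:=b2) (j:=b3) isT S23_gt0 d23 S23E A2 Cv (fun t => kep b2 b3 t isT) (en b2 b3 isT)).
- exact: (pair_kepler_action (i:=b3) (j:=b1) isT S31_gt0 d31 S31E A3 Cv (fun t => kep b3 b1 t isT) (en b3 b1 isT)).
Qed.

End OneLoop.
End Minimizers.

(** * Elliptic triangles *)

Section EllipticTriangles.
Variable R : realType.
Implicit Types (q v p w : loop R) (t eps : R) (m e : 'I_3 -> R).

Lemma delta_sym m e i j : delta m e i j = delta m e j i.
Proof. by rewrite /delta (mulrC (e i)) (mulrC (m i)). Qed.

Lemma rho_sep_sym q i j t :
  rho 0 (sep q i j x0) (sep q i j x1) t = rho 0 (sep q j i x0) (sep q j i x1) t.
Proof. by rewrite /rho /sep -(sqrrN (q i x0 t - _)) -(sqrrN (q i x1 t - _)) !opprB. Qed.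

Lemma lin_indep (al be u1 u2 w1 w2 : R) : u1 * w2 - u2 * w1 != 0 ->
  al * u1 + be * w1 = 0 -> al * u2 + be * w2 = 0 -> al = 0 /\ be = 0.
Proof.
move=> nz h1 h2; split; apply: (mulIf nz); rewrite mul0r.
  rewrite (_ : al * _ = (al * u1 + be * w1) * w2 - (al * u2 + be * w2) * w1); last by ring.
  by rewrite h1 h2 !mul0r subrr.
rewrite (_ : be * _ = (al * u2 + be * w2) * u1 - (al * u1 + be * w1) * u2); last by ring.
by rewrite h1 h2 !mul0r subrr.
Qed.

(** In complex notation q_i = Y a_i with Y = r exp(i th), so q_i'' = - kap q_i with kap = mu/|Y|^3.
    Comparison with the equations of motion, where two sides of the triangle are linearly
    independent, yields delta_ij / r_ij^3 = kap. Hence every separation is a Kepler orbit, and its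
    energy is |a_i - a_j|^2 times that of Y. *)
Lemma elliptic_triangle_facts m e tau (s : int) q v : 0 < tau -> (forall i, 0 < m i) ->
  \sum_(i < 3) m i = 1 -> Xset m tau s s s q v -> elliptic_triangle m e tau q ->
  [/\ C1_loop q, C1_loop (velocity q), forall t, collision_free q t,
      forall i j t, cyclic_pair i j -> pair_kepler m e q i j t &
      forall i j, cyclic_pair i j ->
        2^-1 * (sep (velocity q) i j x0 0 ^+ 2 + sep (velocity q) i j x1 0 ^+ 2)
        - delta m e i j / rho 0 (sep q i j x0) (sep q i j x1) 0 < 0].
Proof.
move=> tau0 m0 m1 Xq [[dq [ncq ode]] [r [th [a [[_ [nca _]] [[mu [mu0 [Yd Yk]]] qE]]]]]].
pose Y (c : 'I_2) (t : R) := r t * (if c == x0 then cos (th t) else sin (th t)).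
have {}Yd c : _ /\ (forall t, derivable (Y c) t 1 /\ derivable (derive1 (Y c)) t 1) := Yd c.
have {}Yk t : 0 < Num.sqrt (Y x0 t ^+ 2 + Y x1 t ^+ 2) /\
  (forall c, derive1 (derive1 (Y c)) t = - mu * Y c t / Num.sqrt (Y x0 t ^+ 2 + Y x1 t ^+ 2) ^+ 3) /\
  2^-1 * (derive1 (Y x0) t ^+ 2 + derive1 (Y x1) t ^+ 2)
    - mu / Num.sqrt (Y x0 t ^+ 2 + Y x1 t ^+ 2) < 0 := Yk t.
have cf t : collision_free q t.
  by move=> i j; exact: ncq.
have Dq i c t : is_derive t 1 (q i c) (velocity q i c t).
  by rewrite /velocity derive1E; apply: derivableP; have [] := dq i c t.
have Dv i c t : is_derive t 1 (velocity q i c) (velocity (velocity q) i c t).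
  by rewrite [velocity (velocity q) i c t]derive1E; apply: derivableP; exact: (dq i c t).2.
have Cq : C1_loop q.
  by move=> i c; split => // t; exact: is_derive_continuous (Dv i c t).
have DY c t : is_derive t 1 (Y c) (derive1 (Y c) t).
  by rewrite derive1E; apply: derivableP; have [_ H] := Yd c; have [] := H t.
have DdY c t : is_derive t 1 (derive1 (Y c)) (derive1 (derive1 (Y c)) t).
  by rewrite [derive1 (derive1 (Y c)) t]derive1E; apply: derivableP; exact: ((Yd c).2 t).2.
have YK c t : derive1 (derive1 (Y c)) t = - mu * Y c t / rho 0 (Y x0) (Y x1) t ^+ 3.
  by have [_ [H _]] := Yk t; rewrite /rho expr0n addr0; exact: H.
have rY t : 0 < rho 0 (Y x0) (Y x1) t by have [H _] := Yk t; rewrite /rho expr0n addr0.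
have x10 : (x1 == x0) = false by [].
have q0E i : q i x0 = fun t => Y x0 t * a i x0 - Y x1 t * a i x1.
  by apply/funext => t; rewrite qE /Defs.rot /Y ?eqxx ?x10; ring.
have q1E i : q i x1 = fun t => Y x1 t * a i x0 + Y x0 t * a i x1.
  by apply/funext => t; rewrite qE /Defs.rot /Y ?eqxx ?x10; ring.
have v0E i t : velocity q i x0 t = derive1 (Y x0) t * a i x0 - derive1 (Y x1) t * a i x1.
  have [_ <-] := Dq i x0 t; rewrite q0E.
  have h0 := DY x0 t; have h1 := DY x1 t.
  have [_ ->] // : is_derive t 1 (fun t => Y x0 t * a i x0 - Y x1 t * a i x1)
    (derive1 (Y x0) t * a i x0 - derive1 (Y x1) t * a i x1).
  by apply: is_derive_eq; rewrite /GRing.scale /=; ring.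
have v1E i t : velocity q i x1 t = derive1 (Y x1) t * a i x0 + derive1 (Y x0) t * a i x1.
  have [_ <-] := Dq i x1 t; rewrite q1E.
  have h0 := DY x0 t; have h1 := DY x1 t.
  have [_ ->] // : is_derive t 1 (fun t => Y x1 t * a i x0 + Y x0 t * a i x1)
    (derive1 (Y x1) t * a i x0 + derive1 (Y x0) t * a i x1).
  by apply: is_derive_eq; rewrite /GRing.scale /=; ring.
pose kap t := mu / rho 0 (Y x0) (Y x1) t ^+ 3.
have acc i c t : velocity (velocity q) i c t = - kap t * q i c t.
  have [_ <-] := Dv i c t.
  have h0 := DdY x0 t; have h1 := DdY x1 t.
  have cE : c = x0 \/ c = x1 by case: c => [[|[|]]] // ?; [left|right]; apply/val_inj.
  case: cE => ->.
    rewrite (_ : velocity q i x0 = fun t => derive1 (Y x0) t * a i x0 - derive1 (Y x1) t * a i x1); last exact/funext.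
    have [_ ->] // : is_derive t 1 (fun t => derive1 (Y x0) t * a i x0 - derive1 (Y x1) t * a i x1)
      (- kap t * q i x0 t).
    by apply: is_derive_eq; rewrite /GRing.scale /= !YK q0E /kap; ring.
  rewrite (_ : velocity q i x1 = fun t => derive1 (Y x1) t * a i x0 + derive1 (Y x0) t * a i x1); last exact/funext.
  have [_ ->] // : is_derive t 1 (fun t => derive1 (Y x1) t * a i x0 + derive1 (Y x0) t * a i x1)
    (- kap t * q i x1 t).
  by apply: is_derive_eq; rewrite /GRing.scale /= !YK q1E /kap; ring.
have [crY _] := rho_continuous (DY x0) (DY x1) rY.
have Cv : C1_loop (velocity q).
  move=> i c; split => // t.
  rewrite (_ : velocity (velocity q) i c = fun t => - kap t * q i c t); last by apply/funext => u; rewrite acc.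
  apply: cvgM; last exact: is_derive_continuous (Dq i c t).
  apply: cvgN; apply: cvgM; first exact: cvg_cst.
  apply: cvgV; first by rewrite expf_neq0// gt_eqF.
  by apply: cvgM; [|apply: cvgM]; exact: crY.
have com c t : \sum_(i < 3) m i * q i c t = 0 by exact: Xset_center Xq.
have sepE i j t : sep q i j x0 t = Y x0 t * (a i x0 - a j x0) - Y x1 t * (a i x1 - a j x1) /\
   sep q i j x1 t = Y x1 t * (a i x0 - a j x0) + Y x0 t * (a i x1 - a j x1).
  by rewrite /sep !q0E !q1E; split; ring.
have nz t : m b1 != 0 /\ m b2 != 0 /\ m b3 != 0 by rewrite !gt_eqF.
have ratio i j t : cyclic_pair i j ->
    delta m e i j / rho 0 (sep q i j x0) (sep q i j x1) t ^+ 3 = kap t.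
  have cross : sep q b2 b1 x0 t * sep q b3 b1 x1 t - sep q b2 b1 x1 t * sep q b3 b1 x0 t != 0.
    have [-> ->] := sepE b2 b1 t; have [-> ->] := sepE b3 b1 t.
    rewrite (_ : _ - _ = rho 0 (Y x0) (Y x1) t ^+ 2 * ((a b2 x0 - a b1 x0) * (a b3 x1 - a b1 x1)
      - (a b2 x1 - a b1 x1) * (a b3 x0 - a b1 x0))); last by rewrite sqr_rho expr0n addr0; ring.
    by rewrite mulf_neq0// expf_neq0// gt_eqF.
  have ode' i' c t' : m i' * (- kap t' * q i' c t') = \sum_(j' < 3 | j' != i') m i' * m j' * delta m e i' j'
      * (q j' c t' - q i' c t') / dist (at_time q t') i' j' ^+ 3.
    by rewrite -acc; exact: ode.
  have m3E : m b3 = 1 - m b1 - m b2 by rewrite -m1 sum_bodies; ring.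
  (* The equation of body 1 in terms of the two sides issuing from it: for masses of sum 1 and
     centre 0, - q_1 is the mass-weighted sum of these sides. *)
  have E1 c : m b2 * (kap t - delta m e b1 b2 / rho 0 (sep q b1 b2 x0) (sep q b1 b2 x1) t ^+ 3) * sep q b2 b1 c t
     + m b3 * (kap t - delta m e b3 b1 / rho 0 (sep q b3 b1 x0) (sep q b3 b1 x1) t ^+ 3) * sep q b3 b1 c t = 0.
    have := ode' b1 c t.
    rewrite big_mkcond sum_bodies /= add0r !distE (delta_sym _ _ b1 b3) (rho_sep_sym q b1 b3).
    have := com c t; rewrite sum_bodies => com0 H.
    apply: (mulfI (lt0r_neq0 (m0 b1))).
    transitivity (m b1 * kap t * (m b1 * q b1 c t + m b2 * q b2 c t + m b3 * q b3 c t)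
       - (m b1 + m b2 + m b3) * (m b1 * kap t * q b1 c t)
       - (m b1 * m b2 * delta m e b1 b2 * (q b2 c t - q b1 c t) / rho 0 (sep q b1 b2 x0) (sep q b1 b2 x1) t ^+ 3
        + m b1 * m b3 * delta m e b3 b1 * (q b3 c t - q b1 c t) / rho 0 (sep q b3 b1 x0) (sep q b3 b1 x1) t ^+ 3)).
      by rewrite /sep; ring.
    by rewrite com0 -H m3E; ring.
  have E2 c : m b1 * (kap t - delta m e b1 b2 / rho 0 (sep q b1 b2 x0) (sep q b1 b2 x1) t ^+ 3) * (- sep q b2 b1 c t)
     + m b3 * (kap t - delta m e b2 b3 / rho 0 (sep q b2 b3 x0) (sep q b2 b3 x1) t ^+ 3) * (sep q b3 b1 c t - sep q b2 b1 c t) = 0.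
    have := ode' b2 c t.
    rewrite big_mkcond sum_bodies /= addr0 !distE (delta_sym _ _ b2 b1) (rho_sep_sym q b2 b1).
    have := com c t; rewrite sum_bodies => com0 H.
    apply: (mulfI (lt0r_neq0 (m0 b2))).
    transitivity (m b2 * kap t * (m b1 * q b1 c t + m b2 * q b2 c t + m b3 * q b3 c t)
       - (m b1 + m b2 + m b3) * (m b2 * kap t * q b2 c t)
       - (m b2 * m b1 * delta m e b1 b2 * (q b1 c t - q b2 c t) / rho 0 (sep q b1 b2 x0) (sep q b1 b2 x1) t ^+ 3
        + m b2 * m b3 * delta m e b2 b3 * (q b3 c t - q b2 c t) / rho 0 (sep q b2 b3 x0) (sep q b2 b3 x1) t ^+ 3)).
      by rewrite /sep; ring.
    by rewrite com0 -H m3E; ring.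
  have [/eqP A1 /eqP A2] := lin_indep cross (E1 x0) (E1 x1).
  have cross' : (- sep q b2 b1 x0 t) * (sep q b3 b1 x1 t - sep q b2 b1 x1 t)
     - (- sep q b2 b1 x1 t) * (sep q b3 b1 x0 t - sep q b2 b1 x0 t) != 0.
    by rewrite (_ : _ - _ = - (sep q b2 b1 x0 t * sep q b3 b1 x1 t - sep q b2 b1 x1 t * sep q b3 b1 x0 t)) ?oppr_eq0//; ring.
  have [_ /eqP A3] := lin_indep cross' (E2 x0) (E2 x1).
  move: A1 A2 A3; have [n1 [n2 n3]] := nz t.
  rewrite !mulf_eq0 (negPf n2) (negPf n3) /= !subr_eq0 => /eqP A1 /eqP A2 /eqP A3.
  by move=> /or3P[] /andP[/eqP-> /eqP->].
split => //.
  move=> i j t cyc c; rewrite {1}/sep !acc -mulrBr -/(sep q i j c t).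
  by rewrite -(ratio i j t cyc); ring.
move=> i j cyc; have ij := cyclic_pair_neq cyc.
have rp := collision_free_rho (cf 0) ij.
have Rt := ratio i j 0 cyc.
have dE : delta m e i j = kap 0 * rho 0 (sep q i j x0) (sep q i j x1) 0 ^+ 3.
  by rewrite -Rt divfK// expf_neq0// gt_eqF.
rewrite dE.
have -> : kap 0 * rho 0 (sep q i j x0) (sep q i j x1) 0 ^+ 3 / rho 0 (sep q i j x0) (sep q i j x1) 0
   = kap 0 * rho 0 (sep q i j x0) (sep q i j x1) 0 ^+ 2 by field; rewrite gt_eqF.
pose A := (a i x0 - a j x0) ^+ 2 + (a i x1 - a j x1) ^+ 2.
have rA : rho 0 (sep q i j x0) (sep q i j x1) 0 ^+ 2 = rho 0 (Y x0) (Y x1) 0 ^+ 2 * A.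
  by rewrite !sqr_rho !expr0n !addr0; have [-> ->] := sepE i j 0; rewrite /A; ring.
have A0 : 0 < A.
  have : 0 < rho 0 (Y x0) (Y x1) 0 ^+ 2 * A by rewrite -rA exprn_gt0.
  by rewrite pmulr_rgt0// exprn_gt0.
rewrite rA /sep !v0E !v1E.
rewrite (_ : _ - _ = A * (2^-1 * (derive1 (Y x0) 0 ^+ 2 + derive1 (Y x1) 0 ^+ 2) - mu / rho 0 (Y x0) (Y x1) 0)).
  rewrite pmulr_rlt0//; have [_ [_ H]] := Yk 0; by rewrite /rho expr0n addr0.
by rewrite /kap /A; field; rewrite gt_eqF.
Qed.

End EllipticTriangles.

(** * Uniformly rotating triangles *)

Section Circular.
Variable R : realType.
Implicit Types (q v p : loop R) (t : R) (m e : 'I_3 -> R) (a : config R).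

(** Bodies 1 and 2 are put on an axis and body 3 is found from the law of cosines; then the centre
    of mass is moved to 0. *)
Lemma triangle_exists m (l1 l2 l3 : R) : \sum_(i < 3) m i = 1 -> 0 < l1 -> 0 < l2 -> 0 < l3 ->
  l3 < l1 + l2 -> l1 < l2 + l3 -> l2 < l3 + l1 ->
  exists a, [/\ forall c, \sum_(i < 3) m i * a i c = 0, noncollinear a,
    (a b1 x0 - a b2 x0) ^+ 2 + (a b1 x1 - a b2 x1) ^+ 2 = l1 ^+ 2,
    (a b2 x0 - a b3 x0) ^+ 2 + (a b2 x1 - a b3 x1) ^+ 2 = l2 ^+ 2 &
    (a b3 x0 - a b1 x0) ^+ 2 + (a b3 x1 - a b1 x1) ^+ 2 = l3 ^+ 2].
Proof.
move=> m1 l10 l20 l30 t1 t2 t3.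
pose X := (l1 ^+ 2 + l3 ^+ 2 - l2 ^+ 2) / (2 * l1).
have n1 : l1 != 0 by rewrite gt_eqF.
(* Heron's formula: the triangle inequalities make the squared height positive. *)
have Y0 : 0 < l3 ^+ 2 - X ^+ 2.
  have -> : l3 ^+ 2 - X ^+ 2 =
      (l1 + l2 + l3) * (l1 + l3 - l2) * (l2 + l1 - l3) * (l2 + l3 - l1) / (4 * l1 ^+ 2).
    by rewrite /X; field.
  by rewrite divr_gt0 ?mulr_gt0 ?exprn_gt0//; lra.
pose Y := Num.sqrt (l3 ^+ 2 - X ^+ 2).
have YE : Y ^+ 2 = l3 ^+ 2 - X ^+ 2 by rewrite sqr_sqrtr// ltW.
have Yp : 0 < Y by rewrite sqrtr_gt0.
pose g (i : 'I_3) (c : 'I_2) : R :=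
  if i == b1 then 0 else if i == b2 then (if c == x0 then l1 else 0) else (if c == x0 then X else Y).
pose G c := m b2 * g b2 c + m b3 * g b3 c.
exists (fun i c => g i c - G c); split.
- move=> c; rewrite sum_bodies /G; have -> : g b1 c = 0 by [].
  move: m1; rewrite sum_bodies => m1.
  have -> : m b3 = 1 - m b1 - m b2 by rewrite -m1; ring.
  ring.
- rewrite /noncollinear /g /=.
  rewrite (_ : _ - _ = l1 * Y); last ring.
  by rewrite gt_eqF// mulr_gt0.
- by rewrite /g /=; ring.
- rewrite /g /= (_ : _ + _ = (l1 - X) ^+ 2 + Y ^+ 2); last ring.
  by rewrite YE /X; field.
- rewrite /g /= (_ : _ + _ = X ^+ 2 + Y ^+ 2); last ring.
  by rewrite YE; ring.
Qed.

Definition circular (w : R) a : loop R := fun i c t => Defs.rot (w * t) (a i) c.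

Lemma trig_is_derive (w A B t : R) :
  is_derive t 1 (fun t => A * cos (w * t) + B * sin (w * t))
    (w * B * cos (w * t) + - (w * A) * sin (w * t)).
Proof.
have D : is_derive t 1 (fun s => w * s) w.
  by apply: is_derive_eq; rewrite /GRing.scale /=; ring.
by apply: is_derive_eq; rewrite /GRing.scale /=; ring.
Qed.

Lemma trig_derive1 (w A B : R) : derive1 (fun t => A * cos (w * t) + B * sin (w * t)) =
  fun t => w * B * cos (w * t) + - (w * A) * sin (w * t).
Proof. by apply/funext => t; rewrite derive1E; have [_ ->] := trig_is_derive w A B t. Qed.

Lemma trig_smooth (w A B : R) : smooth (fun t => A * cos (w * t) + B * sin (w * t)).
Proof.
move=> n t.
have [A' [B' E]] : exists A' B', derive1n n (fun t => A * cos (w * t) + B * sin (w * t)) =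
    fun t => A' * cos (w * t) + B' * sin (w * t).
  elim: n => [|n [A' [B' IH]]]; first by exists A, B.
  by exists (w * B'), (- (w * A')); rewrite -trig_derive1 -IH.
by rewrite E; have [] := trig_is_derive w A' B' t.
Qed.

Variables (w : R) (a : config R).
Let q := circular w a.

Lemma circular0 i : q i x0 = fun t => a i x0 * cos (w * t) + - a i x1 * sin (w * t).
Proof. by apply/funext => t; rewrite /q /circular /Defs.rot eqxx; ring. Qed.

Lemma circular1 i : q i x1 = fun t => a i x1 * cos (w * t) + a i x0 * sin (w * t).
Proof. by apply/funext => t; rewrite /q /circular /Defs.rot /=; ring. Qed.

Lemma coordP (c : 'I_2) : c = x0 \/ c = x1.
Proof. by case: c => [[|[|]]] // ?; [left|right]; apply/val_inj. Qed.

Lemma circular_smooth i c : smooth (q i c).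
Proof. by case: (coordP c) => ->; rewrite ?circular0 ?circular1; exact: trig_smooth. Qed.

Lemma circular_acc i c t : derive1 (derive1 (q i c)) t = - w ^+ 2 * q i c t.
Proof.
by case: (coordP c) => ->; rewrite ?circular0 ?circular1 !trig_derive1; ring.
Qed.

Lemma circular_rho i j t :
  rho 0 (sep q i j x0) (sep q i j x1) t =
  Num.sqrt ((a i x0 - a j x0) ^+ 2 + (a i x1 - a j x1) ^+ 2).
Proof.
rewrite /rho /sep !circular0 !circular1 expr0n addr0; congr Num.sqrt.
apply: subr0_eq; transitivity (((a i x0 - a j x0) ^+ 2 + (a i x1 - a j x1) ^+ 2) *
  (cos (w * t) ^+ 2 + sin (w * t) ^+ 2 - 1)); first by ring.
by rewrite cos2Dsin2 subrr mulr0.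
Qed.

Lemma circular_com m c t : (forall c, \sum_(i < 3) m i * a i c = 0) ->
  \sum_(i < 3) m i * q i c t = 0.
Proof.
move=> com; have h0 := com x0; have h1 := com x1; move: h0 h1; rewrite !sum_bodies => h0 h1.
case: (coordP c) => ->; rewrite ?circular0 ?circular1.
  transitivity ((m b1 * a b1 x0 + m b2 * a b2 x0 + m b3 * a b3 x0) * cos (w * t)
     - (m b1 * a b1 x1 + m b2 * a b2 x1 + m b3 * a b3 x1) * sin (w * t)); first by ring.
  by rewrite h0 h1 !mul0r subrr.
transitivity ((m b1 * a b1 x1 + m b2 * a b2 x1 + m b3 * a b3 x1) * cos (w * t)
   + (m b1 * a b1 x0 + m b2 * a b2 x0 + m b3 * a b3 x0) * sin (w * t)); first by ring.
by rewrite h0 h1 !mul0r addr0.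
Qed.

Lemma circular_winding tau (s : int) i j : w * tau = 2 * pi * s%:~R ->
  0 < (a i x0 - a j x0) ^+ 2 + (a i x1 - a j x1) ^+ 2 ->
  winding tau (sep q i j x0) (sep q i j x1) s.
Proof.
move=> wt l0.
set L := Num.sqrt ((a i x0 - a j x0) ^+ 2 + (a i x1 - a j x1) ^+ 2).
have L0 : 0 < L by rewrite sqrtr_gt0.
have nL : L != 0 by rewrite gt_eqF.
have L2 : L ^+ 2 = (a i x0 - a j x0) ^+ 2 + (a i x1 - a j x1) ^+ 2 by rewrite sqr_sqrtr// ltW.
have [phi [pc ps]] : exists phi, (a i x0 - a j x0) / L = cos phi /\ (a i x1 - a j x1) / L = sin phi.
  by apply: unit_angle; rewrite !expr_div_n -mulrDl -L2 divff// expf_neq0.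
have e0 : a i x0 - a j x0 = L * cos phi by rewrite -pc mulrC divfK.
have e1 : a i x1 - a j x1 = L * sin phi by rewrite -ps mulrC divfK.
exists (fun t => w * t + phi); split.
  apply: (@is_derive_continuous_within _ _ (fun=> w)) => t _.
  by apply: is_derive_eq; rewrite /GRing.scale /=; ring.
split; last by rewrite -wt; ring.
move=> t _.
have -> : Num.sqrt (sep q i j x0 t ^+ 2 + sep q i j x1 t ^+ 2) = L.
  by rewrite /L -(circular_rho i j t) /rho expr0n addr0.
rewrite cosD sinD /sep !circular0 !circular1; split.
  transitivity ((a i x0 - a j x0) * cos (w * t) - (a i x1 - a j x1) * sin (w * t)); first by ring.
  by rewrite e0 e1; ring.
transitivity ((a i x1 - a j x1) * cos (w * t) + (a i x0 - a j x0) * sin (w * t)); first by ring.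
by rewrite e0 e1; ring.
Qed.

Lemma trig_periodic tau (s : int) t : s = 1 \/ s = -1 -> w * tau = 2 * pi * s%:~R ->
  cos (w * (t + tau)) = cos (w * t) /\ sin (w * (t + tau)) = sin (w * t).
Proof.
move=> s1 wt; rewrite mulrDr wt.
have -> : w * t + 2 * pi * s%:~R = w * t + pi * s%:~R + pi * s%:~R by ring.
have [c1 c2] := cosDpi_int (w * t + pi * s%:~R) s1; have [c3 c4] := cosDpi_int (w * t) s1.
by rewrite c1 c2 c3 c4 !opprK.
Qed.

Lemma circular_periodic tau (s : int) i c t : s = 1 \/ s = -1 -> w * tau = 2 * pi * s%:~R ->
  q i c (t + tau) = q i c t.
Proof.
move=> s1 wt; have [h1 h2] := trig_periodic t s1 wt.
by rewrite /q /circular /Defs.rot h1 h2.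
Qed.

End Circular.

(** * Smooth loops as elements of the completion *)

Section SmoothInX.
Variable R : realType.
Local Notation mu := (@lebesgue_measure R).

Lemma Omega_Xset m (tau : R) k1 k2 k3 q : 0 < tau -> Omega m tau k1 k2 k3 q ->
  Xset m tau k1 k2 k3 q (velocity q).
Proof.
move=> tau0 Oq; have Cq := Omega_C1 Oq; split.
  move=> i c; have [Dq cq] := Cq i c; split; first exact: (Oq.1 i c).2.
  split; first by apply: within_continuous_measurable; exact: continuous_subspaceT.
  have csq : continuous (fun t => velocity q i c t ^+ 2) by move=> t; apply: cvgM; exact: cq.
  split.
    have [H _ DH] := antiderivative csq.
    have DH' t : 0 <= t <= tau -> is_derive t 1 H (velocity q i c t ^+ 2).
      by move=> /andP[t0 _]; apply: DH; exact: lt_le_trans (ltrN10 R) t0.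
    by rewrite /sqint (integral_antiderivative tau0 csq DH') ltry.
  move=> t /andP[t0 tt]; move: t0; rewrite le_eqVlt => /predU1P[<-|t0].
    by rewrite set_itv1 integral_set1 adde0.
  rewrite (integral_antiderivative t0 cq (fun u _ => Dq u)) -EFinD.
  by congr EFin; ring.
move=> eps e0; exists q; split => //.
rewrite /dist2 big1 ?lte_fin// => i _; rewrite big1// => c _.
have z (f : R -> R) : sqint tau (fun t => f t - f t) = 0%E.
  by rewrite /sqint integral0_eq// => t _; rewrite subrr expr0n.
by rewrite !z adde0.
Qed.

End SmoothInX.

(** * Central triangles and the exclusion of collinear equilibria *)

Section Geometry.
Variable R : realType.
Implicit Types (q v p : loop R) (t : R) (m e : 'I_3 -> R) (a : config R).

(** Attractions linear in the displacement with a common constant [k] add up to an attraction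
    towards the centre of mass, here 0. *)
Lemma weighted_pull_sum m (i : 'I_3) (k : R) (x : 'I_3 -> R) (F : 'I_3 -> R) :
  \sum_(j < 3) m j = 1 -> \sum_(j < 3) m j * x j = 0 ->
  (forall j, j != i -> F j = m i * m j * k * (x j - x i)) ->
  \sum_(j < 3 | j != i) F j = - (m i * k * x i).
Proof.
move=> m1 com FE.
rewrite (eq_bigr _ FE) [LHS](_ : _ = \sum_(j < 3) m i * m j * k * (x j - x i)); last first.
  by rewrite [RHS](bigD1 i)//= subrr mulr0 add0r.
move: m1 com; rewrite !sum_bodies => m1 com.
transitivity (m i * k * (m b1 * x b1 + m b2 * x b2 + m b3 * x b3) - m i * k * x i * (m b1 + m b2 + m b3)); first by ring.
by rewrite com m1; ring.
Qed.

(** The relation delta_ij = w^2 l_ij^3 makes every attraction linear with constant w^2, which is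
    what uniform rotation of frequency [w] requires. The Kepler factor runs on the unit circle with
    mu = w^2. *)
Lemma circular_elliptic m e (tau : R) (s : int) (w : R) a : 0 < tau -> s = 1 \/ s = -1 ->
  \sum_(i < 3) m i = 1 -> w * tau = 2 * pi * s%:~R ->
  (forall c, \sum_(i < 3) m i * a i c = 0) -> noncollinear a ->
  (forall i j, i != j -> 0 < (a i x0 - a j x0) ^+ 2 + (a i x1 - a j x1) ^+ 2) ->
  (forall i j, i != j -> delta m e i j =
    w ^+ 2 * Num.sqrt ((a i x0 - a j x0) ^+ 2 + (a i x1 - a j x1) ^+ 2) ^+ 3) ->
  Omega m tau s s s (circular w a) /\ elliptic_triangle m e tau (circular w a).
Proof.
move=> tau0 s1 m1 wt com nc l0 dE; set q := circular w a.
have sm i c : smooth (q i c) by exact: circular_smooth.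
have cf t : collision_free q t.
  move=> i j ij; have := circular_rho w a i j t; have [//|nex] := pselect (exists c, q i c t != q j c t).
  have z c : sep q i j c t = 0.
    by apply/eqP; rewrite subr_eq0; apply: contraT => H; exfalso; apply: nex; exists c.
  rewrite /rho -/q !z expr0n !addr0 sqrtr0 => /esym/eqP; rewrite sqrtr_eq0 leNgt l0//.
have w0 : w != 0.
  apply/eqP => w0; have p0 := pi_gt0 R.
  by move: wt; rewrite w0 mul0r; case: s1 => ->; rewrite ?mulrNz ?mulr1z; lra.
have comq c t : \sum_(i < 3) m i * q i c t = 0 by exact: circular_com.
have lp i j : i != j -> 0 < Num.sqrt ((a i x0 - a j x0) ^+ 2 + (a i x1 - a j x1) ^+ 2).
  by move=> ij; rewrite sqrtr_gt0 l0.
split.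
  split; first by move=> i c; split => // t; apply: (circular_periodic _ _ _ _ s1 wt).
  split; first exact: comq.
  split; first by move=> i j t; exact: cf.
  by split; [|split]; apply: circular_winding => //; exact: l0.
split.
  split; first by move=> i c t; split; [exact: (sm i c 0%N)|exact: (sm i c 1%N)].
  split; first by move=> i j t; exact: cf.
  move=> i c t; rewrite -[derive1n 2 (q i c) t]/(derive1 (derive1 (q i c)) t) circular_acc -/q.
  rewrite (weighted_pull_sum (k := w ^+ 2) (x := fun j => q j c t) m1 (comq c t)); first by ring.
  move=> j ji; rewrite distE circular_rho (dE i j) 1?eq_sym//.
  have := lp i j; rewrite eq_sym => /(_ ji) l.
  by field; rewrite gt_eqF.
exists (fun=> 1), (fun t => w * t), a; split; last split.
- split.
    move=> i j ij; have [//|nex] := pselect (exists c, a i c != a j c).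
    have z c : a i c - a j c = 0.
      by apply/eqP; rewrite subr_eq0; apply: contraT => H; exfalso; apply: nex; exists c.
    by have := l0 i j ij; rewrite !z expr0n addr0 ltxx.
  split => //; exists (w ^+ 2) => i c; rewrite /dU.
  rewrite (weighted_pull_sum (k := w ^+ 2) (x := fun j => a j c) m1 (com c)); first by ring.
  move=> j ji; rewrite /dist (dE i j) 1?eq_sym//.
  have := lp i j; rewrite eq_sym => /(_ ji) l.
  by field; rewrite gt_eqF.
- pose Y (c : 'I_2) (t : R) := 1 * (if c == x0 then cos (w * t) else sin (w * t)).
  have Y0 : Y x0 = (fun t : R => 1 * cos (w * t) + 0 * sin (w * t)).
    by apply/funext => t; rewrite /Y eqxx mul0r addr0.
  have Y1 : Y x1 = (fun t : R => 0 * cos (w * t) + 1 * sin (w * t)).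
    by apply/funext => t; rewrite /Y mul0r add0r.
  have n1 t : Num.sqrt (Y x0 t ^+ 2 + Y x1 t ^+ 2) = 1.
    by rewrite Y0 Y1 !mul1r !mul0r addr0 add0r cos2Dsin2 sqrtr1.
  have sY c : smooth (Y c) by case: (coordP c) => ->; rewrite ?Y0 ?Y1; exact: trig_smooth.
  have YK c t : derive1 (derive1 (Y c)) t = - w ^+ 2 * Y c t.
    by case: (coordP c) => ->; rewrite ?Y0 ?Y1 !trig_derive1; ring.
  have w20 : 0 < w ^+ 2 by rewrite lt_neqAle sqr_ge0 andbT eq_sym sqrf_eq0.
  exists (w ^+ 2); split => //; split.
    move=> c; split.
      by move=> t; have [h1 h2] := trig_periodic t s1 wt; rewrite h1 h2.
    by move=> t; split; [exact: (sY c 0%N)|exact: (sY c 1%N)].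
  move=> t.
  suff : 0 < Num.sqrt (Y x0 t ^+ 2 + Y x1 t ^+ 2) /\
    (forall c, derive1 (derive1 (Y c)) t = - w ^+ 2 * Y c t / Num.sqrt (Y x0 t ^+ 2 + Y x1 t ^+ 2) ^+ 3) /\
    2^-1 * (derive1 (Y x0) t ^+ 2 + derive1 (Y x1) t ^+ 2)
    - w ^+ 2 / Num.sqrt (Y x0 t ^+ 2 + Y x1 t ^+ 2) < 0 by [].
  rewrite n1; split; first by [].
  split; first by move=> c; rewrite expr1n divr1 YK.
  rewrite Y0 Y1 !trig_derive1 divr1.
  rewrite (_ : _ - _ = 2^-1 * w ^+ 2 * (cos (w * t) ^+ 2 + sin (w * t) ^+ 2) - w ^+ 2); last by ring.
  by rewrite cos2Dsin2; lra.
- by move=> i c t; rewrite mul1r.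
Qed.

(** Hölder's inequality. The function d^3 / z^2 is convex and homogeneous of degree 1, so both terms
    lie above the tangent taken at the common ratio (d1 + d2)/(x + y). *)
Lemma holder3 (d1 d2 x y : R) : 0 < d1 -> 0 < d2 -> 0 < x -> 0 < y ->
  (d1 + d2) ^+ 3 / (x + y) ^+ 2 <= d1 ^+ 3 / x ^+ 2 + d2 ^+ 3 / y ^+ 2.
Proof.
move=> d10 d20 x0 y0; pose l := (d1 + d2) / (x + y).
have l0 : 0 < l by rewrite divr_gt0 ?addr_gt0.
have tang (d z : R) : 0 < d -> 0 < z -> 3 * d * l ^+ 2 - 2 * z * l ^+ 3 <= d ^+ 3 / z ^+ 2.
  move=> d0 z0; rewrite ler_pdivlMr ?exprn_gt0// -subr_ge0.
  rewrite (_ : _ - _ = (d - l * z) ^+ 2 * (d + 2 * l * z)); last by ring.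
  by rewrite mulr_ge0 ?sqr_ge0// addr_ge0 ?(ltW d0)// mulr_ge0 ?(ltW z0)// mulr_ge0 ?(ltW l0).
have -> : (d1 + d2) ^+ 3 / (x + y) ^+ 2 = 3 * (d1 + d2) * l ^+ 2 - 2 * (x + y) * l ^+ 3.
  by rewrite /l; field; rewrite gt_eqF// addr_gt0.
by have := tang d1 x d10 x0; have := tang d2 y d20 y0; lra.
Qed.

(** Three bodies on a line with sides in the ratio 1 : k : 1 + k; the signs of k and 1 + k tell
    which body is in the middle. In each case the equation equates the term of the longest side with
    the sum of the other two, and [holder3] contradicts one triangle inequality. *)
Lemma collinear_equilibrium_false (d1 d2 d3 k : R) : 0 < d1 -> 0 < d2 -> 0 < d3 ->
  d3 < d1 + d2 -> d1 < d2 + d3 -> d2 < d3 + d1 -> k != 0 -> 1 + k != 0 ->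
  d1 ^+ 3 + d2 ^+ 3 * k / `|k| ^+ 3 - d3 ^+ 3 * (1 + k) / `|1 + k| ^+ 3 = 0 -> False.
Proof.
move=> d10 d20 d30 t3 t1 t2 k0 k1.
have cube (x y z : R) : 0 < x -> 0 < y -> 0 < z -> (x + y) ^+ 3 <= z ^+ 3 -> x + y <= z.
  by move=> hx hy hz; have hxy := addr_gt0 hx hy; rewrite ler_pXn2r// nnegrE ltW.
have [kp|kn|/esym/eqP] := ltgtP 0 k; last by rewrite (negPf k0).
  have kp1 : 0 < 1 + k by rewrite addr_gt0.
  rewrite !gtr0_norm// => E.
  have := holder3 d10 d20 ltr01 kp; rewrite expr1n divr1.
  have -> : d1 ^+ 3 + d2 ^+ 3 / k ^+ 2 = d3 ^+ 3 / (1 + k) ^+ 2.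
    have -> : d2 ^+ 3 / k ^+ 2 = d2 ^+ 3 * k / k ^+ 3 by field; rewrite gt_eqF.
    have -> : d3 ^+ 3 / (1 + k) ^+ 2 = d3 ^+ 3 * (1 + k) / (1 + k) ^+ 3 by field; rewrite gt_eqF.
    lra.
  rewrite ler_pM2r ?invr_gt0 ?exprn_gt0// => /(cube _ _ _ d10 d20 d30); lra.
have [kp1|kn1|/esym/eqP] := ltgtP 0 (1 + k); last by rewrite (negPf k1).
  rewrite (ltr0_norm kn) (gtr0_norm kp1) => E.
  have nk : 0 < - k by rewrite oppr_gt0.
  have := holder3 d20 d30 nk kp1; rewrite (_ : - k + (1 + k) = 1); last by ring.
  rewrite expr1n divr1.
  have -> : d2 ^+ 3 / (- k) ^+ 2 + d3 ^+ 3 / (1 + k) ^+ 2 = d1 ^+ 3.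
    have -> : d2 ^+ 3 / (- k) ^+ 2 = - (d2 ^+ 3 * k / (- k) ^+ 3) by field; rewrite k0.
    have -> : d3 ^+ 3 / (1 + k) ^+ 2 = d3 ^+ 3 * (1 + k) / (1 + k) ^+ 3 by field; rewrite gt_eqF.
    lra.
  by move=> /(cube _ _ _ d20 d30 d10); lra.
rewrite (ltr0_norm kn) (ltr0_norm kn1) => E.
have nk1 : 0 < - (1 + k) by rewrite oppr_gt0.
have nk : 0 < - k by rewrite oppr_gt0.
have := holder3 d10 d30 ltr01 nk1; rewrite (_ : 1 + - (1 + k) = - k); last by ring.
rewrite expr1n divr1.
have -> : d1 ^+ 3 + d3 ^+ 3 / (- (1 + k)) ^+ 2 = d2 ^+ 3 / (- k) ^+ 2.
  have -> : d2 ^+ 3 / (- k) ^+ 2 = - (d2 ^+ 3 * k / (- k) ^+ 3) by field; rewrite k0.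
  have -> : d3 ^+ 3 / (- (1 + k)) ^+ 2 = - (d3 ^+ 3 * (1 + k) / (- (1 + k)) ^+ 3) by field; rewrite k1.
  lra.
by rewrite ler_pM2r ?invr_gt0 ?exprn_gt0// => /(cube _ _ _ d10 d30 d20); lra.
Qed.

End Geometry.

(** * Rigidity of minimizers *)

Section KeplerPairs.
Variable R : realType.
Implicit Types (t : R).
Variables (m e : 'I_3 -> R) (tau : R) (q : loop R) (d1 d2 d3 : R).
Hypothesis tau0 : 0 < tau.
Hypothesis m0 : forall i, 0 < m i.
Hypothesis m1 : \sum_(i < 3) m i = 1.
Hypothesis d10 : 0 < d1.
Hypothesis d20 : 0 < d2.
Hypothesis d30 : 0 < d3.
Hypothesis d1E : delta m e b1 b2 = d1 ^+ 3.
Hypothesis d2E : delta m e b2 b3 = d2 ^+ 3.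
Hypothesis d3E : delta m e b3 b1 = d3 ^+ 3.
Hypothesis t3 : d3 < d1 + d2.
Hypothesis t1 : d1 < d2 + d3.
Hypothesis t2 : d2 < d3 + d1.
Hypothesis Cq : C1_loop q.
Hypothesis Cv : C1_loop (velocity q).
Hypothesis cf : forall t, collision_free q t.
Hypothesis per : forall i c t, q i c (t + tau) = q i c t.
Hypothesis com : forall c t, \sum_(i < 3) m i * q i c t = 0.
Hypothesis kep : forall i j t, cyclic_pair i j -> pair_kepler m e q i j t.

Let u c t := sep q b1 b2 c t.
Let v c t := sep q b2 b3 c t.
Let r12 := rho 0 (sep q b1 b2 x0) (sep q b1 b2 x1).
Let r23 := rho 0 (sep q b2 b3 x0) (sep q b2 b3 x1).
Let r31 := rho 0 (sep q b3 b1 x0) (sep q b3 b1 x1).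

Let r12_gt0 t : 0 < r12 t. Proof. exact: collision_free_rho. Qed.
Let r23_gt0 t : 0 < r23 t. Proof. exact: collision_free_rho. Qed.
Let r31_gt0 t : 0 < r31 t. Proof. exact: collision_free_rho. Qed.

Let zE c t : sep q b3 b1 c t = - u c t - v c t.
Proof. by rewrite /u /v /sep; ring. Qed.

Let r12E t : r12 t ^+ 2 = u x0 t ^+ 2 + u x1 t ^+ 2.
Proof. by rewrite sqr_rho expr0n addr0. Qed.
Let r23E t : r23 t ^+ 2 = v x0 t ^+ 2 + v x1 t ^+ 2.
Proof. by rewrite sqr_rho expr0n addr0. Qed.
Let r31E t : r31 t ^+ 2 = (u x0 t + v x0 t) ^+ 2 + (u x1 t + v x1 t) ^+ 2.
Proof. by rewrite sqr_rho expr0n addr0 !zE; ring. Qed.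

(** The three separations sum to 0, hence so do their accelerations; the separation from body 3 to
    body 1 is written - u - v. *)
Lemma pair_forces c t :
  (d1 ^+ 3 / r12 t ^+ 3 - d3 ^+ 3 / r31 t ^+ 3) * u c t +
  (d2 ^+ 3 / r23 t ^+ 3 - d3 ^+ 3 / r31 t ^+ 3) * v c t = 0.
Proof.
have k1 := kep t (isT : cyclic_pair b1 b2) c.
have k2 := kep t (isT : cyclic_pair b2 b3) c.
have k3 := kep t (isT : cyclic_pair b3 b1) c.
rewrite d1E in k1; rewrite d2E in k2; rewrite d3E zE in k3.
have E : sep (velocity (velocity q)) b1 b2 c t + sep (velocity (velocity q)) b2 b3 c t
   + sep (velocity (velocity q)) b3 b1 c t = 0.
  by rewrite /sep; move: (velocity (velocity q)) => A; ring.
rewrite k1 k2 k3 in E; rewrite -[RHS]oppr0 -E /u /v /r12 /r23 /r31; ring.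
Qed.

Let cross t := u x0 t * v x1 t - u x1 t * v x0 t.

Lemma noncollinear_at t : cross t != 0.
Proof.
apply/eqP => cr0.
have rp := r12_gt0 t; have nr : r12 t != 0 by rewrite gt_eqF.
pose k := (u x0 t * v x0 t + u x1 t * v x1 t) / r12 t ^+ 2.
have vE c : v c t = k * u c t.
  apply: (mulIf (expf_neq0 2 nr)); rewrite /k mulrAC divfK ?expf_neq0// r12E.
  apply: subr0_eq; case: (coordP c) => ->.
    transitivity (- u x1 t * cross t); last by rewrite cr0 mulr0.
    by rewrite /cross; ring.
  transitivity (u x0 t * cross t); last by rewrite cr0 mulr0.
  by rewrite /cross; ring.
have R2 : r23 t = `|k| * r12 t.
  apply/eqP; rewrite -(@eqrXn2 _ 2) ?mulr_ge0 ?normr_ge0 ?ltW//; apply/eqP.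
  by rewrite r23E exprMn real_normK ?num_real// r12E !vE; ring.
have R3 : r31 t = `|1 + k| * r12 t.
  apply/eqP; rewrite -(@eqrXn2 _ 2) ?mulr_ge0 ?normr_ge0 ?ltW//; apply/eqP.
  by rewrite r31E exprMn real_normK ?num_real// r12E !vE; ring.
have k0 : k != 0 by apply/eqP => k0; have := r23_gt0 t; rewrite R2 k0 normr0 mul0r ltxx.
have k1 : 1 + k != 0 by apply/eqP => k1; have := r31_gt0 t; rewrite R3 k1 normr0 mul0r ltxx.
apply: (@collinear_equilibrium_false _ d1 d2 d3 k) => //.
have nk : `|k| != 0 by rewrite normr_eq0.
have nk1 : `|1 + k| != 0 by rewrite normr_eq0.
have F c : (d1 ^+ 3 + d2 ^+ 3 * k / `|k| ^+ 3 - d3 ^+ 3 * (1 + k) / `|1 + k| ^+ 3) * u c t = 0.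
  have := pair_forces c t; rewrite R2 R3 vE => /(congr1 (fun z => z * r12 t ^+ 3)).
  rewrite mul0r => <-.
  move: (r12 t) nr `|k| nk `|1 + k| nk1 (u c t) => r nr' a na b nb uc.
  by field; rewrite na nr' nb.
apply/eqP; apply: contraT => nz.
have uz c : u c t = 0 by apply: (mulfI nz); rewrite F mulr0.
have /eqP : r12 t ^+ 2 = 0 by rewrite r12E !uz expr0n addr0.
by rewrite sqrf_eq0 (negPf nr).
Qed.

Let kap t := d1 ^+ 3 / r12 t ^+ 3.

Lemma equal_ratios t : d2 ^+ 3 / r23 t ^+ 3 = kap t /\ d3 ^+ 3 / r31 t ^+ 3 = kap t.
Proof.
have [A B] := lin_indep (noncollinear_at t) (pair_forces x0 t) (pair_forces x1 t).
by split; rewrite /kap; lra.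
Qed.

Lemma distances_proportional t : r23 t = d2 / d1 * r12 t /\ r31 t = d3 / d1 * r12 t.
Proof.
have [E2 E3] := equal_ratios t; have n1 : d1 != 0 by rewrite gt_eqF.
have cube (d r : R) : 0 < d -> 0 < r -> d ^+ 3 / r ^+ 3 = kap t -> r = d / d1 * r12 t.
  move=> d0 r0 E; have nr : r != 0 by rewrite gt_eqF.
  have n12 : r12 t != 0 by rewrite gt_eqF.
  have rhs0 : 0 <= d / d1 * r12 t.
    by apply: mulr_ge0; [apply: divr_ge0; exact: ltW|exact: ltW].
  apply/eqP; rewrite -(@eqrXn2 _ 3) ?(ltW r0)//; apply/eqP.
  apply: (mulfI (expf_neq0 3 n1)).
  have -> : d1 ^+ 3 * r ^+ 3 = kap t * r12 t ^+ 3 * r ^+ 3 by rewrite /kap divfK ?expf_neq0.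
  by rewrite -E; field; rewrite n1 nr.
by split; [exact: cube E2|exact: cube E3].
Qed.

(** [al] and [be_] are the real and imaginary parts of the complex quotient v/u, which encodes the
    shape and orientation of the triangle. *)
Let al t := (u x0 t * v x0 t + u x1 t * v x1 t) / r12 t ^+ 2.
Let be_ t := cross t / r12 t ^+ 2.

(** The values of |v/u|^2 and |1 + v/u|^2, both fixed by the proportions of the sides. *)
Lemma shape_eqs t : al t ^+ 2 + be_ t ^+ 2 = (d2 / d1) ^+ 2 /\
  1 + 2 * al t + (al t ^+ 2 + be_ t ^+ 2) = (d3 / d1) ^+ 2.
Proof.
have [E2 E3] := distances_proportional t.
have n1 : r12 t != 0 by rewrite gt_eqF.
have nr : r12 t ^+ 2 != 0 by rewrite expf_neq0.
have A : al t ^+ 2 + be_ t ^+ 2 = r23 t ^+ 2 / r12 t ^+ 2.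
  transitivity ((u x0 t ^+ 2 + u x1 t ^+ 2) * (v x0 t ^+ 2 + v x1 t ^+ 2) / (r12 t ^+ 2) ^+ 2).
    by rewrite /al /be_ /cross !expr_div_n -mulrDl; congr (_ / _); ring.
  rewrite -r12E -r23E; move: (r12 t) (r23 t) n1 => r r' n1; by field.
have Q2 : r23 t ^+ 2 / r12 t ^+ 2 = (d2 / d1) ^+ 2 by rewrite E2 exprMn mulfK.
have Q3 : r31 t ^+ 2 / r12 t ^+ 2 = (d3 / d1) ^+ 2 by rewrite E3 exprMn mulfK.
split; first by rewrite A Q2.
rewrite A -Q3 /al; set N := u x0 t * _ + _.
transitivity ((r12 t ^+ 2 + 2 * N + r23 t ^+ 2) / r12 t ^+ 2).
  by clearbody N; move: (r12 t) (r23 t) n1 => r r' n1'; field.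
by congr (_ / _); rewrite /N r12E r23E r31E; ring.
Qed.

Lemma al_const t : al t = al 0.
Proof.
have [A B] := shape_eqs t; have [A0 B0] := shape_eqs 0.
by rewrite A in B; rewrite A0 in B0; lra.
Qed.

Let Du c t : is_derive t 1 (u c) (sep (velocity q) b1 b2 c t).
Proof. exact: sep_is_derive. Qed.
Let Dvv c t : is_derive t 1 (v c) (sep (velocity q) b2 b3 c t).
Proof. exact: sep_is_derive. Qed.

(** The sides determine its square. The sign cannot change either, since [be_] is continuous and a
    zero would be a collinear position. *)
Lemma be_const t : be_ t = be_ 0.
Proof.
have b20 : be_ t ^+ 2 = be_ 0 ^+ 2.
  by have [A B] := shape_eqs t; have [A0 B0] := shape_eqs 0; rewrite al_const in A; lra.
have nz s : be_ s != 0.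
  by rewrite mulf_neq0 ?noncollinear_at// invr_neq0// expf_neq0// gt_eqF.
have cb : continuous be_.
  have cu c : continuous (u c) by move=> s; exact: is_derive_continuous (Du c s).
  have cv c : continuous (v c) by move=> s; exact: is_derive_continuous (Dvv c s).
  have [cr _] := rho_continuous (Du x0) (Du x1) r12_gt0.
  move=> s; apply: cvgM.
    by apply: cvgB; apply: cvgM; (exact: cu || exact: cv).
  apply: cvgV; first by rewrite expf_neq0// gt_eqF.
  by apply: cvgM; exact: cr.
move/eqP: b20; rewrite eqf_sqr => /orP[/eqP //|/eqP E].
exfalso.
have [le|le] : 0 <= t \/ t <= 0 by apply/orP; exact: le_total.
  have [|c _ cE] := @IVT_itv _ be_ 0 t 0 le (continuous_subspaceT cb).
    by rewrite E; have [h|h] := leP 0 (be_ 0); [apply/orP; right|apply/orP; left]; apply/andP; split; lra.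
  by move: (nz c); rewrite cE eqxx.
have [|c _ cE] := @IVT_itv _ be_ t 0 0 le (continuous_subspaceT cb).
  by rewrite E; have [h|h] := leP 0 (be_ 0); [apply/orP; left|apply/orP; right]; apply/andP; split; lra.
by move: (nz c); rewrite cE eqxx.
Qed.

Let vE t : v x0 t = al 0 * u x0 t - be_ 0 * u x1 t /\ v x1 t = al 0 * u x1 t + be_ 0 * u x0 t.
Proof.
have nr : r12 t ^+ 2 != 0 by rewrite expf_neq0// gt_eqF.
rewrite -(al_const t) -(be_const t) /al /be_; set N := u x0 t * _ + _; split.
  transitivity ((N * u x0 t - cross t * u x1 t) / r12 t ^+ 2); last by ring.
  by apply: (mulIf nr); rewrite divfK// r12E /N /cross; ring.
transitivity ((N * u x1 t + cross t * u x0 t) / r12 t ^+ 2); last by ring.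
by apply: (mulIf nr); rewrite divfK// r12E /N /cross; ring.
Qed.

(** The complex quotient u(t)/u(0); it is the common factor r exp(i th) of all bodies. *)
Let Y (c : 'I_2) t : R := if c == x0 then (u x0 t * u x0 0 + u x1 t * u x1 0) / r12 0 ^+ 2
  else (u x0 0 * u x1 t - u x1 0 * u x0 t) / r12 0 ^+ 2.

Let n0 : r12 0 ^+ 2 != 0. Proof. by rewrite expf_neq0// gt_eqF. Qed.

Let uE t : u x0 t = Y x0 t * u x0 0 - Y x1 t * u x1 0 /\ u x1 t = Y x1 t * u x0 0 + Y x0 t * u x1 0.
Proof.
rewrite /Y /=; set N := u x0 t * _ + _; set C := u x0 0 * u x1 t - _; split.
  transitivity ((N * u x0 0 - C * u x1 0) / r12 0 ^+ 2); last by ring.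
  by apply: (mulIf n0); rewrite divfK// r12E /N /C; ring.
transitivity ((C * u x0 0 + N * u x1 0) / r12 0 ^+ 2); last by ring.
by apply: (mulIf n0); rewrite divfK// r12E /N /C; ring.
Qed.

Lemma sepYE i j t : cyclic_pair i j ->
  sep q i j x0 t = Y x0 t * sep q i j x0 0 - Y x1 t * sep q i j x1 0 /\
  sep q i j x1 t = Y x1 t * sep q i j x0 0 + Y x0 t * sep q i j x1 0.
Proof.
have [U0 U1] := uE t; have [V0 V1] := vE t; have [W0 W1] := vE 0.
have hv : v x0 t = Y x0 t * v x0 0 - Y x1 t * v x1 0 /\ v x1 t = Y x1 t * v x0 0 + Y x0 t * v x1 0.
  by rewrite V0 V1 W0 W1 U0 U1; split; ring.
move=> /or3P[] /andP[/eqP-> /eqP->]; [by []|exact: hv|].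
by rewrite !zE; have [-> ->] := hv; rewrite U0 U1; split; ring.
Qed.

Lemma bodyE i c t : q i c t = \sum_(j < 3) m j * sep q i j c t.
Proof.
move: (com c t) m1; rewrite !sum_bodies /sep => C M.
transitivity ((m b1 + m b2 + m b3) * q i c t - (m b1 * q b1 c t + m b2 * q b2 c t + m b3 * q b3 c t)).
  by rewrite C M; ring.
ring.
Qed.

Lemma qYE i t : q i x0 t = Y x0 t * q i x0 0 - Y x1 t * q i x1 0 /\
  q i x1 t = Y x1 t * q i x0 0 + Y x0 t * q i x1 0.
Proof.
have S j k : sep q j k x0 t = Y x0 t * sep q j k x0 0 - Y x1 t * sep q j k x1 0 /\
    sep q j k x1 t = Y x1 t * sep q j k x0 0 + Y x0 t * sep q j k x1 0.
  have [cyc|ncyc] := boolP (cyclic_pair j k); first exact: sepYE.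
  have [cyc|ncyc'] := boolP (cyclic_pair k j).
    have [A B] := sepYE t cyc.
    have sw c s : sep q j k c s = - sep q k j c s by rewrite /sep opprB.
    by rewrite !sw A B; split; ring.
  have -> : j = k.
    apply/eqP; move: ncyc ncyc'.
    by case: j => [[|[|[|]]]] // ?; case: k => [[|[|[|]]]].
  by rewrite /sep !subrr; split; ring.
rewrite !(bodyE i) !sum_bodies.
have [A1 B1] := S i b1; have [A2 B2] := S i b2; have [A3 B3] := S i b3.
by rewrite A1 B1 A2 B2 A3 B3; split; ring.
Qed.

Let rY := rho 0 (Y x0) (Y x1).

Lemma r12Y t : r12 t = rY t * r12 0.
Proof.
apply/eqP; rewrite -(@eqrXn2 _ 2) ?mulr_ge0 ?rho_ge0 ?ltW//; apply/eqP.
have HY : rY t ^+ 2 = Y x0 t ^+ 2 + Y x1 t ^+ 2 by rewrite sqr_rho expr0n addr0.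
rewrite exprMn HY !r12E; have [-> ->] := uE t; ring.
Qed.

Lemma rY_gt0 t : 0 < rY t.
Proof. by rewrite -(pmulr_lgt0 _ (r12_gt0 0)) -r12Y. Qed.

(** Since |u(t)| = |Y(t)| |u(0)|, dividing the Kepler equation of u by u(0) leaves one for Y with
    the constant delta_12 / |u(0)|^3. *)
Let mu := kap 0.

Lemma mu_gt0 : 0 < mu. Proof. by rewrite /mu /kap divr_gt0 ?exprn_gt0. Qed.

Let dY (c : 'I_2) t : R := let du c := sep (velocity q) b1 b2 c t in
  if c == x0 then (du x0 * u x0 0 + du x1 * u x1 0) / r12 0 ^+ 2
  else (u x0 0 * du x1 - u x1 0 * du x0) / r12 0 ^+ 2.

Lemma Y_derive c t : is_derive t 1 (Y c) (dY c t).
Proof.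
have h0 := Du x0 t; have h1 := Du x1 t.
case: (coordP c) => ->; rewrite /Y /dY /=.
  by apply: is_derive_eq; rewrite /GRing.scale /=; ring.
by apply: is_derive_eq; rewrite /GRing.scale /=; ring.
Qed.

Lemma dY_derive c t : is_derive t 1 (dY c) (- mu * Y c t / rY t ^+ 3).
Proof.
have D k : is_derive t 1 (sep (velocity q) b1 b2 k) (- d1 ^+ 3 * u k t / r12 t ^+ 3).
  by rewrite -d1E -(kep t (isT : cyclic_pair b1 b2) k); exact: sep_is_derive.
have h0 := D x0; have h1 := D x1.
have nY : rY t != 0 by rewrite gt_eqF// rY_gt0.
have n1 : r12 0 != 0 by rewrite gt_eqF.
rewrite r12Y in h0 h1.
case: (coordP c) => ->; rewrite /Y /dY /=.
  apply: is_derive_eq; rewrite /GRing.scale /= /mu /kap.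
  move: (rY t) nY (r12 0) n1 => r nr s ns.
  by field; rewrite nr ns.
apply: is_derive_eq; rewrite /GRing.scale /= /mu /kap.
move: (rY t) nY (r12 0) n1 => r nr s ns.
by field; rewrite nr ns.
Qed.

Lemma derive1_Y c : derive1 (Y c) = dY c.
Proof. by apply/funext => t; rewrite derive1E; have [_ ->] := Y_derive c t. Qed.

Lemma derive1_dY c : derive1 (dY c) = fun t => - mu * Y c t / rY t ^+ 3.
Proof. by apply/funext => t; rewrite derive1E; have [_ ->] := dY_derive c t. Qed.

Lemma Y_periodic c t : Y c (t + tau) = Y c t.
Proof. by rewrite /Y /u /sep !per. Qed.

Lemma dY_periodic c t : dY c (t + tau) = dY c t.
Proof. by rewrite -derive1_Y; apply: derive1_periodic; exact: Y_periodic. Qed.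

(* Lagrange-Jacobi: (Y . Y')' = 2 h + mu / |Y|, so h >= 0 would make the
   periodic function Y . Y' strictly increasing. *)
Lemma Y_energy t : 2^-1 * (dY x0 t ^+ 2 + dY x1 t ^+ 2) - mu / rY t < 0.
Proof.
have nY s : rY s != 0 by rewrite gt_eqF// rY_gt0.
have HrY s : Y x0 s ^+ 2 + Y x1 s ^+ 2 = rY s ^+ 2 by rewrite sqr_rho expr0n addr0.
pose h s := 2^-1 * (dY x0 s ^+ 2 + dY x1 s ^+ 2) - mu * (rY s)^-1.
have hc s : h s = h t.
  apply: is_derive_0_is_cst => r.
  have y0 := Y_derive x0 r; have y1 := Y_derive x1 r.
  have z0 := dY_derive x0 r; have z1 := dY_derive x1 r.
  have DV := is_deriveV (nY r) (is_derive_rho (rY_gt0 r) y0 y1).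
  rewrite /h; apply: is_derive_eq; rewrite /GRing.scale /= -/rY.
  by move: (rY r) (nY r) => k nk; field.
rewrite -/(h t) ltNge; apply/negP => h0.
pose V s := Y x0 s * dY x0 s + Y x1 s * dY x1 s.
have : V 0 < V tau.
  apply: (@is_derive_gt0_lt _ V (fun s => 2 * h s + mu / rY s)) => // [s _|s _]; last first.
    apply: ltr_wpDl; first by rewrite (hc s); apply: mulr_ge0.
    exact: divr_gt0 mu_gt0 (rY_gt0 s).
  have y0 := Y_derive x0 s; have y1 := Y_derive x1 s.
  have z0 := dY_derive x0 s; have z1 := dY_derive x1 s.
  rewrite /V /h; apply: is_derive_eq; rewrite /GRing.scale /=.
  apply: subr0_eq; transitivity (- mu * (Y x0 s ^+ 2 + Y x1 s ^+ 2 - rY s ^+ 2) / rY s ^+ 3).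
    by move: (rY s) (nY s) => k nk; field.
  by rewrite HrY subrr mulr0 mul0r.
by rewrite /V -[tau]add0r !Y_periodic !dY_periodic ltxx.
Qed.

Let kapE i j t : i != j -> delta m e i j = kap t * rho 0 (sep q i j x0) (sep q i j x1) t ^+ 3.
Proof.
have [E2 E3] := equal_ratios t.
have main k l : cyclic_pair k l -> delta m e k l = kap t * rho 0 (sep q k l x0) (sep q k l x1) t ^+ 3.
  have n (r : R) : 0 < r -> r ^+ 3 != 0 by move=> r0; rewrite expf_neq0// gt_eqF.
  move=> /or3P[] /andP[/eqP-> /eqP->].
  - by rewrite d1E /kap divfK// n.
  - by rewrite d2E -E2 divfK// n.
  - by rewrite d3E -E3 divfK// n.
move=> ij; have [cyc|ncyc] := boolP (cyclic_pair i j); first exact: main.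
have [cyc|ncyc'] := boolP (cyclic_pair j i).
  by rewrite delta_sym rho_sep_sym main.
exfalso; move: ij ncyc ncyc'.
by case: i => [[|[|[|]]]] // ?; case: j => [[|[|[|]]]].
Qed.

Lemma pull (i : 'I_3) c t : \sum_(j < 3 | j != i) m i * m j * delta m e i j *
    (q j c t - q i c t) / dist (at_time q t) i j ^+ 3 = - (m i * kap t * q i c t).
Proof.
rewrite (weighted_pull_sum (k := kap t) (x := fun j => q j c t) m1 (com c t))//.
move=> j ji; rewrite distE (kapE t (i := i) (j := j)) 1?eq_sym//.
have : 0 < rho 0 (sep q i j x0) (sep q i j x1) t by apply: collision_free_rho; rewrite 1?eq_sym.
by move: (rho 0 _ _ t) (kap t) => r k r0; field; rewrite gt_eqF.
Qed.

Lemma acceleration i c t : velocity (velocity q) i c t = - kap t * q i c t.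
Proof.
have main g h : cyclic_pair g h -> sep (velocity (velocity q)) g h c t = - kap t * sep q g h c t.
  move=> cyc; rewrite (kep t cyc c) (kapE t (cyclic_pair_neq cyc)).
  have := collision_free_rho (cf t) (cyclic_pair_neq cyc).
  move: (rho 0 _ _ t) (sep q g h c t) (kap t) => r x k r0.
  by field; rewrite gt_eqF.
have S j k : sep (velocity (velocity q)) j k c t = - kap t * sep q j k c t.
  have [cyc|ncyc] := boolP (cyclic_pair j k); first exact: main.
  have [cyc|ncyc'] := boolP (cyclic_pair k j).
    have sw (f : loop R) : sep f j k c t = - sep f k j c t by rewrite /sep opprB.
    by rewrite !sw main// mulrN.
  have -> : j = k.
    apply/eqP; move: ncyc ncyc'.
    by case: j => [[|[|[|]]]] // ?; case: k => [[|[|[|]]]].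
  by rewrite /sep !subrr mulr0.
have coma : \sum_(k < 3) m k * velocity (velocity q) k c t = 0.
  by apply: center_velocity => // u0; exact: center_velocity.
move: (com c t) coma m1 (S i b1) (S i b2) (S i b3); rewrite !sum_bodies /sep.
move: (velocity (velocity q)) => A C CA M S1 S2 S3.
transitivity (m b1 * (A i c t - A b1 c t) + m b2 * (A i c t - A b2 c t) + m b3 * (A i c t - A b3 c t)).
  transitivity ((m b1 + m b2 + m b3) * A i c t - (m b1 * A b1 c t + m b2 * A b2 c t + m b3 * A b3 c t)).
    by rewrite CA M; ring.
  by ring.
rewrite S1 S2 S3.
transitivity (- kap t * ((m b1 + m b2 + m b3) * q i c t - (m b1 * q b1 c t + m b2 * q b2 c t + m b3 * q b3 c t))).
  by move: (kap t) => k; ring.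
by rewrite C M mul1r subr0.
Qed.

Lemma kepler_pairs_elliptic : elliptic_triangle m e tau q.
Proof.
split.
  split.
    by move=> i c t; split; [case: ((Cq i c).1 t)|case: ((Cv i c).1 t)].
  split; first by move=> i j t; exact: cf.
  move=> i c t; rewrite pull -[derive1n 2 (q i c) t]/(velocity (velocity q) i c t) acceleration.
  by rewrite mulNr mulrN mulrA.
(* The angle is picked pointwise: regularity is asked only of r exp(i th), which is [Y]. *)
have ang t : exists phi, Y x0 t / rY t = cos phi /\ Y x1 t / rY t = sin phi.
  apply: unit_angle; rewrite (expr_div_n (Y x0 t)) (expr_div_n (Y x1 t)) -mulrDl.
  have <- : rY t ^+ 2 = Y x0 t ^+ 2 + Y x1 t ^+ 2 by rewrite sqr_rho expr0n addr0.
  by rewrite divff// expf_neq0// gt_eqF// rY_gt0.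
have [th thE] := choice ang.
have nY t : rY t != 0 by rewrite gt_eqF// rY_gt0.
have Yc t : Y x0 t = rY t * cos (th t) by have [<- _] := thE t; rewrite mulrC divfK.
have Ys t : Y x1 t = rY t * sin (th t) by have [_ <-] := thE t; rewrite mulrC divfK.
(* The position at time 0 is the central configuration, with multiplier kap 0. *)
exists rY, th, (at_time q 0); split; last split.
- split; first exact: cf.
  split.
    rewrite /noncollinear /at_time (_ : _ - _ = cross 0) ?noncollinear_at//.
    by rewrite /cross /u /v /sep; ring.
  exists (kap 0) => i c; rewrite /dU.
  transitivity (kap 0 * m i * q i c 0 + \sum_(j < 3 | j != i) m i * m j * delta m e i j *
    (q j c 0 - q i c 0) / dist (at_time q 0) i j ^+ 3).
    congr (_ + _); apply: eq_bigr => j _; rewrite /at_time.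
    by rewrite -[q j c 0 - _]opprB mulrN mulNr.
  by rewrite pull; ring.
- have -> : (fun (c : 'I_2) t => rY t * (if c == x0 then cos (th t) else sin (th t))) = Y.
    apply/funext => c; apply/funext => t.
    by case: (coordP c) => ->; rewrite ?Yc ?Ys.
  exists mu; split; first exact: mu_gt0.
  have rE t : Num.sqrt (Y x0 t ^+ 2 + Y x1 t ^+ 2) = rY t by rewrite /rY /rho expr0n addr0.
  split.
    move=> c; split; first by move=> t; exact: Y_periodic.
    move=> t; split; first by case: (Y_derive c t).
    by rewrite derive1_Y; case: (dY_derive c t).
  move=> t; rewrite rE; split; first exact: rY_gt0.
  split; last by rewrite !derive1_Y; exact: Y_energy.
  by move=> c; rewrite -[derive1n 2 (Y c) t]/(derive1 (derive1 (Y c)) t) derive1_Y derive1_dY.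
- move=> i c t; have [A0 A1] := qYE i t.
  case: (coordP c) => ->; rewrite ?A0 ?A1 /Defs.rot /at_time Yc Ys /=; ring.
Qed.

End KeplerPairs.

(** * The value of the minimum, its attainment, and the conclusion *)

Section Main.
Variable R : realType.
Implicit Types (m e : 'I_3 -> R) (q v : loop R).

Lemma cube_root (x : R) : 0 < x -> 0 < x `^ 3^-1 /\ (x `^ 3^-1) ^+ 3 = x.
Proof.
move=> x0; split; first exact: powR_gt0.
by rewrite -powR_mulrn ?powR_ge0// -powRrM mulVf ?pnatr_eq0// powRr1// ltW.
Qed.

Lemma powR_two_thirds (x : R) : x `^ (2 / 3) = (x `^ 3^-1) ^+ 2.
Proof. by rewrite -powR_mulrn ?powR_ge0// -powRrM mulrC. Qed.

(** [S0] is the cube root of 4 pi^2 tau / d. In terms of the cube roots of d, 2, pi and tau the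
    formula for the minimum is a rational identity, where 6 / 4^(2/3) = 3 / 2^(1/3). *)
Lemma kepler_period_exists (tau d : R) : 0 < tau -> 0 < d ->
  exists2 S0, 0 < S0 & d * S0 ^+ 3 = 4 * pi ^+ 2 * tau /\
    kepler_min tau S0 = d `^ (2 / 3) * 3 * 2 `^ (- 3^-1) * pi `^ (2 / 3) * tau `^ 3^-1.
Proof.
move=> tau0 d0; have two0 : 0 < (2 : R) by [].
have [D0 D3] := cube_root d0; have [T0 T3] := cube_root two0.
have [P0 P3] := cube_root (pi_gt0 R); have [Z0 Z3] := cube_root tau0.
rewrite !powR_two_thirds powRN /kepler_min.
move: D0 D3 T0 T3 P0 P3 Z0 Z3.
set D := d `^ _; set T := 2 `^ _; set P := pi `^ _; set Z := tau `^ _ => D0 D3 T0 T3 P0 P3 Z0 Z3.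
have nD : D != 0 by rewrite gt_eqF.
have nT : T != 0 by rewrite gt_eqF.
have nP : P != 0 by rewrite gt_eqF.
have nZ : Z != 0 by rewrite gt_eqF.
exists (T ^+ 2 * P ^+ 2 * Z / D).
  by rewrite divr_gt0// mulr_gt0// mulr_gt0 ?exprn_gt0.
clearbody D T P Z; rewrite -{1}D3 -P3 -Z3; split.
  transitivity (T ^+ 3 * T ^+ 3 * (P ^+ 3) ^+ 2 * Z ^+ 3); first by field.
  by rewrite T3; ring.
transitivity (3 * (T ^+ 3) * P ^+ 2 * Z * D ^+ 2 / (T ^+ 3 * T)).
  rewrite (_ : 3 * T ^+ 3 = 6); last by rewrite T3; ring.
  by field; rewrite nT nP nZ nD.
by field.
Qed.

Lemma C2_loop q : (forall i c, C2 (q i c)) -> C1_loop q /\ C1_loop (velocity q).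
Proof.
move=> H.
have D1 i c (t : R) : is_derive t 1 (q i c) (velocity q i c t).
  by rewrite /velocity derive1E; apply: derivableP; have [] := H i c.
have D2 i c (t : R) : is_derive t 1 (velocity q i c) (velocity (velocity q) i c t).
  by rewrite [velocity (velocity q) i c t]derive1E; apply: derivableP; have [_ []] := H i c.
split=> i c; split => //.
  by move=> t; exact: is_derive_continuous (D2 i c t).
by have [_ []] := H i c.
Qed.

(** Sides d_i / g with g^3 = w^2 satisfy delta_ij = w^2 l_ij^3, and the triangle inequalities
    survive the scaling. The frequency w = 2 pi s / tau gives one turn per period in the direction
    of [s]. *)
Lemma circular_exists m e (tau : R) (s : int) (d1 d2 d3 : R) : 0 < tau -> s = 1 \/ s = -1 ->
  \sum_(i < 3) m i = 1 -> 0 < d1 -> 0 < d2 -> 0 < d3 ->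
  delta m e b1 b2 = d1 ^+ 3 -> delta m e b2 b3 = d2 ^+ 3 -> delta m e b3 b1 = d3 ^+ 3 ->
  d3 < d1 + d2 -> d1 < d2 + d3 -> d2 < d3 + d1 ->
  exists2 q, Omega m tau s s s q & elliptic_triangle m e tau q.
Proof.
move=> tau0 s1 m1 d10 d20 d30 E1 E2 E3 t3 t1 t2.
pose w : R := 2 * pi * s%:~R / tau.
have wt : w * tau = 2 * pi * s%:~R by rewrite divfK// gt_eqF.
have w0 : 0 < w ^+ 2.
  have p0 := pi_gt0 R.
  rewrite lt_neqAle sqr_ge0 andbT eq_sym sqrf_eq0; apply/eqP => w0.
  by move: wt; rewrite w0 mul0r; case: s1 => ->; rewrite ?mulrNz ?mulr1z; lra.
have [g0 g3] := cube_root w0; move: (_ `^ _) g0 g3 => g g0 g3.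
have ng : g != 0 by rewrite gt_eqF.
have l0 d : 0 < d -> 0 < d / g by move=> ?; rewrite divr_gt0.
have tri x y z : x < y + z -> x / g < y / g + z / g by rewrite -mulrDl ltr_pM2r// invr_gt0.
have [a [com nc A1 A2 A3]] := triangle_exists m1 (l0 _ d10) (l0 _ d20) (l0 _ d30)
  (tri _ _ _ t3) (tri _ _ _ t1) (tri _ _ _ t2).
pose L (i j : 'I_3) := (a i x0 - a j x0) ^+ 2 + (a i x1 - a j x1) ^+ 2.
have Lsym i j : L i j = L j i by rewrite /L -(sqrrN (a i x0 - _)) -(sqrrN (a i x1 - _)) !opprB.
have main i j : cyclic_pair i j -> 0 < L i j /\ delta m e i j = w ^+ 2 * Num.sqrt (L i j) ^+ 3.
  have fact d : 0 < d -> 0 < (d / g) ^+ 2 /\ d ^+ 3 = w ^+ 2 * Num.sqrt ((d / g) ^+ 2) ^+ 3.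
    move=> d0; split; first by rewrite exprn_gt0// l0.
    rewrite sqrtr_sqr gtr0_norm ?l0// -g3; by field.
  by move=> /or3P[] /andP[/eqP-> /eqP->]; rewrite /L ?A1 ?A2 ?A3 ?E1 ?E2 ?E3; exact: fact.
have all i j : i != j -> 0 < L i j /\ delta m e i j = w ^+ 2 * Num.sqrt (L i j) ^+ 3.
  move=> ij; have [cyc|ncyc] := boolP (cyclic_pair i j); first exact: main.
  have [cyc|ncyc'] := boolP (cyclic_pair j i).
    by rewrite delta_sym Lsym; exact: main.
  exfalso; move: ij ncyc ncyc'.
  by case: i => [[|[|[|]]]] // ?; case: j => [[|[|[|]]]].
have [Oq Eq] := @circular_elliptic R m e tau s w a tau0 s1 m1 wt com nc
  (fun i j ij => (all i j ij).1) (fun i j ij => (all i j ij).2).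
by exists (circular w a).
Qed.

End Main.

Unset Implicit Arguments.

Theorem theorem2p3 (R : realType) (m e : 'I_3 -> R) (tau : R) (s : int) :
  (forall i, 0 < m i) -> \sum_(i < 3) m i = 1 ->
  0 < delta m e b1 b2 -> 0 < delta m e b2 b3 -> 0 < delta m e b3 b1 ->
  delta m e b1 b2 `^ 3^-1 + delta m e b2 b3 `^ 3^-1 > delta m e b3 b1 `^ 3^-1 ->
  delta m e b2 b3 `^ 3^-1 + delta m e b3 b1 `^ 3^-1 > delta m e b1 b2 `^ 3^-1 ->
  delta m e b3 b1 `^ 3^-1 + delta m e b1 b2 `^ 3^-1 > delta m e b2 b3 `^ 3^-1 ->
  0 < tau -> (s = 1 \/ s = -1) ->
  (* (i) *)
  ereal_inf (fvals m e tau s s s) =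
    ((m b1 * m b2 * delta m e b1 b2 `^ (2 / 3)
      + m b2 * m b3 * delta m e b2 b3 `^ (2 / 3)
      + m b3 * m b1 * delta m e b3 b1 `^ (2 / 3))
     * 3 * 2 `^ (- 3^-1) * pi `^ (2 / 3) * tau `^ 3^-1)%:E /\
  (* (ii) *)
  ((exists q v, Xset m tau s s s q v /\ elliptic_triangle m e tau q) /\
   forall q v, Xset m tau s s s q v -> elliptic_triangle m e tau q ->
     action m e tau q v = ereal_inf (fvals m e tau s s s)) /\
  (* (iii) *)
  (forall q v, Xset m tau s s s q v -> (forall i c, C2 (q i c)) ->
     action m e tau q v = ereal_inf (fvals m e tau s s s) ->
     elliptic_triangle m e tau q).
Proof.
move=> m0 m1 d12 d23 d31 t3 t1 t2 tau0 s1.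
have [S12 S12_gt0 [S12E V12]] := kepler_period_exists tau0 d12.
have [S23 S23_gt0 [S23E V23]] := kepler_period_exists tau0 d23.
have [S31 S31_gt0 [S31E V31]] := kepler_period_exists tau0 d31.
have [D1 D1E] := cube_root d12; have [D2 D2E] := cube_root d23; have [D3 D3E] := cube_root d31.
have [q0 Oq0 Eq0] := circular_exists tau0 s1 m1 D1 D2 D3 (esym D1E) (esym D2E) (esym D3E) t3 t1 t2.
have Xq0 := Omega_Xset tau0 Oq0.
have elliptic_min q v : Xset m tau s s s q v -> elliptic_triangle m e tau q ->
    action m e tau q v = (min_action m tau S12 S23 S31)%:E.
  move=> Xq Eq; have [Cq Cv cf kep en] := elliptic_triangle_facts tau0 m0 m1 Xq Eq.
  exact: (kepler_action_minimal m0 m1 d12 d23 d31 tau0 s1 S12_gt0 S23_gt0 S31_gt0 S12E S23E S31E Cq Xq cf Cv kep en).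
(* The rotating triangle attains the lower bound valid on the completion. *)
have infE : ereal_inf (fvals m e tau s s s) = (min_action m tau S12 S23 S31)%:E.
  apply/eqP; rewrite eq_le; apply/andP; split.
    apply: ereal_inf_lbound; exists q0, (velocity q0); split => //.
    by rewrite (elliptic_min _ _ Xq0 Eq0).
  apply: le_ereal_inf_tmp => _ [q [v [Xq ->]]].
  exact: (action_ge m0 m1 d12 d23 d31 tau0 s1 S12_gt0 S23_gt0 S31_gt0 S12E S23E S31E).
split.
  rewrite infE /min_action V12 V23 V31; congr EFin; ring.
split.
  split; first by exists q0, (velocity q0).
  by move=> q v Xq Eq; rewrite infE; exact: elliptic_min.
move=> q v Xq C2q AE; have [Cq Cv] := C2_loop C2q.
(* A minimizer has finite action, and being C^1 it then has no collision. *)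
have cf : forall t, collision_free q t.
  by apply: (no_collision tau0 m0 m1 d12 d23 d31 Cq Xq); rewrite AE infE ltry.
rewrite infE in AE.
have kep := action_minimal_kepler m0 m1 tau0 s1 S12_gt0 S23_gt0 S31_gt0 S12E S23E S31E Cq Xq cf Cv AE.
have per i c t : q i c (t + tau) = q i c t by exact: (Xset_periodic i c Xq).
have com c t : \sum_(i < 3) m i * q i c t = 0 by exact: Xset_center Xq.
exact: (kepler_pairs_elliptic tau0 m1 D1 D2 D3 (esym D1E) (esym D2E) (esym D3E) t3 t1 t2 Cq Cv cf per com kep).
Qed.
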